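(* Let $k$ be a number field, let $X\subset\mathbb{P}^2_k$ be an integral plane curve of degree $d$ and let $O:=(0:0:1)\in\mathbb{P}^2_k(k)$. Suppose that $X$ has multiplicity $m$ at $O$, that is, $m$ is the largest integer $n$ such that $\mathcal{I}_{X,O}\subset\mathfrak{m}_O^n$, where $\mathcal{I}_X\subset\mathcal{O}_{\mathbb{P}^2_k}$ is the defining ideal sheaf of $X$, $\mathcal{I}_{X,O}$ is its stalk at $O$ and $\mathfrak{m}_O$ is the maximal ideal of $\mathcal{O}_{\mathbb{P}^2_k,O}$. Let $h$ be the standard logarithmic height on $\mathbb{P}^2_k$, $$h((x:y:z))=\frac{1}{[L:k]}\sum_{w\in M_L}\log\max\{\|x\|_w,\|y\|_w,\|z\|_w\}$$ for a finite extension $L/k$ so large that $x,y,z\in L$. Let $h_O$ be a height function of $O$ regarded as a reduced closed subscheme of $\mathbb{P}^2_k$. Then, for every $\epsilon>0$, there exist constants $C_1,C_2>0$ such that for all $x\in(X\setminus\{O\})(\bar k)$, $$\left(\frac{m}{d}-\epsilon\right)h(x)-C_1\le h_O(x)\le\left(\frac{m}{d}+\epsilon\right)h(x)+C_2.$$ Moreover, if $X$ is rational (birational to $\mathbb{P}^1_k$), then on $(X\setminus\{O\})(\bar k)$ $$h_O(x)=\frac{m}{d}h(x)+O(1).$$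
   Context: For a number field $L\supset k$, $M_L$ is the set of places of $L$, and for $w\in M_L$ over a place $p$ of $\mathbb{Q}$ put $\|a\|_w=|a|_w^{[L_w:\mathbb{Q}_p]}$ with $|\cdot|_w$ extending $|\cdot|_p$. For an effective Cartier divisor $E$ on a projective variety over $k$, $\lambda_E$ is a Weil function: locally $\lambda_{E,w}(x)=-\log\|g(x)\|_w+\alpha_w(x)$, with $g$ a local equation of $E$ and $\alpha$ continuous and locally $M_k$-bounded. For a closed subscheme $Z$ written as a scheme-theoretic intersection of effective Cartier divisors $E_1,\dots,E_s$, put $\lambda_Z=\min_i\lambda_{E_i}$ (Silverman; well defined up to $M_k$-bounded functions). A height function of $Z$ is $h_Z(x)=\frac{1}{[L:k]}\sum_{w\in M_L}\lambda_{Z,w}(x)$, where $L/k$ is any finite extension containing the residue field $k(x)$; it is well defined up to bounded functions. The case $O\notin X$ is allowed, with $m=0$. *)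

(* Defs.v *)
From HB Require Import structures.
From mathcomp Require Import all_boot all_order all_algebra all_field.
From mathcomp Require Import mpoly.
From mathcomp Require Import boolp classical_sets fsbigop cardinality.
From mathcomp Require Import constructive_ereal reals ereal sequences exp.

Set Implicit Arguments.
Unset Strict Implicit.
Unset Printing Implicit Defensive.
Import Order.TTheory GRing.Theory Num.Theory.

Local Open Scope classical_set_scope.
Local Open Scope ring_scope.

Section Places.
Variable R : realType.

Definition absolute_value (K : fieldType) (w : K -> R) : Prop :=
  [/\ forall a, 0 <= w a,
      forall a, w a = 0 <-> a = 0,
      forall a b, w (a * b) = w a * w b
    & forall a b, w (a + b) <= w a + w b].

Definition padic_abs (p : nat) (q : rat) : R :=
  if q == 0 then 0
  else p%:R ^+ logn p `|denq q|%N / p%:R ^+ logn p `|numq q|%N.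

(* A place is identified with the unique absolute value representing it that
   extends either the usual absolute value of rat or one of the |.|_p. *)
Definition places (K : fieldType) : set (K -> R) :=
  [set w | absolute_value w /\
     ((forall q : rat, w (ratr q) = `|ratr q|) \/
      (exists2 p : nat, prime p &
         forall q : rat, w (ratr q) = padic_abs p q))].

Record completion (K : fieldType) (w : K -> R) := Completion {
  cpl_field : fieldType;
  cpl_abs : cpl_field -> R;
  cpl_emb : {rmorphism K -> cpl_field};
  cpl_absP : absolute_value cpl_abs;
  cpl_embP : forall a, cpl_abs (cpl_emb a) = w a;
  cpl_dense : forall y (e : R), 0 < e ->
    exists a, cpl_abs (y - cpl_emb a) < e;
  cpl_complete : forall u : nat -> cpl_field,
    (forall e : R, 0 < e -> exists N, forall i j, (N <= i)%N -> (N <= j)%N ->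
       cpl_abs (u i - u j) < e) ->
    exists l, forall e : R, 0 < e -> exists N, forall i, (N <= i)%N ->
       cpl_abs (u i - l) < e }.

(* Q_p (R when p = oo) is realized as the closure of Q in the completion. *)
Definition in_Qp (K : fieldType) (w : K -> R) (C : completion w)
    (y : cpl_field C) : Prop :=
  forall e : R, 0 < e -> exists q : rat, cpl_abs (y - ratr q) < e.

Definition is_local_degree (K : fieldType) (w : K -> R) (n : nat) : Prop :=
  exists (C : completion w) (b : 'I_n -> cpl_field C),
    forall y : cpl_field C,
      exists! c : {ffun 'I_n -> cpl_field C},
        (forall i, in_Qp (c i)) /\ y = \sum_(i < n) c i * b i.

(* [K_w : Q_p] *)
Definition local_degree (K : fieldType) (w : K -> R) : nat :=
  xget 0%N [set n | is_local_degree w n].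

(* ||a||_w *)
Definition nabs (K : fieldType) (w : K -> R) (a : K) : R :=
  w a ^+ local_degree w.

End Places.

Arguments places : clear implicits.

(* Points of P^2(L) are given by nonzero vectors of homogeneous coordinates.
   For k a number field, P^2(kbar) is the union of the P^2(L), L/k finite;
   a function on a subset of P^2(kbar) is a family of functions indexed by L. *)
Section Plane.
Variable k : fieldExtType rat.

Definition i0 : 'I_3 := @Ordinal 3 0 isT.
Definition i1 : 'I_3 := @Ordinal 3 1 isT.
Definition i2 : 'I_3 := @Ordinal 3 2 isT.

Definition point_O (K : fieldType) : 'I_3 -> K := fun i => (i == i2)%:R.

Definition nonzero_vec (K : fieldType) (x : 'I_3 -> K) : Prop :=
  exists i, x i != 0.

Definition same_point (K : fieldType) (x y : 'I_3 -> K) : Prop :=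
  exists2 c : K, c != 0 & forall i, x i = c * y i.

Definition eval_at (L : fieldExtType k) (G : {mpoly k[3]}) (x : 'I_3 -> L) : L :=
  (map_mpoly (in_alg L) G).@[x].

(* x is an L-point of X \ {O}, where X = V(F) *)
Definition on_curve_minus_O (F : {mpoly k[3]}) (L : fieldExtType k)
    (x : 'I_3 -> L) : Prop :=
  [/\ nonzero_vec x, eval_at F x = 0 & ~ same_point x (point_O L)].

Definition integral_plane_curve (F : {mpoly k[3]}) (d : nat) : Prop :=
  [/\ F \is d.-homog, F != 0, F \isn't a GRing.unit
    & forall A B : {mpoly k[3]}, F = A * B ->
        A \is a GRing.unit \/ B \is a GRing.unit].

(* The local ring of P^2 at O consists of the fractions G/H of forms of the
   same degree with H(O) != 0, inside the field of fractions of k[x,y,z]. *)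
Definition stalk_frac (P : {mpoly k[3]} -> Prop)
    (f : {fraction {mpoly k[3]}}) : Prop :=
  exists (e : nat) (G H : {mpoly k[3]}),
    [/\ G \is e.-homog, H \is e.-homog, H.@[point_O k] != 0,
        P G & f = tofrac G / tofrac H].

Definition local_ring_O := stalk_frac (fun _ => True).
Definition max_ideal_O := stalk_frac (fun G => G.@[point_O k] = 0).
Definition curve_ideal_O (F : {mpoly k[3]}) :=
  stalk_frac (fun G => exists Q, G = Q * F).

Definition max_ideal_pow_O (n : nat) (f : {fraction {mpoly k[3]}}) : Prop :=
  exists (N : nat) (r : 'I_N -> {fraction {mpoly k[3]}})
         (a : 'I_N -> 'I_n -> {fraction {mpoly k[3]}}),
    [/\ forall i, local_ring_O (r i), forall i j, max_ideal_O (a i j)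
      & f = \sum_(i < N) r i * \prod_(j < n) a i j].

Definition ideal_in_pow (F : {mpoly k[3]}) (n : nat) : Prop :=
  forall f, curve_ideal_O F f -> max_ideal_pow_O n f.

Definition multiplicity_at_O (F : {mpoly k[3]}) (m : nat) : Prop :=
  ideal_in_pow F m /\ forall n, ideal_in_pow F n -> (n <= m)%N.

(* A : P^1 --> X and B : X --> P^1 are rational maps, given by forms, such
   that both composites are defined and equal to the identity as rational
   maps. *)
Definition rational_curve (F : {mpoly k[3]}) : Prop :=
  exists (e f : nat) (A : 3.-tuple {mpoly k[2]}) (B : 2.-tuple {mpoly k[3]}),
    let in_F (P : {mpoly k[3]}) := exists Q, P = Q * F in
    let BA (i : 'I_2) := tnth B i \mPo A in
    let AB (i : 'I_3) := tnth A i \mPo B in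
    [/\ [/\ forall i, tnth A i \is e.-homog, exists i, tnth A i != 0
          & F \mPo A = 0],
        (forall i, tnth B i \is f.-homog) /\ (exists i, ~ in_F (tnth B i)),
        (exists i, BA i != 0) /\ (forall i j, BA i * 'X_j = BA j * 'X_i)
      & (exists i, ~ in_F (AB i)) /\
        (forall i j, in_F (AB i * 'X_j - AB j * 'X_i))].

(* A closed subscheme of P^2 is given by a list of forms generating its ideal
   sheaf.  On the chart x_j <> 0, a form G belongs to the ideal sheaf of T iff
   x_j^N G belongs to the ideal generated by T for some N. *)
Definition in_ideal (T : seq {mpoly k[3]}) (P : {mpoly k[3]}) : Prop :=
  exists c : 'I_(size T) -> {mpoly k[3]}, P = \sum_(i < size T) c i * T`_i.

Definition ideal_sheaf_le (S T : seq {mpoly k[3]}) : Prop :=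
  forall G, G \in S -> forall j : 'I_3, exists N : nat, in_ideal T ('X_j ^+ N * G).

Definition same_subscheme (S T : seq {mpoly k[3]}) : Prop :=
  ideal_sheaf_le S T /\ ideal_sheaf_le T S.

Definition subscheme_O : seq {mpoly k[3]} := [:: 'X_i0; 'X_i1].

(* Every effective Cartier divisor of P^2 is the zero scheme of a nonzero
   form. *)
Definition effective_divisor (G : {mpoly k[3]}) : Prop :=
  G != 0 /\ exists e : nat, G \is e.-homog.

End Plane.

Section Heights.
Variables (R : realType) (k : fieldExtType rat).

Definition place_fun (T : Type) :=
  forall L : fieldExtType k, (L -> R) -> ('I_3 -> L) -> T.

Definition place_restr (L : fieldExtType k) (w : L -> R) : k -> R :=
  fun a => w a%:A.

Definition Mk_constant (g : (k -> R) -> R) : Prop :=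
  finite_set [set v | places R k v /\ g v <> 0].

(* Affine coordinates on the chart x_j <> 0, with a 1 kept in position j *)
Definition chart (L : fieldExtType k) (j : 'I_3) (x : 'I_3 -> L) : 'I_3 -> L :=
  fun i => x i / x j.

(* The real number attached to (L, w, y) does not depend on the choice of L,
   up to the normalization by local degrees. *)
Definition compatible (j : 'I_3) (al : place_fun R) : Prop :=
  forall (L L' : fieldExtType k) (s : {lrmorphism L -> L'})
         (w : L -> R) (w' : L' -> R) (y : 'I_3 -> L),
    places R L w -> places R L' w' -> (forall a, w' (s a) = w a) -> y j = 1 ->
    al L' w' (fun i => s (y i)) / (local_degree w')%:R
      = al L w y / (local_degree w)%:R.

(* Continuity on U_j(kbar) for every place of kbar, where U_j is the chart
   x_j <> 0: the nearby point y' may be defined over a larger field L'. *)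
Definition chart_continuous (j : 'I_3) (al : place_fun R) : Prop :=
  forall (L : fieldExtType k) (w : L -> R) (y : 'I_3 -> L),
    places R L w -> y j = 1 ->
    forall e : R, 0 < e -> exists2 delta : R, 0 < delta &
      forall (L' : fieldExtType k) (s : {lrmorphism L -> L'})
             (w' : L' -> R) (y' : 'I_3 -> L'),
        places R L' w' -> (forall a, w' (s a) = w a) -> y' j = 1 ->
        (forall i, w' (y' i - s (y i)) < delta) ->
        `|al L' w' y' / (local_degree w')%:R
          - al L w y / (local_degree w)%:R| < e.

(* al is bounded by an M_k-constant on every affine M_k-bounded subset of U_j;
   an M_k-constant de acts on w | v through [L_w : Q_p] * de v, in accordance
   with the normalization of ||.||_w. *)
Definition locally_Mk_bounded (j : 'I_3) (al : place_fun R) : Prop :=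
  forall ga, Mk_constant ga -> exists2 de, Mk_constant de &
    forall (L : fieldExtType k) (w : L -> R) (y : 'I_3 -> L),
      places R L w -> y j = 1 ->
      (forall i, w (y i) <= expR (ga (place_restr w))) ->
      `|al L w y| <= (local_degree w)%:R * de (place_restr w).

(* Weil functions of the divisor V(G), with value +oo on V(G); a local equation
   on the chart x_j <> 0 is G(x_0/x_j, x_1/x_j, x_2/x_j).  Recall lne 0 = -oo. *)
Definition weil_function_divisor (G : {mpoly k[3]})
    (la : place_fun (\bar R)) : Prop :=
  forall j : 'I_3, exists al : place_fun R,
    [/\ compatible j al, chart_continuous j al, locally_Mk_bounded j al
      & forall (L : fieldExtType k) (w : L -> R) (x : 'I_3 -> L),
          places R L w -> x j != 0 ->
          la L w x = (- lne (nabs w (eval_at G (chart j x)))%:E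
                      + (al L w (chart j x))%:E)%E].

Definition weil_function_subscheme (T : seq {mpoly k[3]})
    (la : place_fun (\bar R)) : Prop :=
  exists (E : seq {mpoly k[3]}) (lE : nat -> place_fun (\bar R)),
    [/\ forall G, G \in E -> effective_divisor G,
        same_subscheme E T,
        forall i, (i < size E)%N -> weil_function_divisor E`_i (lE i)
      & forall (L : fieldExtType k) (w : L -> R) (x : 'I_3 -> L),
          la L w x = \big[Order.min/+oo%E]_(i < size E) lE i L w x].

Definition rel_degree (L : fieldExtType k) : nat := \dim {:L}.

Definition global_fun := forall L : fieldExtType k, ('I_3 -> L) -> R.

(* The function is only specified away from the subscheme. *)
Definition height_function (T : seq {mpoly k[3]}) (h : global_fun) : Prop :=
  exists2 la : place_fun (\bar R), weil_function_subscheme T la &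
    forall (L : fieldExtType k) (x : 'I_3 -> L),
      nonzero_vec x -> (exists2 G, G \in T & eval_at G x != 0) ->
      h L x = (\sum_(w \in places R L) fine (la L w x)) / (rel_degree L)%:R.

Definition std_height : global_fun := fun L x =>
  (\sum_(w \in places R L) ln (\big[Order.max/0]_(i < 3) nabs w (x i)))
    / (rel_degree L)%:R.

End Heights.

(* Main.v *)
Require Import Defs.
From HB Require Import structures.
From mathcomp Require Import all_boot all_order all_algebra all_field.
From mathcomp Require Import mpoly.
From mathcomp Require Import ring_quotient.
From mathcomp Require Import boolp classical_sets functions fsbigop cardinality.
From mathcomp Require Import constructive_ereal reals ereal topology normedtype.
From mathcomp Require Import sequences exp.
From mathcomp Require Import ring lra.
From mathcomp Require Import zify.

Set Implicit Arguments.
Unset Strict Implicit.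
Unset Printing Implicit Defensive.
Import Order.TTheory GRing.Theory Num.Theory.
Import numFieldNormedType.Exports.

Local Open Scope classical_set_scope.
Local Open Scope ring_scope.

(** Write [H2] for the height of [(x : y : z)] and [H1] for that of [(x : y)].
    The point O is the intersection of the lines [x = 0] and [y = 0], hence
    its Weil function at a place [w] is
    [log max(|x|, |y|, |z|) - log max(|x|, |y|)] up to a bounded error, and
    [h_O = H2 - H1 + O(1)] ([height_of_O]).  The theorem thus compares two
    projections of the curve to a line: the one from O, of degree
    [s = d - m], which computes [H1], and one from a point outside the curve,
    of degree [d], which computes [H2] ([projection_height]).  It says that
    [H1] is about [s / d] times [H2] ([relative_height]).

    In coordinates such that [(0 : 1 : 0)] is not on the curve, [v = z / x]
    and [t = y / x] satisfy an irreducible equation of degree [d] in [t] and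
    of degree [s] in [v]: the multiplicity at O is the least degree in [x, y]
    of a monomial of the equation ([multiplicity_monomials], [dehom_sizes]).
    Both inequalities between [H1 = h(t)] and [H2 = h(v) + O(1)] are instances
    of [bidegree_bound]: on a curve [G(t, z) = 0] of degree [n] in [z] and
    [s] in [t], the height of [z] is at most [s / n + eps] times that of [t].
    The reason is that, by linear algebra, there are combinations
    [phi_0, ..., phi_b] of the quotients of [G] by the powers of [z], with
    coefficients of degree at most [c = b s / n] in [t], that satisfy
    [z phi_l = phi_(l+1)] on the curve.  Their values have size at most
    [max(1, |t|)^(c + s)] at each place, and so has [z^b phi_0 = phi_b].
    When [phi_0] does not vanish at the point, summing over the places gives
    [b h(z) <= (c + s) h(t) + O(1)] by the product formula, and [b] is as
    large as one wishes.  The points where [phi_0] vanishes lie over the roots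
    of a fixed polynomial in [t] ([irreducible_elimination]) and have bounded
    height.

    If the curve is rational, all but finitely many of its points are images
    of parameters [t], and the heights of [(x : y : z)] and [(x : y)] are
    [e2 h(t) + O(1)] and [e1 h(t) + O(1)] for two integers
    ([morphism_height]).  Parameters of large height exist, and for them the
    first part forces [e1 = (s / d) e2].

    Heights are sums over the places of a number field, weighted by the local
    degrees, which are defined by completions.  They are computed by
    [place_heightE]: the places over [p] come from the embeddings of the field
    in a splitting field by restriction of one fixed absolute value, and the
    local degree counts the embeddings that induce the place
    ([places_structure]).  This rests on the extension of absolute values
    ([exists_over]), obtained as a minimal power-multiplicative norm, and on
    the approximation theorem, which bounds the sum of the local degrees from
    above.  Bounded errors are tracked by families of constants indexed by the
    places of the rationals that are equal to 1 at almost all places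
    ([adelic]), so that an inequality between sizes up to such constants
    becomes an inequality between heights up to a constant
    ([place_height_le]). *)

(** * Absolute values *)

Section AbsoluteValues.
Variables (R : realType) (K : fieldType) (w : K -> R).
Hypothesis absw : absolute_value w.

Lemma av_ge0 a : 0 <= w a. Proof. by case: absw. Qed.
Lemma av_eq0 a : w a = 0 <-> a = 0. Proof. by case: absw. Qed.
Lemma avM a b : w (a * b) = w a * w b. Proof. by case: absw. Qed.
Lemma avD a b : w (a + b) <= w a + w b. Proof. by case: absw. Qed.
Lemma av0 : w 0 = 0. Proof. exact/av_eq0. Qed.
Lemma av_neq0 a : a != 0 -> w a != 0.
Proof. by move=> a0; apply/eqP => /av_eq0/eqP; rewrite (negPf a0). Qed.
Lemma av_gt0 a : a != 0 -> 0 < w a.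
Proof. by move=> a0; rewrite lt_def av_neq0 // av_ge0. Qed.
Lemma av1 : w 1 = 1.
Proof.
have h := avM 1 1; rewrite mulr1 in h.
apply: (mulfI (av_neq0 (oner_neq0 K))); by rewrite mulr1.
Qed.
Lemma avX a n : w (a ^+ n) = w a ^+ n.
Proof. by elim: n => [|n IH]; rewrite ?expr0 ?av1 // !exprS avM IH. Qed.
Lemma avN a : w (- a) = w a.
Proof.
have w1 : w (-1) = 1.
  apply: (@pexpIrn _ 2); rewrite ?nnegrE ?ler01 ?av_ge0 //.
  by rewrite -avX sqrrN expr1n av1 expr1n.
by rewrite -mulN1r avM w1 mul1r.
Qed.
Lemma avB a b : w (a - b) <= w a + w b.
Proof. by rewrite -[w b]avN avD. Qed.
Lemma av_distC a b : w (a - b) = w (b - a).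
Proof. by rewrite -avN opprB. Qed.
Lemma avV a : w a^-1 = (w a)^-1.
Proof.
have [->|a0] := eqVneq a 0; first by rewrite invr0 av0 invr0.
apply: (mulfI (av_neq0 a0)); by rewrite -avM !divff ?av1 ?av_neq0.
Qed.
Lemma av_prod (I : finType) (F : I -> K) : w (\prod_i F i) = \prod_i w (F i).
Proof. exact: (big_morph w avM av1). Qed.
Lemma av_sum (I : Type) (r : seq I) (P : pred I) (F : I -> K) :
  w (\sum_(i <- r | P i) F i) <= \sum_(i <- r | P i) w (F i).
Proof.
elim/big_rec2: _ => [|i x y _ le]; first by rewrite av0.
by apply: le_trans (avD _ _) _; rewrite lerD2l.
Qed.
Lemma av_lerB a b : w a - w b <= w (a - b).
Proof. by rewrite lerBlDr; have := avD (a - b) b; rewrite subrK. Qed.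
Lemma av_natr n : w n%:R <= n%:R.
Proof.
elim: n => [|n IH]; first by rewrite av0.
by rewrite -natr1 -[in leRHS]natr1; apply: le_trans (avD _ _) _; rewrite av1 lerD2r.
Qed.

End AbsoluteValues.

(** The absolute value attached to [p]: the usual one when [p = 0], which
    stands for the infinite place, and the p-adic one otherwise. *)
Definition base_abs (R : realType) (p : nat) (q : rat) : R :=
  if p == 0%N then `|ratr q| else padic_abs R p q.

Definition is_base (p : nat) : bool := (p == 0%N) || prime p.

Definition lies_over (R : realType) (K : fieldType) (p : nat) (w : K -> R) : Prop :=
  absolute_value w /\ forall q : rat, w (ratr q) = base_abs R p q.

Lemma over_av (R : realType) (K : fieldType) p (w : K -> R) :
  lies_over p w -> absolute_value w.
Proof. by case. Qed.

Section BaseAbs.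
Variable R : realType.

Lemma padic_abs_frac p (a b : int) : prime p -> a != 0 -> b != 0 ->
  padic_abs R p (a%:~R / b%:~R)
  = p%:R ^+ logn p `|b|%N / p%:R ^+ logn p `|a|%N.
Proof.
move=> pp a0 b0; set q : rat := a%:~R / b%:~R.
have p0 : (p%:R : R) != 0 by rewrite pnatr_eq0 -lt0n prime_gt0.
have q0 : q != 0 by rewrite /q mulf_neq0 ?invr_eq0 ?intr_eq0.
rewrite /padic_abs (negPf q0).
apply/eqP; rewrite eqr_div ?expf_neq0 //; apply/eqP.
rewrite -!exprD -!lognM ?absz_gt0 ?numq_eq0 ?denq_neq0 //.
congr (_ ^+ logn _ _); rewrite -!abszM; congr absz.
have : (numq q)%:~R / (denq q)%:~R = q by rewrite divq_num_den.
rewrite [in X in _ = X]/q => /eqP; rewrite eqr_div ?intr_eq0 ?denq_neq0 //.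
by rewrite -!intrM eqr_int => /eqP e; first [lia | rewrite mulrC e mulrC | rewrite mulrC -e mulrC].
Qed.

Lemma padic_abs_int p (a : int) : prime p -> padic_abs R p a%:~R <= 1.
Proof.
move=> pp; have [->|a0] := eqVneq a 0; first by rewrite /padic_abs eqxx ler01.
have := @padic_abs_frac p a 1 pp a0 (oner_neq0 _).
rewrite divr1 => ->; rewrite logn1 expr0 div1r invf_le1.
  by rewrite exprn_ege1 // ler1n prime_gt0.
by rewrite exprn_gt0 // ltr0n prime_gt0.
Qed.

Lemma padic_absM p (x y : rat) : prime p ->
  padic_abs R p (x * y) = padic_abs R p x * padic_abs R p y.
Proof.
move=> pp.
have z : padic_abs R p 0 = 0 by rewrite /padic_abs eqxx.
have [->|x0] := eqVneq x 0; first by rewrite mul0r z mul0r.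
have [->|y0] := eqVneq y 0; first by rewrite mulr0 z mulr0.
rewrite -[x in LHS]divq_num_den -[y in LHS]divq_num_den mulf_div -!intrM.
rewrite padic_abs_frac ?mulf_neq0 ?numq_eq0 ?denq_neq0 //.
rewrite /padic_abs (negPf x0) (negPf y0) !abszM.
rewrite !lognM ?absz_gt0 ?numq_eq0 ?denq_neq0 // !exprD.
by rewrite mulf_div.
Qed.

Lemma padic_abs_ge0 p (x : rat) : 0 <= padic_abs R p x.
Proof. by rewrite /padic_abs; case: eqP => // _; rewrite divr_ge0 ?exprn_ge0. Qed.

Lemma padic_absD p (x y : rat) : prime p ->
  padic_abs R p (x + y) <= Num.max (padic_abs R p x) (padic_abs R p y).
Proof.
move=> pp.
have z : padic_abs R p 0 = 0 by rewrite /padic_abs eqxx.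
have g0 := padic_abs_ge0.
have [->|x0] := eqVneq x 0; first by rewrite add0r le_max lexx orbT.
have [->|y0] := eqVneq y 0; first by rewrite addr0 le_max lexx.
have [->|xy0] := eqVneq (x + y) 0; first by rewrite z le_max g0.
set b := denq x * denq y; set a1 := numq x * denq y : int; set a2 := numq y * denq x.
have b0 : b != 0 by rewrite mulf_neq0 ?denq_neq0.
have a10 : a1 != 0 by rewrite mulf_neq0 ?denq_neq0 ?numq_eq0.
have a20 : a2 != 0 by rewrite mulf_neq0 ?denq_neq0 ?numq_eq0.
have dx : (denq x)%:~R != 0 :> rat by rewrite intr_eq0 denq_neq0.
have dy : (denq y)%:~R != 0 :> rat by rewrite intr_eq0 denq_neq0.
have ex : x = a1%:~R / b%:~R.
  by rewrite -[LHS]divq_num_den /a1 /b !intrM; field; rewrite dx dy.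
have ey : y = a2%:~R / b%:~R.
  by rewrite -[LHS]divq_num_den /a2 /b !intrM; field; rewrite dx dy.
have exy : x + y = (a1 + a2)%:~R / b%:~R by rewrite ex ey -mulrDl -intrD.
have a120 : a1 + a2 != 0.
  by apply: contraNneq xy0 => h; rewrite exy h mul0r.
rewrite exy [in leRHS]ex [in leRHS]ey !padic_abs_frac //.
have p1 : 1 < p%:R :> R by rewrite ltr1n prime_gt1.
have ppos : 0 < p%:R :> R by rewrite ltr0n prime_gt0.
have key n1 n2 : (n1 <= n2)%N ->
   p%:R ^+ logn p `|b|%N / p%:R ^+ n2 <= p%:R ^+ logn p `|b|%N / p%:R ^+ n1 :> R.
  move=> le; rewrite ler_pM2l ?exprn_gt0 // lef_pV2 ?posrE ?exprn_gt0 //.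
  by rewrite ler_eXn2l.
rewrite le_max.
have : (minn (logn p `|a1|%N) (logn p `|a2|%N) <= logn p `|(a1 + a2)%R|%N)%N.
  set n := minn _ _.
  rewrite -pfactor_dvdn ?absz_gt0 //.
  have d1 : (p ^ n %| `|a1|%N)%N by rewrite pfactor_dvdn ?absz_gt0 // geq_minl.
  have d2 : (p ^ n %| `|a2|%N)%N by rewrite pfactor_dvdn ?absz_gt0 // geq_minr.
  have : (Posz (p ^ n)%N %| a1 + a2)%Z by apply: rpredD.
  by rewrite /dvdz.
by rewrite geq_min => /orP[]/key ->; rewrite ?orbT.
Qed.

Lemma base_abs_valued p : is_base p -> absolute_value (base_abs R p).
Proof.
case/orP => [/eqP -> | pp].
  split=> [a|a|a b|a b]; rewrite /base_abs /=.
  - exact: normr_ge0.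
  - split=> [/normr0_eq0/eqP|->]; last by rewrite rmorph0 normr0.
    by rewrite fmorph_eq0 => /eqP.
  - by rewrite rmorphM normrM.
  - by rewrite rmorphD ler_normD.
have p0 : (p == 0%N) = false by case: p pp.
split=> [a|a|a b|a b]; rewrite /base_abs p0.
- exact: padic_abs_ge0.
- split=> [|->]; last by rewrite /padic_abs eqxx.
  rewrite /padic_abs; case: eqP => // _ /eqP.
  by rewrite mulf_eq0 invr_eq0 !expf_eq0 !pnatr_eq0 p0 !andbF.
- exact: padic_absM.
- apply: le_trans (padic_absD _ _ pp) _.
  by rewrite ge_max lerDl lerDr !padic_abs_ge0.
Qed.

(** A rational number that witnesses that the absolute value is not trivial. *)
Definition base_big (p : nat) : rat := if p == 0%N then 2 else p%:R^-1.

Lemma base_big_gt1 p : is_base p -> 1 < base_abs R p (base_big p).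
Proof.
rewrite /is_base /base_abs /base_big; case: eqP => /= [_ _|p0 pp].
  by rewrite ratr_nat normr_nat ltr1n.
have := @padic_abs_frac p 1 p%:Z pp (oner_neq0 _).
rewrite div1r => -> //; last by case: p pp p0.
rewrite logn1 expr0 divr1 absz_nat -[X in logn _ X]expn1 pfactorK // expr1.
by rewrite ltr1n prime_gt1.
Qed.

Lemma base_abs_int p (a : int) : prime p -> base_abs R p a%:~R <= 1.
Proof.
by move=> pp; rewrite /base_abs; case: eqP pp => [->|_ /padic_abs_int->].
Qed.

Lemma places_over (K : fieldType) (w : K -> R) :
  places R K w <-> exists2 p, is_base p & lies_over p w.
Proof.
split.
  case=> aw [h|[p pp h]].
    by exists 0%N => //; split=> // q; rewrite /base_abs /=.
  exists p; first by rewrite /is_base pp orbT.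
  by split=> // q; rewrite /base_abs; case: eqP pp => [->|].
case=> p bp [aw h]; split => //; case/orP: bp => [/eqP p0|pp].
  by left=> q; rewrite h p0 /base_abs.
right; exists p => // q; rewrite h /base_abs; by case: eqP pp => [->|].
Qed.

End BaseAbs.
Section RealTools.
Variable R : realType.
Implicit Types (x e : R) (E : set R).

Lemma expr_unbounded x B : 1 < x -> exists n, B < x ^+ n.
Proof.
move=> x1.
have bern n : 1 + n%:R * (x - 1) <= x ^+ n.
  elim: n => [|n IH]; first by rewrite mul0r addr0 expr0.
  rewrite exprSr; apply: (@le_trans _ _ ((1 + n%:R * (x - 1)) * x)).
    rewrite -natr1 -subr_ge0 [X in 0 <= X](_ : _ = n%:R * (x - 1) ^+ 2); last by ring.
    by rewrite mulr_ge0 // sqr_ge0.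
  by rewrite ler_wpM2r // ltW // (lt_trans ltr01).
exists (Num.bound `|B / (x - 1)|); apply: lt_le_trans (bern _).
have : B / (x - 1) < (Num.bound `|B / (x - 1)|)%:R.
  by apply: le_lt_trans (ler_norm _) _; exact/archi_boundP/normr_ge0.
by rewrite ltr_pdivrMr ?subr_gt0 // => h; rewrite ltr_wpDl.
Qed.

Lemma expr_small x e : 0 <= x < 1 -> 0 < e -> exists n, x ^+ n < e.
Proof.
move=> /andP[x0 x1] e0; have [->|xn0] := eqVneq x 0.
  by exists 1%N; rewrite expr1.
have xp : 0 < x by rewrite lt_def xn0.
have [|n hn] := @expr_unbounded x^-1 e^-1; first by rewrite invf_gt1.
by exists n; rewrite -ltf_pV2 ?posrE ?exprn_gt0 // -exprVn.
Qed.

Lemma nneg_inf_le E e : (forall y, E y -> 0 <= y) -> E e -> inf E <= e.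
Proof. by move=> E0 Ee; apply: ge_inf => //; exists 0. Qed.

Lemma nneg_inf_lt E e : (forall y, E y -> 0 <= y) -> (exists y, E y) ->
  inf E < e -> exists2 y, E y & y < e.
Proof.
move=> E0 En lt; have d0 : 0 < e - inf E by rewrite subr_gt0.
have [|y Ey] := @inf_adherent R E _ d0; first by split=> //; exists 0.
by rewrite addrC subrK => h; exists y.
Qed.

Lemma le_prod_eps a b c : 0 <= b -> 0 <= c ->
  (forall e, 0 < e -> a <= (b + e) * (c + e)) -> a <= b * c.
Proof.
move=> b0 c0 h; apply/ler_addgt0Pl => d d0.
pose e := Num.min 1 (d / (b + c + 1)).
have s0 : 0 < b + c + 1 by lra.
have e0 : 0 < e by rewrite lt_min ltr01 divr_gt0.
have e1 : e <= 1 by rewrite ge_min lexx.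
have e2 : e * (b + c + 1) <= d by rewrite -ler_pdivlMr // ge_min lexx orbT.
apply: le_trans (h e e0) _; nra.
Qed.
End RealTools.

(** * Existence of places *)

Section PowerMultiplicative.
Variables (R : realType) (K : fieldExtType rat) (v : rat -> R).
Hypothesis absv : absolute_value v.

(** Power-multiplicative norms on [K] bounded by [v] on the rationals.  The
    minimal ones among them turn out to be multiplicative. *)
Record pm_norm (N : K -> R) : Prop := PmNorm {
  pm_ge0 : forall x, 0 <= N x;
  pm1 : N 1 = 1;
  pmD : forall x y, N (x + y) <= N x + N y;
  pmM : forall x y, N (x * y) <= N x * N y;
  pm_sqr : forall x, N x ^+ 2 <= N (x ^+ 2);
  pm_rat : forall q, N q%:A <= v q }.

Lemma pm_norm_gt0 N a : pm_norm N -> a != 0 -> 0 < N a.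
Proof.
move=> pN a0; rewrite lt_def pm_ge0 // andbT; apply: contraTneq isT => Na.
have := pmM pN a a^-1; rewrite divff // pm1 // Na mul0r; lra.
Qed.

Lemma pm_normX N a n : pm_norm N -> a != 0 -> N (a ^+ n) = N a ^+ n.
Proof.
move=> pN a0; have leX k : N (a ^+ k) <= N a ^+ k.
  elim: k => [|k IH]; first by rewrite !expr0 pm1.
  rewrite !exprS; apply: le_trans (pmM pN _ _) _.
  by rewrite ler_wpM2l // pm_ge0.
have ge2 k : N a ^+ (2 ^ k) <= N (a ^+ (2 ^ k)).
  elim: k => [|k IH]; first by rewrite expn0 !expr1.
  rewrite expnSr !exprM; apply: le_trans (pm_sqr pN _).
  by rewrite ler_pXn2r ?nnegrE ?exprn_ge0 ?pm_ge0.
apply/eqP; rewrite eq_le leX /=.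
have le2 : (n <= 2 ^ n)%N by rewrite ltnW // ltn_expl.
rewrite -(@ler_pM2r _ (N a ^+ (2 ^ n - n))) ?exprn_gt0 ?pm_norm_gt0 //.
rewrite -exprD subnKC //; apply: le_trans (ge2 n) _.
rewrite -{1}(subnKC le2) exprD; apply: le_trans (pmM pN _ _) _.
by rewrite ler_wpM2l ?pm_ge0.
Qed.

(** The properties of a power-multiplicative norm survive in the infimum of a
    directed family, even when the product and the square change the index. *)
Lemma pm_norm_inf (I : Type) (i0 : I) (f : I -> K -> R) :
  (forall i x, 0 <= f i x) -> (forall i, f i 1 = 1) ->
  (forall i j, exists k, (forall x, f k x <= f i x) /\ (forall x, f k x <= f j x)) ->
  (forall i x y, f i (x + y) <= f i x + f i y) ->
  (forall i x y, exists j, f j (x * y) <= f i x * f i y) ->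
  (forall i x, exists j, f j x ^+ 2 <= f i (x ^+ 2)) ->
  (forall i q, f i q%:A <= v q) ->
  pm_norm (fun x => inf (range (f ^~ x))).
Proof.
move=> f0 f1 dir fD fM fS fq.
have p0 x y : range (f ^~ x) y -> 0 <= y by case=> i _ <-.
have ex x : exists y, range (f ^~ x) y by exists (f i0 x); exists i0.
have lei i x : inf (range (f ^~ x)) <= f i x.
  by apply: nneg_inf_le; [exact: p0 | exists i].
have lti x e : inf (range (f ^~ x)) < e -> exists i, f i x < e.
  by move/(nneg_inf_lt (@p0 x) (ex x)) => [_ [i _ <-]]; exists i.
have gei x b : (forall i, b <= f i x) -> b <= inf (range (f ^~ x)).
  by move=> h; apply: lb_le_inf; [exact: ex | move=> _ [i _ <-]].
have i_ge0 x : 0 <= inf (range (f ^~ x)) by apply: gei.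
split=> //.
- apply/eqP; rewrite eq_le -[X in _ <= X](f1 i0) lei.
  by apply: gei => i; rewrite f1.
- move=> x y; apply/ler_addgt0Pl => e e0.
  have [|i hi] := lti x (inf (range (f ^~ x)) + e / 2); first by lra.
  have [|j hj] := lti y (inf (range (f ^~ y)) + e / 2); first by lra.
  have [k [ki kj]] := dir i j.
  apply: le_trans (lei k _) _; apply: le_trans (fD _ _ _) _.
  by have := ki x; have := kj y; lra.
- move=> x y; apply: le_prod_eps => // e e0.
  have [|i hi] := lti x (inf (range (f ^~ x)) + e); first by lra.
  have [|j hj] := lti y (inf (range (f ^~ y)) + e); first by lra.
  have [k [ki kj]] := dir i j; have [l hl] := fM k x y.
  apply: le_trans (lei l _) _; apply: le_trans hl _.
  apply: ler_pM => //; [have := ki x | have := kj y]; lra.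
- move=> x; apply: gei => i; have [j hj] := fS i x; apply: le_trans hj.
  by rewrite ler_pXn2r ?nnegrE.
- by move=> q; apply: le_trans (lei i0 _) (fq _ _).
Qed.

(** Replacing [N x] by the limit of [N (x * a ^+ n) / N a ^+ n] produces a
    smaller norm, for which multiplication by [a] scales: so a minimal norm
    was multiplicative in the first place. *)
Lemma minimal_pm_norm N : pm_norm N ->
  (forall N', pm_norm N' -> (forall x, N' x <= N x) -> forall x, N x <= N' x) ->
  absolute_value N /\ forall q, N q%:A = v q.
Proof.
move=> pN minN.
have NM x a : a != 0 -> N (x * a) = N x * N a.
  move=> a0; have Na := pm_norm_gt0 pN a0.
  pose f n x := N (x * a ^+ n) / N a ^+ n.
  have decr n m y : (n <= m)%N -> f m y <= f n y.
    move=> /subnKC <-; rewrite /f exprD mulrA [in X in _ / X]exprD.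
    rewrite ler_pdivrMr ?mulr_gt0 ?exprn_gt0 //.
    rewrite mulrA divfK ?lt0r_neq0 ?exprn_gt0 //.
    by apply: le_trans (pmM pN _ _) _; rewrite pm_normX.
  have pf : pm_norm (fun x => inf (range (f ^~ x))).
    apply: (@pm_norm_inf _ 0%N).
    - by move=> i y; rewrite /f divr_ge0 ?exprn_ge0 ?pm_ge0.
    - by move=> i; rewrite /f mul1r pm_normX // divff // lt0r_neq0 ?exprn_gt0.
    - move=> i j; exists (maxn i j).
      by split=> y; apply: decr; rewrite ?leq_maxl ?leq_maxr.
    - move=> i y z; rewrite /f -mulrDl ler_wpM2r ?invr_ge0 ?exprn_ge0 ?pm_ge0 //.
      by rewrite mulrDl pmD.
    - move=> i y z; exists (i + i)%N; rewrite /f !exprD.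
      rewrite mulf_div ler_wpM2r ?invr_ge0 ?mulr_ge0 ?exprn_ge0 ?pm_ge0 //.
      by rewrite mulrACA pmM.
    - move=> i y; exists i; apply: le_trans (decr i (i + i)%N _ (leq_addr _ _)).
      rewrite /f expr_div_n -exprM muln2 -addnn.
      rewrite ler_wpM2r ?invr_ge0 ?exprn_ge0 ?pm_ge0 //.
      by rewrite exprD -expr2 -exprMn pm_sqr.
    - move=> i q; apply: le_trans (decr 0%N i _ (leq0n _)) _.
      by rewrite /f !expr0 mulr1 divr1 pm_rat.
  have nn y z : range (f ^~ y) z -> 0 <= z.
    by case=> i _ <-; rewrite /f divr_ge0 ?exprn_ge0 ?pm_ge0.
  have low y : inf (range (f ^~ y)) <= N y.
    apply: nneg_inf_le; first exact: nn.
    by exists 0%N => //; rewrite /f !expr0 mulr1 divr1.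
  have up := minN _ pf low x.
  apply/eqP; rewrite eq_le pmM //= -ler_pdivlMr //; apply: le_trans up _.
  by apply: nneg_inf_le; [exact: nn | exists 1%N => //; rewrite /f !expr1].
have N0 : N 0 = 0.
  apply/eqP; rewrite eq_le pm_ge0 // andbT -(av0 absv).
  by have := pm_rat pN 0; rewrite scale0r.
split.
  split.
  - exact: pm_ge0.
  - move=> a; split=> [Na|->] //; apply/eqP; apply: contraTT isT => a0.
    by have := pm_norm_gt0 pN a0; rewrite Na ltxx.
  - move=> a b; have [->|b0] := eqVneq b 0; first by rewrite mulr0 N0 mulr0.
    exact: NM.
  - exact: pmD.
move=> q; have [->|q0] := eqVneq q 0; first by rewrite scale0r N0 av0.
have qA0 : q^-1%:A != 0 :> K by rewrite scaler_eq0 invr_eq0 negb_or q0 oner_neq0.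
apply/eqP; rewrite eq_le pm_rat //=.
rewrite -(@ler_pM2r _ (v q^-1)) ?(av_gt0 absv) ?invr_eq0 //.
rewrite -(avM absv) divff // (av1 absv).
have e1 : q%:A * q^-1%:A = 1 :> K.
  by rewrite -scalerAl mul1r scalerA divff // scale1r.
have := NM q%:A _ qA0; rewrite e1 pm1 // => ->.
by rewrite ler_wpM2l ?pm_ge0 ?pm_rat.
Qed.

Lemma exists_minimal_pm_norm N0 : pm_norm N0 -> exists2 N, pm_norm N &
  forall N', pm_norm N' -> (forall x, N' x <= N x) -> forall x, N x <= N' x.
Proof.
move=> pN0; pose T := {N | pm_norm N}.
pose le (s t : T) := `[< forall x, sval t x <= sval s x >].
have [|s t u|A tot|[N pN] minN] := @ZL_preorder T (exist _ N0 pN0) le.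
- by move=> t; apply/asboolP.
- by move=> /asboolP h1 /asboolP h2; apply/asboolP => x; exact: le_trans (h1 x).
- have [[t0 At0]|nA] := pselect (exists t, A t); last first.
    by exists (exist _ N0 pN0) => s As; case: nA; exists s.
  pose I := {t | A t}; pose f (i : I) := sval (sval i).
  have pf i : pm_norm (f i) := svalP (sval i).
  have pinf : pm_norm (fun x => inf (range (f ^~ x))).
    apply: (@pm_norm_inf _ (exist _ t0 At0)).
    - by move=> i x; apply: pm_ge0.
    - by move=> i; apply: pm1.
    - move=> i j; have [/asboolP h|/asboolP h] := tot _ _ (svalP i) (svalP j).
        by exists j; split.
      by exists i; split.
    - by move=> i x y; apply: pmD.
    - by move=> i x y; exists i; apply: pmM.
    - by move=> i x; exists i; apply: pm_sqr.
    - by move=> i q; apply: pm_rat.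
  exists (exist _ _ pinf) => s As; apply/asboolP => x /=.
  apply: nneg_inf_le; first by move=> _ [i _ <-]; apply: pm_ge0.
  by exists (exist _ s As).
exists N => // N' pN' h.
by have /asboolP := minN (exist _ N' pN') (asboolT h).
Qed.

(** The coordinates in a basis give a norm that is submultiplicative up to a
    constant; its spectral radius is power-multiplicative. *)
Lemma exists_pm_norm : exists N, pm_norm N.
Proof.
pose n := \dim {:K}; pose b := vbasis {:K}.
pose c (i : 'I_n) (x : K) : rat := coord b i x.
pose N x := \sum_i v (c i x).
have N_ge0 x : 0 <= N x by apply: sumr_ge0 => i _; apply: av_ge0.
have ND x y : N (x + y) <= N x + N y.
  rewrite -big_split /=; apply: ler_sum => i _.
  by rewrite /c linearD; apply: avD.
have NZ q x : N (q *: x) = v q * N x.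
  rewrite mulr_sumr; apply: eq_bigr => i _.
  by rewrite /c linearZ /= avM.
have decomp x : x = \sum_i c i x *: b`_i by apply: coord_vbasis; rewrite memvf.
have Nsum (J : finType) (F : J -> K) : N (\sum_j F j) <= \sum_j N (F j).
  elim/big_rec2: _ => [|i x y _ le].
    by rewrite -[0](scale0r 0) NZ av0 // mul0r.
  by apply: le_trans (ND _ _) _; rewrite lerD2l.
have N1 : 0 < N 1.
  rewrite lt_def N_ge0 andbT; apply/eqP => h.
  have : forall i, c i 1 = 0.
    move=> i; apply/(av_eq0 absv); apply/eqP; move/eqP: h.
    by rewrite psumr_eq0 => [/allP/(_ i)/implyP|j _]; rewrite ?mem_index_enum ?av_ge0 //; apply.
  move=> hc; have := decomp 1; rewrite big1 => [/eqP|i _]; last by rewrite hc scale0r.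
  by rewrite oner_eq0.
pose C := 1 + \sum_(i < n) \sum_(j < n) N (b`_i * b`_j).
have C1 : 1 <= C by rewrite lerDl; do 2![apply: sumr_ge0 => ? _].
have NM x y : N (x * y) <= C * N x * N y.
  rewrite {1}(decomp x) {1}(decomp y) mulr_suml.
  apply: le_trans (Nsum _ _) _.
  rewrite -mulrA [N x * _]mulr_suml mulr_sumr; apply: ler_sum => i _.
  rewrite mulr_sumr; apply: le_trans (Nsum _ _) _.
  rewrite mulrA [leRHS]mulr_sumr; apply: ler_sum => j _.
  rewrite -scalerAl -scalerAr !NZ [leRHS](_ : _ = v (c i x) * (v (c j y) * C)); last by ring.
  rewrite !ler_wpM2l ?av_ge0 //.
  rewrite /C (bigD1 i) //= (bigD1 j) //=.
  have h1 : 0 <= \sum_(i0 < n | i0 != j) N (b`_i * b`_i0) by apply: sumr_ge0.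
  have h2 : 0 <= \sum_(i0 < n | i0 != i) \sum_(j0 < n) N (b`_i0 * b`_j0).
    by do 2![apply: sumr_ge0 => ? _].
  lra.
pose S x := [set s | 0 < s /\ exists D, forall k, N (x ^+ k) <= D * s ^+ k].
have SD x y s t : S x s -> S y t -> S (x + y) (s + t).
  move=> [s0 [D1 h1]] [t0 [D2 h2]]; split; first exact: addr_gt0.
  have D10 : 0 <= D1.
    by have := le_trans (N_ge0 _) (h1 0%N); rewrite expr0 mulr1.
  have D20 : 0 <= D2.
    by have := le_trans (N_ge0 _) (h2 0%N); rewrite expr0 mulr1.
  exists (C * D1 * D2) => k; rewrite !exprDn.
  apply: le_trans (Nsum _ _) _; rewrite mulr_sumr; apply: ler_sum => i _.
  rewrite -scaler_nat NZ.
  apply: (@le_trans _ _ (('C(k, i))%:R * N (x ^+ (k - i) * y ^+ i))).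
    by rewrite ler_wpM2r // av_natr.
  rewrite [leRHS](_ : _ = ('C(k, i))%:R * (C * D1 * D2 * (s ^+ (k - i) * t ^+ i)));
    last by rewrite -mulr_natl; ring.
  rewrite ler_wpM2l ?ler0n //.
  apply: le_trans (NM _ _) _.
  rewrite [leRHS](_ : _ = C * (D1 * s ^+ (k - i)) * (D2 * t ^+ i)); last by ring.
  apply: ler_pM => //; first by rewrite mulr_ge0 // ?N_ge0 //; lra.
  by rewrite ler_wpM2l //; lra.
have SM x y s t : S x s -> S y t -> S (x * y) (s * t).
  move=> [s0 [D1 h1]] [t0 [D2 h2]]; split; first exact: mulr_gt0.
  exists (C * D1 * D2) => k; rewrite !exprMn.
  apply: le_trans (NM _ _) _.
  rewrite [leRHS](_ : _ = C * (D1 * s ^+ k) * (D2 * t ^+ k)); last by ring.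
  apply: ler_pM => //; first by rewrite mulr_ge0 // ?N_ge0 //; lra.
  by rewrite ler_wpM2l //; lra.
have SS x s : S (x ^+ 2) s -> S x (Num.sqrt s).
  move=> [s0 [D h]]; split; first by rewrite sqrtr_gt0.
  have D0 : 0 <= D.
    by have := le_trans (N_ge0 _) (h 0%N); rewrite expr0 mulr1.
  exists (D + C * N x * D / Num.sqrt s) => k.
  have sq : Num.sqrt s ^+ 2 = s by rewrite sqr_sqrtr // ltW.
  have sp : 0 < Num.sqrt s by rewrite sqrtr_gt0.
  rewrite -[k]odd_double_half; case: (odd k); rewrite ?add1n ?add0n.
    rewrite [Num.sqrt s ^+ _]exprS mulrA mulrDl divfK ?gt_eqF //.
    rewrite -mul2n [_ ^+ (2 * _)]exprM sq exprS exprM.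
    apply: le_trans (NM _ _) _; rewrite mulrDl ler_wpDl //.
      by rewrite !mulr_ge0 ?exprn_ge0 // ltW.
    by rewrite -[leRHS]mulrA ler_wpM2l // mulr_ge0 //; lra.
  rewrite -mul2n !exprM sq; apply: le_trans (h _) _.
  rewrite ler_wpM2r ?exprn_ge0 ?(ltW s0) // lerDl.
  by rewrite !mulr_ge0 ?invr_ge0 ?(ltW sp) //; lra.
have ex x : exists s, S x s.
  exists (C * N x + 1); split; first by rewrite ltr_wpDl // mulr_ge0 //; lra.
  exists (N 1); elim=> [|k IH]; first by rewrite !expr0 mulr1.
  rewrite exprS [_ ^+ k.+1]exprS; apply: le_trans (NM _ _) _.
  have := N_ge0 x; have := N_ge0 (x ^+ k) => h1 h2.
  rewrite mulrCA; apply: ler_pM => //; first by rewrite mulr_ge0 //; lra.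
  by rewrite lerDl.
have S0 x s : S x s -> 0 <= s by case=> /ltW.
have lei x s : S x s -> inf (S x) <= s by move=> h; apply: nneg_inf_le (@S0 x) h.
have i_ge0 x : 0 <= inf (S x) by apply: lb_le_inf => // s /S0.
have lti x e : inf (S x) < e -> exists2 s, S x s & s < e.
  exact: nneg_inf_lt (@S0 x) (ex x).
exists (fun x => inf (S x)); split=> //.
- apply/eqP; rewrite eq_le; apply/andP; split.
    by apply: lei; split=> //; exists (N 1) => k; rewrite !expr1n mulr1.
  apply: lb_le_inf => // s [s0 [D h]]; rewrite leNgt; apply/negP => s1.
  have D0 : 0 < D.
    by have := h 0%N; rewrite !expr0 mulr1; apply: lt_le_trans.
  have [||k] := @expr_small R s (N 1 / D); rewrite ?(ltW s0) ?divr_gt0 //.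
  rewrite ltr_pdivlMr // mulrC => lt; have := h k; rewrite expr1n.
  by rewrite leNgt lt.
- move=> x y; apply/ler_addgt0Pl => e e0.
  have [|s Ss hs] := lti x (inf (S x) + e / 2); first by lra.
  have [|t St ht] := lti y (inf (S y) + e / 2); first by lra.
  by have := lei _ _ (SD _ _ _ _ Ss St); lra.
- move=> x y; apply: le_prod_eps => // e e0.
  have [|s Ss hs] := lti x (inf (S x) + e); first by lra.
  have [|t St ht] := lti y (inf (S y) + e); first by lra.
  apply: le_trans (lei _ _ (SM _ _ _ _ Ss St)) _.
  by apply: ler_pM; rewrite ?(S0 _ _ Ss) ?(S0 _ _ St) ?ltW.
- move=> x; apply: lb_le_inf => // s Ss.
  rewrite -[leRHS]sqr_sqrtr ?(S0 _ _ Ss) // ler_pXn2r ?nnegrE ?sqrtr_ge0 //.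
  exact/lei/SS.
- move=> q; apply/ler_addgt0Pl => e e0; apply: lei; split.
    by rewrite ltr_pwDl ?av_ge0.
  exists (N 1) => k; have -> : q%:A ^+ k = q ^+ k *: 1 :> K.
    by rewrite -(rmorphXn (in_alg K)).
  rewrite NZ mulrC ler_wpM2l // (avX absv).
  by apply: lerXn2r; rewrite ?nnegrE ?addr_ge0 ?av_ge0 ?lerDr ?lerDl // ltW.
Qed.

End PowerMultiplicative.

Lemma exists_over (R : realType) (K : fieldExtType rat) p :
  is_base p -> exists w : K -> R, lies_over p w.
Proof.
move=> bp; have av := base_abs_valued R bp.
have [N0 pN0] := exists_pm_norm K av.
have [N pN minN] := exists_minimal_pm_norm pN0.
have [aN hN] := minimal_pm_norm av pN minN.
by exists N; split=> // q; rewrite -alg_num_field.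
Qed.
(** * Approximation *)

Lemma linear_dependence (F : fieldType) (V : vectType F) (J : finType) (x : J -> V) :
  (\dim {:V} < #|J|)%N -> exists2 q : J -> F, (exists j, q j != 0) & \sum_j q j *: x j = 0.
Proof.
move=> lt.
pose X := [tuple x (enum_val i) | i < #|J|].
have nf : ~~ free X.
  apply: contraL lt; rewrite /free size_tuple => /eqP <-.
  by rewrite -leqNgt dimvS // subvf.
have [k [hk [i ki]]] : exists k : 'I_#|J| -> F,
    \sum_i k i *: X`_i = 0 /\ exists i, k i != 0.
  apply: contraNP nf => h; apply/freeP => k hk i; apply/eqP/negPn/negP => ki.
  by apply: h; exists k; split=> //; exists i.
exists (k \o enum_rank); first by exists (enum_val i); rewrite /= enum_valK.
rewrite (reindex _ (onW_bij _ (enum_val_bij J))) /= -[RHS]hk.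
by apply: eq_bigr => l _; rewrite enum_valK -tnth_nth tnth_mktuple.
Qed.

Section Approximation.
Variables (R : realType) (K : fieldExtType rat) (p : nat).
Hypothesis basep : is_base p.
Implicit Types (w : K -> R) (a b c x : K).

Hint Resolve over_av : core.

Lemma over_alg w q : lies_over p w -> w q%:A = base_abs R p q.
Proof. by case=> _ h; rewrite alg_num_field h. Qed.

Lemma overZ w q x : lies_over p w -> w (q *: x) = base_abs R p q * w x.
Proof. by move=> ow; rewrite -mulr_algl (avM (over_av ow)) over_alg. Qed.

Lemma base_ln_mulz (n : int) : exists2 q : rat, q != 0 &
  ln (base_abs R p q) = n%:~R * ln (base_abs R p (base_big p)).
Proof.
have av := base_abs_valued R basep.
have b1 := base_big_gt1 R basep; set b := base_big p in b1 *.
have b0 : b != 0 by apply: contraTneq b1 => ->; rewrite (av0 av) ltNge ler01.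
have bp := av_gt0 av b0.
case: n => n; first exists (b ^+ n); last exists (b ^+ n.+1)^-1.
- by rewrite expf_neq0.
- by rewrite (avX av) lnXn // -mulr_natl.
- by rewrite invr_neq0 // expf_neq0.
rewrite (avV av) (avX av) lnV ?posrE ?exprn_gt0 // lnXn //.
by rewrite NegzE mulrNz -pmulrn -mulr_natl mulNr.
Qed.

(** Distinct places over the same [p] are inequivalent: if [w1 x < w2 x], a
    power of [x] times a suitable rational number separates them around 1. *)
Lemma places_separated w1 w2 : lies_over p w1 -> lies_over p w2 -> w1 <> w2 ->
  exists2 a, w1 a < 1 & 1 < w2 a.
Proof.
move=> o1 o2 neq.
have av1' := over_av o1; have av2' := over_av o2.
have [x ltx] : exists x, w1 x < w2 x.
  have [x nx] : exists x, w1 x != w2 x.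
    by apply: contra_notP neq => h; apply/funext => x; apply/eqP/negPn/negP => ?; apply: h; exists x.
  have x0 : x != 0 by apply: contraNneq nx => ->; rewrite !av0.
  case: (ltgtP (w1 x) (w2 x)) nx => // lt _; first by exists x.
  by exists x^-1; rewrite !avV // ltf_pV2 ?posrE ?av_gt0.
have x0 : x != 0 by apply: contraTneq ltx => ->; rewrite !av0 ?ltxx.
have u0 := av_gt0 av1' x0; have v0 := av_gt0 av2' x0.
set u := w1 x in ltx u0 *; set v := w2 x in ltx v0 *.
have lnlt : ln u < ln v by rewrite ltr_ln.
set L := ln (base_abs R p (base_big p)).
have L0 : 0 < L by rewrite ln_gt0 // base_big_gt1.
have d0 : 0 < ln v - ln u by rewrite subr_gt0.
pose m := Num.bound (L / (ln v - ln u)).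
have hm : L < m%:R * (ln v - ln u).
  by rewrite -ltr_pdivrMr // archi_boundP // divr_ge0 ?ltW.
pose n := Num.floor (m%:R * ln u / L) + 1.
have n1 : m%:R * ln u < n%:~R * L by rewrite -ltr_pdivrMr // floorD1_gt.
have n2 : n%:~R * L <= m%:R * ln u + L.
  rewrite /n intrD mulrDl mul1r lerD2r -ler_pdivlMr //; exact: floor_le.
have [q q0 hq] := base_ln_mulz (- n).
have qp : 0 < base_abs R p q by apply: (av_gt0 (base_abs_valued R basep)).
have lnw w : lies_over p w -> ln (w (q *: x ^+ m)) = m%:R * ln (w x) - n%:~R * L.
  move=> ow; have wx := av_gt0 (over_av ow) x0.
  rewrite (overZ _ _ ow) (avX (over_av ow)) lnM ?posrE ?exprn_gt0 //.
  by rewrite lnXn // hq mulr_natl intrN mulNr addrC.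
have qx0 : q *: x ^+ m != 0 by rewrite scaler_eq0 negb_or q0 expf_neq0.
exists (q *: x ^+ m).
  by rewrite -ltr_ln ?posrE ?av_gt0 // ln1 lnw // subr_lt0.
rewrite -ltr_ln ?posrE ?av_gt0 // ln1 lnw // subr_gt0.
by apply: le_lt_trans n2 _; rewrite -/v; lra.
Qed.

Definition evt (P : nat -> Prop) := exists N, forall n, (N <= n)%N -> P n.

Lemma evt_all (T : eqType) (s : seq T) (P : T -> nat -> Prop) :
  (forall t, t \in s -> evt (P t)) -> evt (fun n => forall t, t \in s -> P t n).
Proof.
elim: s => [|t s IH] h; first by exists 0%N.
have [|N hN] := IH; first by move=> y ys; apply: h; rewrite inE ys orbT.
have [|M hM] := h t; first by rewrite inE eqxx.
exists (maxn N M) => n; rewrite geq_max => /andP[n1 n2] y.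
by rewrite inE => /predU1P[->|ys]; [apply: hM | apply: hN].
Qed.

Lemma evt_expr (x e : R) : 0 <= x < 1 -> 0 < e -> evt (fun n => x ^+ n < e).
Proof.
move=> x01 e0; have [N hN] := expr_small x01 e0; case/andP: x01 => x0 x1.
exists N => n /subnKC <-; apply: le_lt_trans hN; rewrite exprD ler_piMr ?exprn_ge0 //.
by rewrite exprn_ile1 // ltW.
Qed.

(** The sequence [b ^+ n / (1 + b ^+ n)] tends to 0 at the places where [b] is
    small, and to 1 where [b] is large. *)
Definition cutoff b n := b ^+ n / (1 + b ^+ n).

Lemma cutoff_small w b e : lies_over p w -> w b < 1 -> 0 < e ->
  evt (fun n => w (cutoff b n) < e).
Proof.
move=> ow wb e0; have aw := over_av ow; have w0 := av_ge0 aw.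
have d0 : 0 < Num.min (1 / 2) (e / 2) by rewrite lt_min !divr_gt0.
have [|N hN] := @evt_expr (w b) _ _ d0; first by rewrite w0 wb.
exists N => n /hN; rewrite lt_min => /andP[h1 h2].
have h3 : 1 / 2 <= w (1 + b ^+ n).
  have := av_lerB aw 1 (- b ^+ n); rewrite opprK (av1 aw) (avN aw) (avX aw).
  by apply: le_trans; lra.
rewrite /cutoff (avM aw) (avV aw) (avX aw) ltr_pdivrMr; last by lra.
nra.
Qed.

Lemma cutoff_large w b e : lies_over p w -> 1 < w b -> 0 < e ->
  evt (fun n => w (cutoff b n - 1) < e).
Proof.
move=> ow wb e0; have aw := over_av ow; have w0 := av_ge0 aw.
have wb0 : 0 < w b by lra.
have d0 : 0 < Num.min (1 / 2) (e / 2) by rewrite lt_min !divr_gt0.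
have [|N hN] := @evt_expr (w b)^-1 _ _ d0.
  by rewrite invr_ge0 ltW // invf_lt1.
exists N => n /hN; rewrite exprVn lt_min => /andP[h1 h2].
set t := w b ^+ n in h1 h2; have t0 : 0 < t by rewrite exprn_gt0.
have t1 : t^-1 * t = 1 by rewrite mulVf // gt_eqF.
have s0 : 0 < t^-1 by rewrite invr_gt0.
have t2 : 2 < t by nra.
have h3 : t - 1 <= w (1 + b ^+ n).
  by have := av_lerB aw (b ^+ n) (-1); rewrite opprK (avN aw) (av1 aw) (avX aw) [b ^+ n + 1]addrC.
have n0 : 1 + b ^+ n != 0.
  by apply: contraTneq h3 => ->; rewrite (av0 aw) -ltNge; lra.
have -> : cutoff b n - 1 = - (1 + b ^+ n)^-1.
  by rewrite /cutoff; field.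
rewrite (avN aw) (avV aw) -[ltLHS]mul1r ltr_pdivrMr; last by lra.
apply: (@lt_le_trans _ _ (e * (t - 1))); last by rewrite ler_pM2l.
have : t^-1 * t < e / 2 * t by rewrite ltr_pM2r.
by rewrite t1; nra.
Qed.

(** Induction on the list.  If [b] serves for the other places, and [c]
    separates the new place from [w], then the product of [c] with a large
    power of [b] or with [cutoff b n] for a large [n] serves for all of
    them. *)
Lemma exists_dominant w (ws : seq (K -> R)) : lies_over p w -> w \notin ws ->
  (forall w', w' \in ws -> lies_over p w') ->
  exists2 a, 1 < w a & forall w', w' \in ws -> w' a < 1.
Proof.
move=> ow; have aw := over_av ow; elim: ws => [_ _|w1 ws IH].
  exists (base_big p)%:A => //; rewrite over_alg //; exact: base_big_gt1.
rewrite inE negb_or => /andP[/eqP ne nin] ows.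
have [|b wb hb] := IH nin; first by move=> w' h; apply: ows; rewrite inE h orbT.
have ow1 : lies_over p w1 by apply: ows; rewrite inE eqxx.
have ows' w' : w' \in ws -> lies_over p w' by move=> h; apply: ows; rewrite inE h orbT.
have [|c c1 c2] := places_separated ow1 ow; first by move=> e; apply: ne.
have aw1 := over_av ow1.
have pos (x : R) : 0 <= x -> 0 < (x + 1)^-1 by move=> x0; rewrite invr_gt0; lra.
have small w' x : lies_over p w' -> w' x < (w' c + 1)^-1 -> w' (c * x) < 1.
  move=> ow'; have a' := over_av ow'; have c0 := av_ge0 a' c.
  have x0 := av_ge0 a' x.
  rewrite -[ltRHS]mul1r ltr_pdivlMr; last by lra.
  by rewrite avM //; nra.
have [le1|gt1] := leP (w1 b) 1.
  have [N hN] : evt (fun n => forall w', w' \in ws -> w' (b ^+ n) < (w' c + 1)^-1).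
    apply: evt_all => w' h; have a' := over_av (ows' _ h).
    have [|M hM] := @evt_expr (w' b) _ _ (pos _ (av_ge0 a' c)).
      by rewrite (av_ge0 a') hb.
    by exists M => n /hM; rewrite avX.
  exists (c * b ^+ N); first by rewrite (avM aw) (avX aw) (lt_le_trans c2) // ler_peMr ?(av_ge0 aw) // exprn_ege1 // ltW.
  move=> w'; rewrite inE => /predU1P[->|h]; last first.
    by apply: small (ows' _ h) (hN _ (leqnn N) _ h).
  rewrite (avM aw1) (avX aw1); apply: le_lt_trans c1.
  by rewrite ler_piMr ?(av_ge0 aw1) // exprn_ile1 ?(av_ge0 aw1).
have e1 : 0 < (1 - w1 c) / 2 by lra.
have e2 : 0 < (w c - 1) / (w c + 1) by rewrite divr_gt0 ?subr_gt0 //; lra.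
have [N1 h1] := cutoff_large ow1 gt1 e1.
have [N2 h2] := cutoff_large ow wb e2.
have [N3 h3] : evt (fun n => forall w', w' \in ws -> w' (cutoff b n) < (w' c + 1)^-1).
  apply: evt_all => w' h; have a' := over_av (ows' _ h).
  by apply: cutoff_small (ows' _ h) (hb _ h) (pos _ (av_ge0 a' c)).
pose N := maxn N1 (maxn N2 N3).
have {}h1 : w1 (cutoff b N - 1) < (1 - w1 c) / 2 by apply: h1; rewrite leq_maxl.
have {}h2 : w (cutoff b N - 1) < (w c - 1) / (w c + 1).
  by apply: h2; rewrite /N maxnCA leq_maxl.
exists (c * cutoff b N).
  rewrite avM //; have := av_lerB aw 1 (1 - cutoff b N).
  rewrite subKr av1 // av_distC // => h4.
  move: h2; rewrite ltr_pdivlMr => [h2|]; last by lra.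
  nra.
move=> w'; rewrite inE => /predU1P[->|h]; last first.
  apply: small (ows' _ h) _; apply: h3 => //.
  by rewrite /N maxnA leq_maxr.
rewrite avM //; have := avD aw1 (cutoff b N - 1) 1; rewrite subrK av1 //.
have := av_ge0 aw1 c; nra.
Qed.

Lemma weak_approximation w (ws : seq (K -> R)) e : lies_over p w -> w \notin ws ->
  (forall w', w' \in ws -> lies_over p w') -> 0 < e ->
  exists2 u, w (u - 1) < e & forall w', w' \in ws -> w' u < e.
Proof.
move=> ow nin ows e0; have [b wb hb] := exists_dominant ow nin ows.
have [N1 h1] := cutoff_large ow wb e0.
have [N2 h2] : evt (fun n => forall w', w' \in ws -> w' (cutoff b n) < e).
  by apply: evt_all => w' h; apply: cutoff_small (ows _ h) (hb _ h) e0.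
exists (cutoff b (maxn N1 N2)); first by rewrite h1 ?leq_maxl.
by move=> w' h; rewrite h2 ?leq_maxr.
Qed.

(** A family of elements of [K], each one attached to a place over [p], such
    that the elements attached to one place are uniformly independent for the
    topology of that place, is linearly independent over the rationals: after
    multiplication by the elements that weak approximation provides, the
    places no longer interact. *)
Lemma strong_indep_bound (J : finType) (pl : J -> K -> R) (x : J -> K) :
  (forall j, lies_over p (pl j)) ->
  (forall j, exists k : R, 0 < k /\ forall (q : J -> rat) i, pl i = pl j ->
     k * base_abs R p (q i) <= pl j (\sum_(l | pl l == pl j) q l *: x l)) ->
  (#|J| <= \dim {:K})%N.
Proof.
move=> opl indep; rewrite leqNgt; apply/negP => lt.
have av := base_abs_valued R basep.
have avj j := over_av (opl j).
have [c cP] := choice indep.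
have c0 j : 0 < c j by case: (cP j).
pose B j := \sum_l pl j (x l).
have B0 j : 0 <= B j by apply: sumr_ge0 => l _; apply: av_ge0.
pose D := 1 + \sum_j B j / c j.
have D0 : 0 < D.
  by rewrite ltr_pwDl // sumr_ge0 // => j _; rewrite divr_ge0 // ltW.
have small j : D^-1 * B j < c j.
  rewrite mulrC ltr_pdivrMr // -ltr_pdivrMl // mulrC /D (bigD1 j) //=.
  have : 0 <= \sum_(i | i != j) B i / c i.
    by rewrite sumr_ge0 // => i _; rewrite divr_ge0 // ltW.
  lra.
have /choice[u uP] : forall j, exists u, pl j (u - 1) < D^-1 /\
    forall i, pl i != pl j -> pl i u < D^-1.
  move=> j.
  pose ws := [seq pl i | i <- enum J & pl i != pl j].
  have inws w' : w' \in ws -> exists2 i, w' = pl i & pl i != pl j.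
    by move=> /mapP[i]; rewrite mem_filter => /andP[h _] ->; exists i.
  have [|||a h1 h2] := @weak_approximation (pl j) ws D^-1 (opl j).
  - by apply/negP => /inws[i <-]; rewrite eqxx.
  - by move=> w' /inws[i -> _].
  - by rewrite invr_gt0.
  exists a; split=> // i ne; apply: h2; apply: map_f.
  by rewrite mem_filter ne mem_enum.
have [q [j1 qj1] hq] := linear_dependence (fun j => u j * x j) lt.
have [j0 _ maxq] := @Order.TotalTheory.arg_maxP _ _ _ j1 xpredT
  (fun j => base_abs R p (q j)) isT.
have qj0 : 0 < base_abs R p (q j0).
  by apply: lt_le_trans (maxq j1 isT); apply: (av_gt0 av).
set w := pl j0.
have ow : lies_over p w := opl j0.
have aw := over_av ow.
have [_ /(_ q j0 erefl)] := cP j0; apply/negP; rewrite -ltNge -/w.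
have -> : \sum_(l | pl l == w) q l *: x l
    = \sum_l q l *: ((if pl l == w then 1 - u l else - u l) * x l).
  transitivity (\sum_(l | pl l == w) q l *: x l - \sum_j q j *: (u j * x j)).
    by rewrite hq subr0.
  rewrite [X in X - _]big_mkcond -sumrB /=.
  apply: eq_bigr => l _; case: ifP => _; last by rewrite sub0r mulNr scalerN.
  by rewrite -scalerBr mulrBl mul1r.
apply: le_lt_trans (av_sum aw _ _ _) _.
apply: (@le_lt_trans _ _ (\sum_l base_abs R p (q j0) * (D^-1 * w (x l)))).
  apply: ler_sum => l _; rewrite (overZ _ _ ow).
  apply: ler_pM; rewrite ?(av_ge0 av) ?(av_ge0 aw) //; first exact: maxq.
  rewrite (avM aw) ler_wpM2r ?(av_ge0 aw) // ltW //.
  have [hl1 hl2] := uP l; case: eqP => [e|/eqP ne].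
    by rewrite (av_distC aw) -e.
  by rewrite (avN aw) hl2 // eq_sym.
rewrite -mulr_sumr -mulr_sumr mulrC ltr_pM2r //; exact: small.
Qed.

End Approximation.
(** * Completions *)

Definition converges (R : realType) (s : nat -> R) (l : R) :=
  forall e, 0 < e -> exists N, forall n, (N <= n)%N -> `|s n - l| < e.

Section RealSequences.
Variable R : realType.
Implicit Types (s t : nat -> R) (l : R).

Lemma converges_le s t l l' N : converges s l -> converges t l' ->
  (forall n, (N <= n)%N -> s n <= t n) -> l <= l'.
Proof.
move=> hs ht le; rewrite leNgt; apply/negP => lt.
have e0 : 0 < (l - l') / 2 by lra.
have [N1 h1] := hs _ e0; have [N2 h2] := ht _ e0.
pose n := maxn N (maxn N1 N2).
have m0 : (N <= n)%N by rewrite leq_maxl.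
have m1 : (N1 <= n)%N by rewrite /n maxnCA leq_maxl.
have m2 : (N2 <= n)%N by rewrite /n maxnA leq_maxr.
have := le n m0; have := h1 n m1; have := h2 n m2.
by rewrite !ltr_norml => /andP[? ?] /andP[? ?] ?; lra.
Qed.

Lemma converges_uniq s l l' : converges s l -> converges s l' -> l = l'.
Proof.
by move=> h1 h2; apply/eqP; rewrite eq_le !(@converges_le s s _ _ 0).
Qed.

Lemma converges_cst l : converges (fun=> l) l.
Proof. by move=> e e0; exists 0%N => n _; rewrite subrr normr0. Qed.

Lemma cauchy_converges s :
  (forall e, 0 < e -> exists N, forall i j, (N <= i)%N -> (N <= j)%N ->
     `|s i - s j| < e) -> exists l, converges s l.
Proof.
move=> hs; have /cauchy_cvgP/cvg_ex[l hl] : cauchy (s @ \oo).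
  apply/cauchy_ballP => e e0; have [N hN] := hs _ e0.
  by exists ([set x | exists2 n, (N <= n)%N & x = s n], [set x | exists2 n, (N <= n)%N & x = s n]);
    [split; exists N => // n /= Nn; exists n | move=> [x y] /= [[i Ni ->] [j Nj ->]]; apply: hN].
exists l => e e0; move/cvgrPdist_lt: hl => /(_ e e0)[N _ hN].
by exists N => n Nn; rewrite distrC; apply: hN.
Qed.

End RealSequences.

Section Completion.
Variables (R : realType) (K : fieldType) (w : K -> R).

Definition cauchy_seqs (absw : absolute_value w) : {pred nat -> K} :=
  fun u => `[< forall e, 0 < e -> exists N, forall i j, (N <= i)%N -> (N <= j)%N ->
                w (u i - u j) < e >].

Hypothesis absw : absolute_value w.
Local Notation cs := (cauchy_seqs absw).

Lemma cauchy_seqsP u : reflect (forall e, 0 < e -> exists N, forall i j,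
  (N <= i)%N -> (N <= j)%N -> w (u i - u j) < e) (u \in cs).
Proof. exact: asboolP. Qed.

Lemma cauchy_bounded u : u \in cs -> exists2 B, 0 < B & forall n, w (u n) <= B.
Proof.
move=> /cauchy_seqsP/(_ 1 ltr01)[N hN].
have w0 := av_ge0 absw.
exists (1 + \sum_(i < N.+1) w (u i)); first by rewrite ltr_pwDl // sumr_ge0.
move=> n; have [le|lt] := leqP n N.
  rewrite (bigD1 (Ordinal (le : n < N.+1)%N)) //= addrCA lerDl addr_ge0 //.
  exact: sumr_ge0.
have := hN n N (ltnW lt) (leqnn _) => h.
have := avD absw (u n - u N) (u N); rewrite subrK => h2.
rewrite big_ord_recr /=; have : 0 <= \sum_(i < N) w (u i) by apply: sumr_ge0.
lra.
Qed.

Lemma cauchy_seqs_subring : subring_closed cs.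
Proof.
split.
- by apply/cauchy_seqsP => e e0; exists 0%N => i j _ _; rewrite subrr (av0 absw).
- move=> u v /cauchy_seqsP hu /cauchy_seqsP hv; apply/cauchy_seqsP => e e0.
  have e2 : 0 < e / 2 by lra.
  have [N hN] := hu _ e2; have [M hM] := hv _ e2.
  exists (maxn N M) => i j; rewrite !geq_max => /andP[i1 i2] /andP[j1 j2].
  have -> : (u - v) i - (u - v) j = (u i - u j) - (v i - v j).
    by rewrite (_ : (u - v) i = u i - v i) // (_ : (u - v) j = u j - v j) //; ring.
  by have := avB absw (u i - u j) (v i - v j); have := hN _ _ i1 j1; have := hM _ _ i2 j2; lra.
- move=> u v cu cv; have [A A0 hA] := cauchy_bounded cu.
  have [B B0 hB] := cauchy_bounded cv.
  move/cauchy_seqsP: cu => hu; move/cauchy_seqsP: cv => hv.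
  apply/cauchy_seqsP => e e0.
  have [|N hN] := hu (e / (2 * B)); first by rewrite divr_gt0 // mulr_gt0.
  have [|M hM] := hv (e / (2 * A)); first by rewrite divr_gt0 // mulr_gt0.
  exists (maxn N M) => i j; rewrite !geq_max => /andP[i1 i2] /andP[j1 j2].
  have -> : (u * v) i - (u * v) j = (u i - u j) * v i + u j * (v i - v j).
    by rewrite (_ : (u * v) i = u i * v i) // (_ : (u * v) j = u j * v j) //; ring.
  apply: le_lt_trans (avD absw _ _) _; rewrite !(avM absw).
  have := hN _ _ i1 j1; rewrite ltr_pdivlMr ?mulr_gt0 // => h1.
  have := hM _ _ i2 j2; rewrite ltr_pdivlMr ?mulr_gt0 // => h2.
  have := hA j; have := hB i; have := av_ge0 absw (u i - u j).
  have := av_ge0 absw (v i - v j); nra.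
Qed.

HB.instance Definition _ :=
  GRing.isSubringClosed.Build (nat -> K) cs cauchy_seqs_subring.

End Completion.

Section Completion2.
Variables (R : realType) (K : fieldType) (w : K -> R).
Hypothesis absw : absolute_value w.
Local Notation cs := (cauchy_seqs absw).

Record cseq : predArgType := Cseq { cseq_val :> nat -> K; cseqP : cseq_val \in cs }.
HB.instance Definition _ := [isSub for cseq_val].
HB.instance Definition _ := [Choice of cseq by <:].
HB.instance Definition _ := [SubChoice_isSubComNzRing of cseq by <:].


Definition null_seqs : {pred cseq} :=
  fun u => `[< forall e, 0 < e -> exists N, forall n, (N <= n)%N -> w (u n) < e >].

Lemma null_seqsP (u : cseq) : reflect (converges (w \o u) 0) (u \in null_seqs).
Proof.
apply: (iffP (asboolP _)) => h e /h[N hN]; exists N => n /hN.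
  by rewrite /= subr0 ger0_norm // av_ge0.
by rewrite /= subr0 ger0_norm // av_ge0.
Qed.

Lemma cseq_valB (u v : cseq) n : (u - v) n = u n - v n. Proof. by []. Qed.
Lemma cseq_valD (u v : cseq) n : (u + v) n = u n + v n. Proof. by []. Qed.
Lemma cseq_valM (u v : cseq) n : (u * v) n = u n * v n. Proof. by []. Qed.

Lemma null_seqs_ideal : idealr_closed null_seqs.
Proof.
split.
- by apply/asboolP => e e0; exists 0%N => n _; rewrite [w _](av0 absw).
- apply/negP => /asboolP/(_ 1 ltr01)[N /(_ N (leqnn _))].
  by rewrite [w _](av1 absw) ltxx.
- move=> a u v /asboolP hu /asboolP hv; apply/asboolP => e e0.
  have [A A0 hA] := cauchy_bounded (cseqP a).
  have [|N hN] := hu (e / (2 * A)); first by rewrite divr_gt0 // mulr_gt0.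
  have [|M hM] := hv (e / 2); first by rewrite divr_gt0.
  exists (maxn N M) => n; rewrite geq_max => /andP[n1 n2].
  rewrite cseq_valD cseq_valM; apply: le_lt_trans (avD absw _ _) _.
  rewrite (avM absw); have := hN _ n1; rewrite ltr_pdivlMr ?mulr_gt0 // => h1.
  have := hM _ n2; have := hA n; have := av_ge0 absw (u n); nra.
Qed.

HB.instance Definition _ := isIdealr.Build cseq null_seqs null_seqs_ideal.

Definition cpl := {ideal_quot null_seqs}.
HB.instance Definition _ := GRing.ComNzRing.on cpl.

Local Open Scope quotient_scope.

Definition pi (u : cseq) : cpl := \pi_({ideal_quot null_seqs}) u.
Definition cpl_repr (x : cpl) : cseq := repr (x : {ideal_quot null_seqs}).

Lemma cpl_reprK x : pi (cpl_repr x) = x. Proof. exact: reprK. Qed.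

Lemma cplW (P : cpl -> Prop) : (forall u, P (pi u)) -> forall x, P x.
Proof. by move=> h x; rewrite -[x]cpl_reprK. Qed.

Lemma pi0 : pi 0 = 0. Proof. exact: pi_zeror. Qed.
Lemma pi1 : pi 1 = 1. Proof. exact: pi_oner. Qed.
Lemma piD u v : pi (u + v) = pi u + pi v. Proof. exact: pi_addr. Qed.
Lemma piN u : pi (- u) = - pi u. Proof. exact: pi_oppr. Qed.
Lemma piB u v : pi (u - v) = pi u - pi v. Proof. by rewrite piD piN. Qed.
Lemma piM u v : pi (u * v) = pi u * pi v. Proof. exact: pi_mulr. Qed.

Lemma pi_eq0 u : pi u = 0 <-> u \in null_seqs.
Proof.
rewrite -pi0 -[u in u \in _]subr0 Quotient.idealrBE.
by split=> [h|/eqP h]; [apply/eqP|].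
Qed.

Lemma cpl_has_inv (x : cpl) : x != 0 -> exists y, y * x = 1.
Proof.
elim/cplW: x => u /eqP u0.
have nu : u \notin null_seqs by apply/negP => /pi_eq0.
have [c c0 [N hN]] : exists2 c, 0 < c & exists N, forall n, (N <= n)%N -> c <= w (u n).
  apply: contraNP nu => nc; apply/asboolP => e e0.
  have e2 : 0 < e / 2 by lra.
  have /cauchy_seqsP/(_ _ e2)[N hN] := cseqP u.
  exists N => n Nn; rewrite ltNge; apply/negP => le.
  apply: nc; exists (e / 2) => //; exists N => m Nm.
  by have := hN _ _ Nn Nm; have := av_lerB absw (u n) (u m); lra.
have cinv : (fun n => (u n)^-1) \in cs.
  apply/cauchy_seqsP => e e0.
  have ec : 0 < e * c ^+ 2 by rewrite mulr_gt0 // exprn_gt0.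
  have /cauchy_seqsP/(_ _ ec)[M hM] := cseqP u.
  exists (maxn N M) => i j; rewrite !geq_max => /andP[i1 i2] /andP[j1 j2].
  have ui0 : u i != 0 by apply: contraTneq (hN i i1) => ->; rewrite (av0 absw) -ltNge.
  have uj0 : u j != 0 by apply: contraTneq (hN j j1) => ->; rewrite (av0 absw) -ltNge.
  have -> : (u i)^-1 - (u j)^-1 = (u j - u i) / (u i * u j) by field; rewrite ui0 uj0.
  rewrite (avM absw) (avV absw) (avM absw) ltr_pdivrMr ?mulr_gt0 ?(av_gt0 absw) //.
  apply: lt_le_trans (hM _ _ j2 i2) _; rewrite ler_pM2l // expr2.
  by apply: ler_pM; rewrite ?hN ?(ltW c0).
exists (pi (Cseq cinv)); rewrite -piM; apply/eqP; rewrite -subr_eq0; apply/eqP.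
rewrite -pi1.
rewrite -piB; apply/pi_eq0/asboolP => e e0; exists N => n Nn.
have un0 : u n != 0 by apply: contraTneq (hN n Nn) => ->; rewrite (av0 absw) -ltNge.
by rewrite cseq_valB cseq_valM /= mulVf // subrr (av0 absw).
Qed.

Definition cpl_inv (x : cpl) : cpl := if x == 0 then 0 else xget 0 [set y | y * x = 1].

Lemma cpl_mulVx (x : cpl) : x != 0 -> cpl_inv x * x = 1.
Proof.
move=> x0; rewrite /cpl_inv (negPf x0); have [y hy] := cpl_has_inv x0.
by case: xgetP => [z _ //|/(_ y)].
Qed.

Lemma cpl_inv0 : cpl_inv 0 = 0. Proof. by rewrite /cpl_inv eqxx. Qed.

HB.instance Definition _ := GRing.ComNzRing_isField.Build cpl cpl_mulVx cpl_inv0.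

Definition cpl_norm (x : cpl) : R := xget 0 [set l | converges (w \o cpl_repr x) l].

Lemma cseq_norm_cvg (u : cseq) : exists l, converges (w \o u) l.
Proof.
apply: cauchy_converges => e e0; have /cauchy_seqsP/(_ _ e0)[N hN] := cseqP u.
exists N => i j Ni Nj /=; rewrite ltr_norml; apply/andP; split.
  by have := hN _ _ Nj Ni; have := av_lerB absw (u j) (u i); lra.
by have := hN _ _ Ni Nj; have := av_lerB absw (u i) (u j); lra.
Qed.

Lemma cpl_normP (u : cseq) : converges (w \o u) (cpl_norm (pi u)).
Proof.
set v := cpl_repr (pi u).
have hv : converges (w \o v) (cpl_norm (pi u)).
  by rewrite /cpl_norm; case: xgetP => // h; have [l hl] := cseq_norm_cvg v; case: (h l).
have /asboolP nuv : u - v \in null_seqs.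
  by apply/pi_eq0; rewrite piB cpl_reprK subrr.
move=> e e0; have e2 : 0 < e / 2 by lra.
have [N hN] := hv _ e2; have [M hM] := nuv _ e2.
exists (maxn N M) => n; rewrite geq_max => /andP[n1 n2].
have := hN _ n1; have := hM _ n2; rewrite cseq_valB /= !ltr_norml => h1 /andP[h2 h3].
have := av_lerB absw (u n) (v n); have := av_lerB absw (v n) (u n).
by rewrite (av_distC absw (v n)); lra.
Qed.

Lemma converges_cseq (u : cseq) l : converges (w \o u) l -> cpl_norm (pi u) = l.
Proof. exact/converges_uniq/cpl_normP. Qed.

Lemma cpl_norm_abs : absolute_value cpl_norm.
Proof.
split.
- elim/cplW => u; apply: (@converges_le _ (fun=> 0) _ _ _ 0); first exact: converges_cst.
    exact: cpl_normP.
  by move=> n _ /=; apply: av_ge0.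
- elim/cplW => u; split=> [h|/pi_eq0/null_seqsP/converges_cseq //].
  by apply/pi_eq0/null_seqsP; rewrite -h; apply: cpl_normP.
- elim/cplW => u; elim/cplW => v; rewrite -piM; apply: converges_cseq.
  have hu := cpl_normP u; have hv := cpl_normP v.
  set lu := cpl_norm _ in hu *; set lv := cpl_norm _ in hv *.
  have [A A0 hA] := cauchy_bounded (cseqP u).
  have B0 : 0 < `|lv| + 1 by rewrite ltr_wpDl.
  move=> e e0; have [|N hN] := hv (e / (2 * A)); first by rewrite divr_gt0 // mulr_gt0.
  have [|M hM] := hu (e / (2 * (`|lv| + 1))); first by rewrite divr_gt0 // mulr_gt0.
  exists (maxn N M) => n; rewrite geq_max => /andP[n1 n2].
  rewrite [(w \o _) n](_ : _ = w (u n) * w (v n)); last by rewrite -(avM absw).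
  have -> : w (u n) * w (v n) - lu * lv
     = w (u n) * (w (v n) - lv) + (w (u n) - lu) * lv by ring.
  apply: le_lt_trans (ler_normD _ _) _; rewrite !normrM.
  have := hN _ n1; rewrite /= ltr_pdivlMr ?mulr_gt0 // => h1.
  have := hM _ n2; rewrite /= ltr_pdivlMr ?mulr_gt0 // => h2.
  rewrite (ger0_norm (av_ge0 absw _)).
  have := hA n; have := normr_ge0 (w (v n) - lv); have := normr_ge0 (w (u n) - lu).
  have := normr_ge0 lv; nra.
- elim/cplW => u; elim/cplW => v; rewrite -piD.
  have hu := cpl_normP u; have hv := cpl_normP v.
  apply: (@converges_le _ _ (fun n => w (u n) + w (v n)) _ _ 0 (cpl_normP _)).
    move=> e e0; have e2 : 0 < e / 2 by lra.
    have [N hN] := hu _ e2; have [M hM] := hv _ e2.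
    exists (maxn N M) => n; rewrite geq_max => /andP[n1 n2].
    have := hN _ n1; have := hM _ n2.
    by rewrite /= !ltr_norml => /andP[? ?] /andP[? ?]; lra.
  by move=> n _; apply: (avD absw).
Qed.

Lemma cst_cauchy (a : K) : (fun=> a) \in cs.
Proof. by apply/cauchy_seqsP => e e0; exists 0%N => i j _ _; rewrite subrr (av0 absw). Qed.

Definition cpl_cst (a : K) : cpl := pi (Cseq (cst_cauchy a)).

Lemma cpl_cst_zmod : zmod_morphism cpl_cst.
Proof. by move=> a b; rewrite /cpl_cst -piB; congr (pi _); apply: val_inj. Qed.

Lemma cpl_cst_monoid : monoid_morphism cpl_cst.
Proof.
split=> [|a b]; last by rewrite /cpl_cst -piM; congr (pi _); apply: val_inj.
rewrite -pi1.
by congr (pi _); apply: val_inj.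
Qed.

HB.instance Definition _ := GRing.isZmodMorphism.Build K cpl cpl_cst cpl_cst_zmod.
HB.instance Definition _ := GRing.isMonoidMorphism.Build K cpl cpl_cst cpl_cst_monoid.

Lemma cpl_norm_cst a : cpl_norm (cpl_cst a) = w a.
Proof. by apply: converges_cseq; exact: (converges_cst (w a)). Qed.

Lemma cpl_cst_dense y (e : R) : 0 < e -> exists a, cpl_norm (y - cpl_cst a) < e.
Proof.
move=> e0; have e2 : 0 < e / 2 by lra.
elim/cplW: y => u; have /cauchy_seqsP/(_ _ e2)[N hN] := cseqP u.
exists (u N); rewrite /cpl_cst -piB; apply: (@le_lt_trans _ _ (e / 2)); last by lra.
apply: (@converges_le _ _ (fun=> e / 2) _ _ N (cpl_normP _)); first exact: converges_cst.
by move=> n Nn; apply/ltW/hN.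
Qed.

Lemma cpl_norm_complete (x : nat -> cpl) :
  (forall e : R, 0 < e -> exists N, forall i j, (N <= i)%N -> (N <= j)%N ->
     cpl_norm (x i - x j) < e) ->
  exists l, forall e : R, 0 < e -> exists N, forall i, (N <= i)%N ->
     cpl_norm (x i - l) < e.
Proof.
move=> hx; have an := cpl_norm_abs.
have /choice[a ha] : forall n, exists a, cpl_norm (x n - cpl_cst a) < n.+1%:R^-1.
  by move=> n; apply: cpl_cst_dense; rewrite invr_gt0.
have small (e : R) : 0 < e -> exists N, forall n, (N <= n)%N -> n.+1%:R^-1 < e.
  move=> e0; exists (Num.bound e^-1) => n Nn.
  rewrite -[ltRHS]invrK ltf_pV2 ?posrE ?invr_gt0 //.
  apply: lt_trans (archi_boundP _) _; first by rewrite invr_ge0 ltW.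
  by rewrite ltr_nat.
have dist i j : w (a i - a j) <=
    i.+1%:R^-1 + j.+1%:R^-1 + cpl_norm (x i - x j).
  rewrite -cpl_norm_cst rmorphB /=.
  have -> : cpl_cst (a i) - cpl_cst (a j)
    = (cpl_cst (a i) - x i) + (x i - x j) + (x j - cpl_cst (a j)) by ring.
  apply: le_trans (avD an _ _) _; rewrite [leRHS]addrAC.
  apply: lerD; last exact/ltW/ha.
  apply: le_trans (avD an _ _) _; rewrite lerD2r (av_distC an).
  exact/ltW/ha.
have ca : a \in cs.
  apply/cauchy_seqsP => e e0; have e3 : 0 < e / 3 by lra.
  have [N hN] := hx _ e3; have [M hM] := small _ e3.
  exists (maxn N M) => i j; rewrite !geq_max => /andP[i1 i2] /andP[j1 j2].
  apply: le_lt_trans (dist _ _) _.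
  rewrite (_ : e = e / 3 + e / 3 + e / 3); last by field.
  by do 2?[apply: ltrD]; [exact: hM | exact: hM | exact: hN].
exists (pi (Cseq ca)) => e e0; have e2 : 0 < e / 2 by lra.
have e4 : 0 < e / 4 by lra.
have /cauchy_seqsP/(_ _ e4)[N hN] := ca; have [M hM] := small _ e4.
exists (maxn N M) => i; rewrite geq_max => /andP[i1 i2].
have -> : x i - pi (Cseq ca) = (x i - cpl_cst (a i)) + (cpl_cst (a i) - pi (Cseq ca)) by ring.
apply: le_lt_trans (avD an _ _) _.
have h3 : cpl_norm (cpl_cst (a i) - pi (Cseq ca)) <= e / 4.
  rewrite /cpl_cst -piB.
  apply: (@converges_le _ _ (fun=> e / 4) _ _ N (cpl_normP _)); first exact: converges_cst.
  by move=> n Nn; apply/ltW/hN.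
rewrite (_ : e = e / 2 + e / 2); last by field.
apply: ltrD.
  by apply: lt_trans (ha i) _; apply: lt_trans (hM _ i2) _; lra.
by apply: le_lt_trans h3 _; lra.
Qed.

(** The completion is the ring of Cauchy sequences modulo the null sequences. *)
Lemma completion_exists : inhabited (completion w).
Proof.
exact: (inhabits (@Completion R K w cpl cpl_norm cpl_cst cpl_norm_abs
  cpl_norm_cst cpl_cst_dense cpl_norm_complete)).
Qed.

End Completion2.
(** * Embeddings of a number field *)

(** A ring morphism out of a field generated by [theta] over the rationals is
    given by the image [r] of [theta], subject to the relations of [theta]. *)
Lemma rmorphism_of_root (K M : fieldExtType rat) (theta : K) (r : M) :
  (forall x : K, exists g : {poly rat}, x = (map_poly (in_alg K) g).[theta]) ->
  (forall g : {poly rat}, (map_poly (in_alg K) g).[theta] = 0 ->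
     (map_poly (in_alg M) g).[r] = 0) ->
  exists s : {rmorphism K -> M}, s theta = r.
Proof.
move=> gen rel; have [g hg] := choice gen.
pose s x := (map_poly (in_alg M) (g x)).[r].
have sE f : s (map_poly (in_alg K) f).[theta] = (map_poly (in_alg M) f).[r].
  apply/eqP; rewrite /s -subr_eq0 -hornerN -hornerD -!rmorphN -rmorphD /=.
  by apply/eqP/rel; rewrite rmorphB /= hornerD hornerN -hg subrr.
have sB : zmod_morphism s.
  move=> x y; rewrite [in LHS](hg x) [in LHS](hg y) -hornerN -hornerD.
  by rewrite -rmorphN -rmorphD sE rmorphB /= hornerD hornerN.
have sM : monoid_morphism s.
  split=> [|x y].
    by have := sE 1; rewrite !rmorph1 !hornerC.
  rewrite [in LHS](hg x) [in LHS](hg y) -hornerM -rmorphM sE rmorphM /=.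
  by rewrite hornerM.
pose f : {rmorphism K -> M} := HB.pack s
  (GRing.isZmodMorphism.Build K M s sB) (GRing.isMonoidMorphism.Build K M s sM).
exists f; have := sE 'X; rewrite !map_polyX !hornerX; exact.
Qed.

(** The [\dim {:K}] embeddings of [K] in the splitting field of the minimal
    polynomial of a primitive element [theta]. *)
Lemma number_field_embeddings (K : fieldExtType rat) (n := \dim {:K}) :
  exists (M : fieldExtType rat) (theta : K) (s : 'I_n -> {rmorphism K -> M}),
    injective (fun i => s i theta) /\
    forall x : K, exists c : 'I_n -> rat, x = \sum_(j < n) c j *: theta ^+ j.
Proof.
have sep : separable 1 {:K}.
  by apply/separableP => x _; apply: pcharf0_separable => p; rewrite pchar_lalg pchar_num.
pose theta := separable_generator 1 {:K}.
have genv : {:K}%VS = <<1; theta>>%VS by apply: eq_adjoin_separable_generator (sub1v _).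
have deg : adjoin_degree 1 theta = n.
  by have := dim_Fadjoin 1 theta; rewrite -genv dimv1 muln1.
have coords x : exists g : {poly rat}, (size g <= n)%N /\ x = (map_poly (in_alg K) g).[theta].
  have /polyOver1P[g gE] := Fadjoin_polyOver 1 theta x.
  exists g; rewrite -gE Fadjoin_poly_eq -?genv ?memvf //; split=> //.
  by rewrite -(size_map_poly (in_alg K)) -gE -deg size_Fadjoin_poly.
have /polyOver1P[f fE] := minPolyOver 1 theta.
have szf : size f = n.+1 by rewrite -(size_map_poly (in_alg K)) -fE size_minPoly deg.
have f0 : f != 0 by rewrite -size_poly_eq0 szf.
have fsep : separable_poly f.
  rewrite -(separable_map (in_alg K)) -fE.
  by have /separableP/(_ theta (memvf _)) := sep.
have fdvd g : (map_poly (in_alg K) g).[theta] = 0 -> f %| g.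
  move=> g0; rewrite -(dvdp_map (in_alg K)) -fE; apply: minPoly_dvdp.
    by apply/polyOver1P; exists g.
  exact/rootP.
have [rs rsE] := closed_field_poly_normal (map_poly (@ratr algC) f).
have lc0 : lead_coef (map_poly (@ratr algC) f) != 0 by rewrite lead_coef_eq0 map_poly_eq0.
have szrs : size rs = n.
  have := congr1 (size \o @polyseq _) rsE; rewrite /= size_map_poly szf.
  by rewrite size_scale // size_prod_XsubC => -[].
have urs : uniq rs.
  have := separable_map (@ratr algC) f; rewrite fsep rsE.
  by rewrite (eqp_separable (eqp_scale _ lc0)) separable_prod_XsubC.
have [M [MC [s1 s1E _]]] := num_field_exists rs.
have szs1 : size s1 = n by rewrite -szrs -s1E size_map.
have us1 : uniq s1 by move: urs; rewrite -s1E => /map_uniq.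
have root_i (i : 'I_n) g : (map_poly (in_alg K) g).[theta] = 0 ->
    (map_poly (in_alg M) g).[s1`_i] = 0.
  move=> /fdvd/dvdpP[h ->]; apply: (fmorph_inj MC); rewrite rmorph0 -horner_map /=.
  rewrite -map_poly_comp /= (@eq_map_poly _ _ _ (@ratr algC)); last first.
    by move=> a /=; rewrite alg_num_field fmorph_rat.
  rewrite rmorphM /= hornerM rsE.
  have -> : MC s1`_i = rs`_i by rewrite -s1E (nth_map 0) // szs1.
  rewrite hornerZ; have -> : (\prod_(z <- rs) ('X - z%:P)).[rs`_i] = 0.
    by apply/rootP; rewrite root_prod_XsubC mem_nth // szrs.
  by rewrite !mulr0.
have gen x : exists g : {poly rat}, x = (map_poly (in_alg K) g).[theta].
  by have [g [_ ->]] := coords x; exists g.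
have /choice[s sP] i := rmorphism_of_root gen (root_i i).
exists M, theta, s; split=> [i j|x].
  by rewrite !sP => /eqP; rewrite nth_uniq ?szs1 // => /eqP/val_inj.
have [g [sg ->]] := coords x; exists (fun j => g`_j).
rewrite (horner_coef_wide _ (n := n)) ?size_map_poly //.
by apply: eq_bigr => j _; rewrite coef_map /= mulr_algl.
Qed.
(** * Local degrees *)

Section LocalDegrees.
Variables (R : realType) (K M : fieldExtType rat) (theta : K).
Local Notation n := (\dim {:K}).
Variable s : 'I_n -> {rmorphism K -> M}.
Hypothesis sinj : injective (fun i => s i theta).
Hypothesis coords : forall x : K, exists c : 'I_n -> rat, x = \sum_(j < n) c j *: theta ^+ j.

Lemma rmorph_alg (i : 'I_n) q : s i q%:A = q%:A.
Proof. by rewrite !alg_num_field fmorph_rat. Qed.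

(** Multiplication by [a] is given by a rational matrix [A] in the basis of the
    powers of [theta], and the Vandermonde matrix of the conjugates of [theta]
    diagonalizes [A]: the determinant of [A] is the product of the conjugates
    of [a]. *)
Lemma exists_norm a : exists q : rat, q%:A = \prod_i s i a.
Proof.
pose r : 'rV[M]_n := \row_i s i theta.
have /choice[c cP] (j : 'I_n) := coords (a * theta ^+ j).
pose A : 'M[rat]_n := \matrix_(j, l) c j l.
have AV : map_mx (in_alg M) A *m Vandermonde n r
        = Vandermonde n r *m diag_mx (\row_i s i a).
  apply/matrixP => j i; rewrite mul_mx_diag !mxE.
  have := congr1 (s i) (cP j); rewrite rmorphM rmorphXn /= mulrC => ->.
  rewrite rmorph_sum /=; apply: eq_bigr => l _.
  by rewrite !mxE -mulr_algl rmorphM rmorph_alg rmorphXn.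
have V0 : \det (Vandermonde n r) != 0.
  rewrite det_Vandermonde; apply/prodf_neq0 => i _; apply/prodf_neq0 => j lt.
  rewrite !mxE subr_eq0; apply: contraTneq lt => /sinj ->; by rewrite ltnn.
exists (\det A); have := congr1 determinant AV.
rewrite !det_mulmx mulrC => /(mulfI V0).
rewrite det_map_mx det_diag /= => ->; by apply: eq_bigr => i _; rewrite mxE.
Qed.

Section OnePlace.
Variables (p : nat) (w0 : M -> R).
Hypotheses (basep : is_base p) (ow0 : lies_over p w0).
Let aw0 : absolute_value w0 := over_av ow0.

Definition pull (i : 'I_n) : K -> R := fun x => w0 (s i x).

Lemma pull_over i : lies_over p (pull i).
Proof.
split; last by move=> q; rewrite /pull fmorph_rat; case: ow0.
rewrite /pull; split=> [a|a|a b|a b].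
- exact: av_ge0.
- by rewrite (av_eq0 aw0); split=> [/eqP|->]; rewrite ?fmorph_eq0 ?rmorph0 // => /eqP.
- by rewrite rmorphM avM.
- by rewrite rmorphD avD.
Qed.

Variable w : K -> R.
Hypothesis ow : lies_over p w.
Let aw : absolute_value w := over_av ow.
Let ab := base_abs_valued R basep.

Definition above := [pred i | pull i == w].
Local Notation e := #|above|.

Lemma mem_above i : (i \in above) = (pull i == w). Proof. by []. Qed.

(** If the value of a rational polynomial of degree less than [e] at [theta]
    is small at [w], then so are its values at [e] conjugates of [theta] at
    [w0], hence its coefficients by interpolation. *)
Lemma powers_strong_indep : exists k : R, 0 < k /\ forall (q : 'I_e -> rat) j,
  k * base_abs R p (q j) <= w (\sum_(l < e) q l *: theta ^+ l).
Proof.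
pose r : 'rV[M]_e := \row_i s (enum_val i) theta.
pose V := Vandermonde e r.
have Vu : V \in unitmx.
  rewrite unitmxE unitfE det_Vandermonde; apply/prodf_neq0 => i _; apply/prodf_neq0 => j lt.
  rewrite !mxE subr_eq0; apply: contraTneq lt => /sinj/enum_val_inj ->; by rewrite ltnn.
pose D := 1 + \sum_i \sum_j w0 (invmx V i j).
have D0 : 0 < D by rewrite ltr_pwDl // sumr_ge0 // => i _; rewrite sumr_ge0 // => j _; apply: av_ge0.
exists D^-1; rewrite invr_gt0; split=> // q j; set x := \sum_(l < e) _.
pose Q : 'rV[M]_e := \row_l (q l)%:A; pose Y : 'rV[M]_e := \row_l s (enum_val l) x.
have QV : Q *m V = Y.
  apply/rowP => l; rewrite !mxE rmorph_sum /=; apply: eq_bigr => i _.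
  by rewrite !mxE -[in RHS]mulr_algl rmorphM rmorph_alg rmorphXn.
have wY l : w0 (Y 0 l) = w x.
  by rewrite mxE; have := enum_valP l; rewrite mem_above => /eqP <-.
rewrite mulrC ler_pdivrMr // -(over_alg _ ow0).
have -> : (q j)%:A = (Y *m invmx V) 0 j by rewrite -QV mulmxK // mxE.
rewrite mxE; apply: le_trans (av_sum aw0 _ _ _) _.
under eq_bigr do rewrite (avM aw0) wY.
rewrite -mulr_sumr ler_wpM2l ?(av_ge0 aw) // /D.
apply: ler_wpDl => //; apply: ler_sum => i _.
rewrite (bigD1 j) //= lerDl sumr_ge0 // => ? _; exact: av_ge0.
Qed.

End OnePlace.

Section Bound.
Variables (p : nat) (w0 : M -> R).
Hypotheses (basep : is_base p) (ow0 : lies_over p w0).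
Variable w : K -> R.
Hypothesis ow : lies_over p w.
Let aw : absolute_value w := over_av ow.
Let ab := base_abs_valued R basep.
Local Notation above := (above w0).
Local Notation e := #|above w|.

(** The powers of [theta] already provide [n] uniformly independent elements,
    so no element can be added to them. *)
Lemma no_extra_indep (y : K) : ~ exists k : R, 0 < k /\
  forall (q : 'I_e -> rat) (q' : rat),
   (forall j, k * base_abs R p (q j) <= w (q' *: y + \sum_(l < e) q l *: theta ^+ l)) /\
   k * base_abs R p q' <= w (q' *: y + \sum_(l < e) q l *: theta ^+ l).
Proof.
case=> k [k0 hk].
pose J : finType := ('I_n + 'I_1)%type.
pose pl (j : J) : K -> R := match j with inl i => pull w0 i | inr _ => w end.
pose ix (i : 'I_n) := index i (enum (above (pull w0 i))).
pose x (j : J) : K := match j with inl i => theta ^+ ix i | inr _ => y end.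
have opl j : lies_over p (pl j) by case: j => [i|?] //=; apply: pull_over.
have ixE w' (q : J -> rat) : \sum_(i | pull w0 i == w') q (inl i) *: theta ^+ ix i
   = \sum_(l < #|above w'|) q (inl (enum_val l)) *: theta ^+ l.
  rewrite (eq_bigl (fun i => i \in above w')) // big_enum_val.
  apply: eq_bigr => l _; congr (_ *: theta ^+ _).
  have /eqP ew : pull w0 (enum_val l) == w' by have := enum_valP l; rewrite mem_above.
  rewrite /ix ew (enum_val_nth (enum_val l)) index_uniq ?enum_uniq // -cardE.
  exact: ltn_ord.
have mem_ex w' i : pull w0 i = w' -> exists l : 'I_#|above w'|, enum_val l = i.
  move=> h; have ia : i \in above w' by rewrite mem_above h.
  by exists (enum_rank_in ia i); rewrite enum_rankK_in.
have := @strong_indep_bound R K p basep J pl x opl.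
rewrite card_sum !card_ord addn1 ltnn => H; suff: False by []; apply: notF; apply: H => j.
have split_sum (q : J -> rat) : \sum_(l | pl l == pl j) q l *: x l =
    (if w == pl j then q (inr ord0) *: y else 0) +
    \sum_(l < #|above (pl j)|) q (inl (enum_val l)) *: theta ^+ l.
  by rewrite big_sumType /= ixE addrC; congr (_ + _); rewrite big_mkcond big_ord1.
have [ew|nw] := eqVneq w (pl j).
  exists k; split=> // q i ei; rewrite split_sum ew eqxx -ew.
  have [h1 h2] := hk (fun l => q (inl (enum_val l))) (q (inr ord0)).
  case: i ei => [i|i] ei; last by rewrite (ord1 i).
  by have [l <-] := mem_ex w i (etrans ei (esym ew)); apply: h1.
have [c [c0 hc]] := powers_strong_indep ow0 (opl j).
exists c; split=> // q i ei; rewrite split_sum (negPf nw) add0r.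
case: i ei => [i|i] ei; last by rewrite -ei eqxx in nw.
have [l <-] := mem_ex (pl j) i ei; exact: hc (fun l => q (inl (enum_val l))) l.
Qed.

Lemma places_are_pulled : exists i, w = pull w0 i.
Proof.
apply: contrapT => h; apply: (no_extra_indep (y := 1)); exists 1; split=> // q q'.
have e0 (l : 'I_e) : False.
  by have := enum_valP l; rewrite mem_above => /eqP ew; apply: h; exists (enum_val l).
split=> [j|]; first by case: (e0 j).
by rewrite big1 => [|l]; [rewrite addr0 (over_alg _ ow) mul1r | case: (e0 l)].
Qed.

Section InCompletion.
Variable C : completion w.
Local Notation F := (cpl_field C).
Local Notation ca := (@cpl_abs _ _ _ C).
Local Notation emb := (cpl_emb C).
Let aC : absolute_value ca := cpl_absP C.

Lemma emb_rat q : emb q%:A = ratr q.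
Proof. by rewrite alg_num_field fmorph_rat. Qed.

Lemma cpl_abs_rat q : ca (ratr q) = base_abs R p q.
Proof. by rewrite -emb_rat cpl_embP (over_alg _ ow). Qed.

Lemma Qp_rat q : in_Qp (ratr q : F).
Proof. by move=> d d0; exists q; rewrite subrr (av0 aC). Qed.

Lemma ratB_C q q' : ratr (q - q') = ratr q - ratr q' :> F.
Proof. by rewrite -!emb_rat scalerBl rmorphB. Qed.

Lemma QpB (x y : F) : in_Qp x -> in_Qp y -> in_Qp (x - y).
Proof.
move=> hx hy d d0; have d2 : 0 < d / 2 by lra.
have [a ha] := hx _ d2; have [b hb] := hy _ d2; exists (a - b).
rewrite ratB_C (_ : _ - _ = (x - ratr a) - (y - ratr b)); last by ring.
by apply: le_lt_trans (avB aC _ _) _; lra.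
Qed.

Lemma Qp0 : in_Qp (0 : F).
Proof. by have := Qp_rat 0; rewrite -emb_rat scale0r rmorph0. Qed.

Lemma QpD (x y : F) : in_Qp x -> in_Qp y -> in_Qp (x + y).
Proof.
by move=> hx hy; rewrite -[y]opprK; apply: QpB => //; rewrite -sub0r; apply: QpB => //; apply: Qp0.
Qed.

Lemma QpM (x y : F) : in_Qp x -> in_Qp y -> in_Qp (x * y).
Proof.
move=> hx hy d d0.
have x0 := av_ge0 aC x; have y0 := av_ge0 aC y.
have m0 : 0 < Num.min 1 (d / (ca x + ca y + 2)).
  by rewrite lt_min ltr01 divr_gt0 //; lra.
have [a] := hx _ m0; rewrite lt_min => /andP[a1 a2].
have [b] := hy _ m0; rewrite lt_min => /andP[b1 b2].
exists (a * b).
have -> : ratr (a * b) = ratr a * ratr b :> F.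
  by rewrite -!emb_rat -rmorphM /= -scalerAl mul1r scalerA.
rewrite (_ : _ - _ = (x - ratr a) * y + (x - (x - ratr a)) * (y - ratr b)); last by ring.
apply: le_lt_trans (avD aC _ _) _; rewrite !(avM aC).
have := avB aC x (x - ratr a).
move: a2 b2; rewrite !ltr_pdivlMr; try lra.
set u := ca (x - ratr a) in a1 *; set v := ca (y - ratr b) in b1 *.
have u0 : 0 <= u := av_ge0 aC _; have v0 : 0 <= v := av_ge0 aC _.
set t := ca (x - (x - ratr a)); have t0 : 0 <= t := av_ge0 aC _.
move=> h1 h2 h3.
have : t * v <= (ca x + 1) * v by rewrite ler_wpM2r //; lra.
have [uv|vu] := leP u v; nra.
Qed.

Lemma Qp_sum (I : finType) (f : I -> F) : (forall i, in_Qp (f i)) -> in_Qp (\sum_i f i).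
Proof.
by move=> h; apply: big_ind => [|x y|i _]; [exact: Qp0 | exact: QpD | exact: h].
Qed.

Lemma emb_comb (q : 'I_e -> rat) :
  emb (\sum_(l < e) q l *: theta ^+ l) = \sum_(l < e) ratr (q l) * emb (theta ^+ l).
Proof. by rewrite rmorph_sum /=; apply: eq_bigr => l _; rewrite -mulr_algl rmorphM emb_rat. Qed.

(** Rational approximations of the coefficients of a vanishing combination give
    a combination of small value, whose coefficients are small. *)
Lemma Qp_indep (d : 'I_e -> F) : (forall i, in_Qp (d i)) ->
  \sum_(l < e) d l * emb (theta ^+ l) = 0 -> forall i, d i = 0.
Proof.
move=> hd sd i; apply/(av_eq0 aC)/eqP; rewrite eq_le av_ge0 // andbT.
have [k [k0 hk]] := powers_strong_indep ow0 ow.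
pose B := \sum_(l < e) ca (emb (theta ^+ l)).
have B0 : 0 <= B by apply: sumr_ge0 => l _; apply: av_ge0.
apply/ler_addgt0Pl => d0 d00; rewrite addr0.
pose h := d0 / (1 + B / k).
have q0 : 0 < 1 + B / k by rewrite ltr_pwDl // divr_ge0 // ltW.
have h0 : 0 < h by rewrite divr_gt0.
have /choice[q hq] l := hd l h h0.
have : w (\sum_(l < e) q l *: theta ^+ l) <= h * B.
  rewrite -(cpl_embP C) emb_comb.
  have -> : \sum_(l < e) ratr (q l) * emb (theta ^+ l)
      = \sum_(l < e) (ratr (q l) - d l) * emb (theta ^+ l).
    by under [RHS]eq_bigr do rewrite mulrBl; rewrite sumrB sd subr0.
  apply: le_trans (av_sum aC _ _ _) _; rewrite mulr_sumr; apply: ler_sum => l _.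
  by rewrite (avM aC) ler_wpM2r ?av_ge0 // (av_distC aC); apply/ltW/hq.
move/(le_trans (hk q i)); rewrite mulrC -ler_pdivlMr // => h2.
have := avD aC (d i - ratr (q i)) (ratr (q i)); rewrite subrK cpl_abs_rat => h3.
have := hq i => h4; apply: le_trans h3 _.
apply: (@le_trans _ _ (h + h * B / k)); first by lra.
by rewrite -mulrA -{1}[h]mulr1 -mulrDr /h divfK // gt_eqF.
Qed.

(** An element at positive distance from the rational combinations of the
    powers of [theta] would enlarge this independent family.  Otherwise it is a
    limit of such combinations, and their coefficients are Cauchy sequences. *)
Lemma Qp_span (y : F) : exists c : 'I_e -> F, (forall i, in_Qp (c i)) /\
  y = \sum_(l < e) c l * emb (theta ^+ l).
Proof.
have [k [k0 hk]] := powers_strong_indep ow0 ow.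
have [[d [d0 far]]|near] := pselect (exists d, 0 < d /\
    forall q : 'I_e -> rat, d <= ca (y - emb (\sum_(l < e) q l *: theta ^+ l))).
  have d2 : 0 < d / 2 by lra.
  have [a ha] := cpl_dense y d2.
  have {}far (q : 'I_e -> rat) : d / 2 <= w (a + \sum_(l < e) q l *: theta ^+ l).
    have := far (fun l => - q l).
    under eq_bigr do rewrite scaleNr.
    rewrite sumrN rmorphN opprK -(cpl_embP C) rmorphD /=.
    set z := emb (\sum_(l < e) _).
    have := avD aC (y - emb a) (emb a + z); rewrite addrA subrK; lra.
  case: (no_extra_indep (y := a)).
  have wa0 := av_ge0 aw a.
  pose D := 1 + 2 * w a / d.
  have D1 : 1 <= D by rewrite lerDl divr_ge0 ?mulr_ge0 // ltW.
  have main q q' : d / 2 * base_abs R p q' <= w (q' *: a + \sum_(l < e) q l *: theta ^+ l).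
    have [->|q0] := eqVneq q' 0; first by rewrite (av0 ab) mulr0 av_ge0.
    have -> : q' *: a + \sum_(l < e) q l *: theta ^+ l
       = q' *: (a + \sum_(l < e) (q l / q') *: theta ^+ l).
      rewrite scalerDr; congr (_ + _); rewrite scaler_sumr; apply: eq_bigr => l _.
      by rewrite scalerA mulrC divfK.
    by rewrite (overZ _ _ ow) mulrC ler_wpM2l ?av_ge0.
  exists (Num.min (d / 2) (k / D)); split.
    by rewrite lt_min d2 divr_gt0 //; lra.
  move=> q q'; set z := w (_ + _); have z0 : 0 <= z := av_ge0 aw _.
  have hz := main q q'; rewrite -/z in hz; split=> [j|]; last first.
    by apply: le_trans hz; rewrite ler_wpM2r ?av_ge0 // ge_min lexx.
  apply: (@le_trans _ _ (k / D * base_abs R p (q j))).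
    by rewrite ler_wpM2r ?av_ge0 // ge_min lexx orbT.
  rewrite mulrAC ler_pdivrMr; last by lra.
  apply: le_trans (hk q j) _.
  have := avD aw (q' *: a + \sum_(l < e) q l *: theta ^+ l) (- (q' *: a)).
  rewrite (avN aw) addrAC subrr add0r (overZ _ _ ow) -/z => h.
  apply: le_trans h _; rewrite /D mulrDr mulr1 lerD2l.
  rewrite mulrA ler_pdivlMr // -mulrA.
  have : d / 2 * base_abs R p q' * w a <= z * w a by rewrite ler_wpM2r.
  by nra.
have /choice[q hq] (N : nat) : exists q : 'I_e -> rat,
    ca (y - emb (\sum_(l < e) q l *: theta ^+ l)) < N.+1%:R^-1.
  apply: contrapT => h; apply: near; exists N.+1%:R^-1; rewrite invr_gt0 ltr0n.
  by split=> // q; rewrite leNgt; apply/negP => lt; apply: h; exists q.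
have small (d : R) : 0 < d -> exists N, forall i, (N <= i)%N -> i.+1%:R^-1 < d.
  move=> d0; exists (Num.bound d^-1) => i Ni.
  rewrite -[ltRHS]invrK ltf_pV2 ?posrE ?invr_gt0 //.
  apply: lt_trans (archi_boundP _) _; first by rewrite invr_ge0 ltW.
  by rewrite ltr_nat.
have cau l : forall d : R, 0 < d -> exists N, forall i j, (N <= i)%N -> (N <= j)%N ->
    ca (ratr (q i l) - ratr (q j l)) < d.
  move=> d d0; have kd : 0 < k * d / 2 by rewrite divr_gt0 // mulr_gt0.
  have [N hN] := small _ kd; exists N => i j Ni Nj.
  rewrite -ratB_C cpl_abs_rat -(ltr_pM2l k0).
  apply: le_lt_trans (hk (fun l => q i l - q j l) l) _.
  under eq_bigr do rewrite scalerBl.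
  rewrite sumrB -(cpl_embP C) rmorphB /=.
  set u := emb _; set v := emb _.
  have -> : u - v = (y - v) - (y - u) by ring.
  apply: le_lt_trans (avB aC _ _) _.
  have hu : ca (y - u) < i.+1%:R^-1 := hq i.
  have hv : ca (y - v) < j.+1%:R^-1 := hq j.
  apply: le_lt_trans (lerD (ltW hv) (ltW hu)) _.
  move: (hN _ Ni) (hN _ Nj); move: (i.+1%:R^-1) (j.+1%:R^-1) => A B.
  by move=> ? ?; lra.
have /choice[c hc] l := cpl_complete (cau l).
exists c; split=> [l d d0|].
  by have [N /(_ N (leqnn _)) h] := hc l d d0; exists (q N l); rewrite (av_distC aC).
apply/eqP; rewrite -subr_eq0; apply/eqP/(av_eq0 aC)/eqP; rewrite eq_le av_ge0 // andbT.
apply/ler_addgt0Pl => d d0; rewrite addr0.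
pose B := \sum_(l < e) ca (emb (theta ^+ l)).
have B0 : 0 <= B by apply: sumr_ge0 => l _; apply: av_ge0.
have h0 : 0 < d / (1 + B) by rewrite divr_gt0 //; lra.
have [N1 hN1] := small _ h0.
have [N hN] : evt (fun N => forall l, l \in enum 'I_e -> ca (ratr (q N l) - c l) < d / (1 + B)).
  by apply: evt_all => l _; exact: hc l _ h0.
pose m := maxn N N1.
have := hq m; set z := emb _ => h1.
rewrite -[y](subrK z) -addrA; apply: le_trans (avD aC _ _) _.
have h2 : ca (z - \sum_(l < e) c l * emb (theta ^+ l)) <= d / (1 + B) * B.
  rewrite /z emb_comb -sumrB; apply: le_trans (av_sum aC _ _ _) _.
  rewrite mulr_sumr; apply: ler_sum => l _.
  rewrite -mulrBl (avM aC) ler_wpM2r ?av_ge0 //; apply/ltW/hN.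
    by rewrite leq_maxl.
  by rewrite mem_enum.
have h3 := hN1 m (leq_maxr _ _).
move: h1 h3; move: (m.+1%:R^-1) => A h1 h3.
apply: (@le_trans _ _ (d / (1 + B) + d / (1 + B) * B)); first by lra.
by rewrite -{1}[d / _]mulr1 -mulrDr divfK // gt_eqF //; lra.
Qed.

End InCompletion.

(** The powers of [theta] are a basis of every completion. *)
Lemma local_degreeE : local_degree w = e.
Proof.
have basis (C : completion w) (y : cpl_field C) :
    exists! c : {ffun 'I_e -> cpl_field C},
        (forall i, in_Qp (c i)) /\ y = \sum_(i < e) c i * cpl_emb C (theta ^+ i).
  have [c [hc yE]] := Qp_span y.
  exists (finfun c); split.
    split=> [i|]; first by rewrite ffunE.
    by rewrite yE; apply: eq_bigr => i _; rewrite ffunE.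
  move=> c' [hc' yE']; apply/ffunP => i; rewrite ffunE; apply/eqP; rewrite -subr_eq0.
  apply/eqP; apply: (Qp_indep (d := fun i => c i - c' i)) => [l|].
    by apply: QpB.
  under eq_bigr do rewrite mulrBl.
  by rewrite sumrB -yE -yE' subrr.
rewrite /local_degree; apply: xget_unique.
  have [C] := completion_exists aw.
  by exists C, (fun i => cpl_emb C (theta ^+ i)); apply: basis.
move=> m [C [b hb]].
pose b' (i : 'I_e) := cpl_emb C (theta ^+ i).
have /choice[A hA] i := hb (b' i).
have /choice[B hB] i := basis C (b i).
have prod_one (m1 m2 : nat) (b1 : 'I_m1 -> cpl_field C) (b2 : 'I_m2 -> cpl_field C)
    (P1 : 'I_m1 -> {ffun 'I_m2 -> cpl_field C}) (P2 : 'I_m2 -> {ffun 'I_m1 -> cpl_field C}) :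
    (forall y, exists! c : {ffun 'I_m1 -> cpl_field C},
        (forall i, in_Qp (c i)) /\ y = \sum_(i < m1) c i * b1 i) ->
    (forall i, (forall j, in_Qp (P1 i j)) /\ b1 i = \sum_j P1 i j * b2 j) ->
    (forall i, (forall j, in_Qp (P2 i j)) /\ b2 i = \sum_j P2 i j * b1 j) ->
    (m1 <= m2)%N.
  move=> uniq h1 h2.
  pose P := \matrix_(i < m1, j < m2) P1 i j; pose Q := \matrix_(i < m2, j < m1) P2 i j.
  apply: (@mulmx1_min _ _ _ P Q); apply/matrixP => i j.
  have [c [_ cu]] := uniq (b1 i).
  have e1 : c = [ffun l => (P *m Q) i l].
    apply: cu; split=> [l|].
      rewrite ffunE mxE; apply: Qp_sum => a; rewrite !mxE; apply: QpM.
        by case: (h1 i).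
      by case: (h2 a).
    have [_ {1}->] := h1 i.
    under [RHS]eq_bigr do rewrite ffunE mxE mulr_suml.
    rewrite exchange_big /=; apply: eq_bigr => a _.
    have [_ {1}->] := h2 a; rewrite mulr_sumr; apply: eq_bigr => l _.
    by rewrite !mxE mulrA.
  have e2 : c = [ffun l => (1%:M : 'M_m1) i l].
    apply: cu; split=> [l|].
      rewrite ffunE mxE; case: eqP => _; last exact: Qp0.
      by have := Qp_rat C 1; rewrite -emb_rat scale1r rmorph1.
    rewrite (bigD1 i) //= ffunE mxE eqxx mul1r big1 ?addr0 // => l /negPf ne.
    by rewrite ffunE mxE eq_sym ne mul0r.
  by have := e1; rewrite e2 => /ffunP/(_ j); rewrite !ffunE => <-.
apply/eqP; rewrite eqn_leq; apply/andP; split.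
  apply: (prod_one _ _ b b' B A hb) => i; [by case: (hB i) | by case: (hA i)].
apply: (prod_one _ _ b' b A B (basis C)) => i; [by case: (hA i) | by case: (hB i)].
Qed.

End Bound.

End LocalDegrees.
(** * The product formula *)

Section RationalProductFormula.
Variable R : realType.

Lemma ln_prod (I : Type) (r : seq I) (P : pred I) (f : I -> R) :
  (forall i, P i -> 0 < f i) ->
  ln (\prod_(i <- r | P i) f i) = \sum_(i <- r | P i) ln (f i).
Proof.
move=> f0; elim: r => [|i r IH]; first by rewrite !big_nil ln1.
rewrite !big_cons; case: ifP => // Pi.
by rewrite lnM ?IH // posrE; [exact: f0 | exact: prodr_gt0].
Qed.

Lemma ln_nat_primes (m B : nat) : (0 < m)%N -> (m < B)%N ->
  ln (m%:R : R) = \sum_(p < B | prime p) (logn p m)%:R * ln (p%:R : R).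
Proof.
case: B => // B m0 mB.
rewrite -[in LHS](partnT m0) (@widen_partn B) // big_mkord natr_prod ln_prod.
  rewrite [RHS]big_mkcond; apply: eq_bigr => i _ /=.
  case: ifP => [pi|npi]; last by rewrite lognE npi expn0 ln1.
  by rewrite natrX lnXn ?ltr0n ?prime_gt0 // mulr_natl.
by move=> i _; rewrite ltr0n expn_gt0; case: (val i).
Qed.

Lemma rational_product_formula (q : rat) : q != 0 ->
  exists B0, forall B, (B0 <= B)%N -> \sum_(p < B | is_base p) ln (base_abs R p q) = 0.
Proof.
move=> q0; pose a := `|numq q|%N; pose b := `|denq q|%N.
have a0 : (0 < a)%N by rewrite absz_gt0 numq_eq0.
have b0 : (0 < b)%N by rewrite absz_gt0 denq_neq0.
exists (maxn a b).+1 => -[//|B]; rewrite ltnS geq_max => /andP[aB bB].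
rewrite (bigD1 ord0) //= [in X in X + _]/base_abs /=.
have -> : `|ratr q : R| = a%:R / b%:R.
  by rewrite /ratr normrM normfV -!intr_norm -!natr_absz.
rewrite ln_div ?posrE ?ltr0n // (@ln_nat_primes a B.+1) ?(@ln_nat_primes b B.+1) //.
rewrite -sumrB.
rewrite [X in _ + X](eq_bigl (fun p : 'I_B.+1 => prime p)); last first.
  by move=> p; rewrite /is_base -val_eqE /=; case: (val p) => [|n] //=; rewrite andbT.
rewrite -big_split /= big1 // => p pp.
rewrite /base_abs; case: eqP => [p0|_]; first by rewrite p0 in pp.
rewrite /padic_abs (negPf q0) -/a -/b.
have pg : 0 < p%:R :> R by rewrite ltr0n prime_gt0.
rewrite ln_div ?posrE ?exprn_gt0 // !lnXn // !mulr_natl; ring.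
Qed.

Lemma base_abs_prime p : prime p -> base_abs R p p%:R = p%:R^-1.
Proof.
move=> pp; rewrite /base_abs; case: eqP => [p0|_]; first by rewrite p0 in pp.
have := @padic_abs_frac R p p%:Z 1 pp; rewrite divr1 => ->; last by [].
  by rewrite logn1 expr0 div1r absz_nat -[X in logn _ X]expn1 pfactorK // expr1.
by case: p pp.
Qed.

Lemma base_abs_other p p' : prime p -> is_base p' -> p' != p -> 1 <= base_abs R p' p%:R.
Proof.
move=> pp /orP[/eqP-> _|pp' ne].
  by rewrite /base_abs /= ratr_nat normr_nat ler1n prime_gt0.
rewrite /base_abs; case: eqP => [p0|_]; first by rewrite p0 in pp'.
have := @padic_abs_frac R p' p%:Z 1 pp'; rewrite divr1 => ->; last by [].
  by rewrite logn1 expr0 div1r absz_nat logn_prime // (negPf ne) expr0 invr1.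
by case: p pp {ne}.
Qed.

Lemma lies_over_inj (K : fieldType) p p' (w : K -> R) : is_base p -> is_base p' ->
  lies_over p w -> lies_over p' w -> p = p'.
Proof.
have main q q' : prime q -> is_base q' -> lies_over q w -> lies_over q' w -> q = q'.
  move=> pq bq' [_ h] [_ h']; apply/eqP; rewrite eq_sym; apply: contraT => ne.
  have := base_abs_other pq bq' ne; rewrite -h' h base_abs_prime //.
  by rewrite leNgt invf_lt1 ?ltr0n ?prime_gt0 // ltr1n prime_gt1.
case/orP=> [/eqP->|pp]; last exact: main.
by case/orP=> [/eqP-> //|pp'] o o'; apply/esym/main.
Qed.

(** Apply the triangle inequality to [(a + b) ^+ n]: since the integers are
    bounded, [w (a + b) ^+ n] grows at most like [n + 1] times the maximum. *)
Lemma ultrametric (K : fieldType) p (w : K -> R) a b : prime p -> lies_over p w ->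
  w (a + b) <= Num.max (w a) (w b).
Proof.
move=> pp [aw hw]; set m := Num.max _ _.
have wnat n : w n%:R <= 1.
  rewrite -(ratr_nat K n) hw; have := base_abs_int R n pp; apply: le_trans.
  by rewrite -pmulrn.
have m0 : 0 <= m by rewrite le_max av_ge0.
have ha : w a <= m by rewrite le_max lexx.
have hb : w b <= m by rewrite le_max lexx orbT.
have key n : w (a + b) ^+ n <= n.+1%:R * m ^+ n.
  rewrite -(avX aw) exprDn; apply: le_trans (av_sum aw _ _ _) _.
  rewrite mulr_natl -[n.+1 in X in _ <= X]card_ord -sumr_const.
  apply: ler_sum => i _; rewrite -mulr_natl (avM aw) -[leRHS]mul1r.
  apply: ler_pM; rewrite ?(av_ge0 aw) ?wnat //.
  rewrite (avM aw) !(avX aw).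
  have -> : m ^+ n = m ^+ (n - i) * m ^+ i by rewrite -exprD subnK // -ltnS.
  by apply: ler_pM; rewrite ?exprn_ge0 ?(av_ge0 aw) //; apply: lerXn2r; rewrite ?nnegrE ?(av_ge0 aw).
have [mz|mn0] := eqVneq m 0.
  by have := key 1%N; rewrite mz expr1 expr1 mulr0.
have mp : 0 < m by rewrite lt_def mn0.
rewrite leNgt; apply/negP => lt.
pose t := w (a + b) / m; have t1 : 1 < t by rewrite ltr_pdivlMr // mul1r.
have keyt n : t ^+ n <= n.+1%:R.
  by rewrite expr_div_n ler_pdivrMr ?exprn_gt0.
pose d := t - 1; have d0 : 0 < d by rewrite subr_gt0.
have bern n : 1 + n%:R * d <= t ^+ n.
  elim: n => [|n IH]; first by rewrite mul0r addr0 expr0.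
  rewrite exprSr; apply: (@le_trans _ _ ((1 + n%:R * d) * t)).
    rewrite -natr1 -subr_ge0 [X in 0 <= X](_ : _ = n%:R * d ^+ 2); last by rewrite /d; ring.
    by rewrite mulr_ge0 // sqr_ge0.
  by rewrite ler_wpM2r // ltW // (lt_trans ltr01).
pose n := (Num.bound (3 / d ^+ 2)).+1.
have hn : 3 < n%:R * d ^+ 2.
  rewrite -ltr_pdivrMr ?exprn_gt0 //.
  apply: lt_trans (archi_boundP _) _; last by rewrite ltr_nat.
  by rewrite divr_ge0 ?exprn_ge0 // ltW.
have n1 : 1 <= n%:R :> R by rewrite ler1n.
have h1 := keyt (n * 2)%N; have h2 := bern n.
have h3 : (1 + n%:R * d) ^+ 2 <= t ^+ (n * 2).
  have t0 : 0 <= t by lra.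
  rewrite exprM; apply: lerXn2r; rewrite ?nnegrE ?exprn_ge0 //.
  by rewrite addr_ge0 // mulr_ge0 // ltW.
have := le_trans h3 h1; rewrite -natr1 natrM.
have : 0 <= n%:R * d by rewrite mulr_ge0 // ltW.
have : 3 * n%:R < n%:R * (n%:R * d ^+ 2) by rewrite mulrC ltr_pM2l //; lra.
by rewrite expr2; nra.
Qed.

End RationalProductFormula.

(** Constants that depend on the place [p] of the rationals only, and differ
    from 1 at finitely many of them. *)
Definition adelic (R : realType) (C : nat -> R) :=
  (forall p, 1 <= C p) /\ exists B, forall p, (B <= p)%N -> C p = 1.

Section Adelic.
Variable R : realType.
Implicit Types C D : nat -> R.

Lemma adelic1 : adelic (fun=> 1 : R). Proof. by split=> //; exists 0%N. Qed.

Lemma adelicM C D : adelic C -> adelic D -> adelic (fun p => C p * D p).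
Proof.
move=> [C1 [B hB]] [D1 [B' hB']]; split=> [p|]; first by rewrite mulr_ege1.
exists (maxn B B') => p; rewrite geq_max => /andP[h1 h2].
by rewrite hB // hB' // mulr1.
Qed.

Lemma adelicX C n : adelic C -> adelic (fun p => C p ^+ n).
Proof.
move=> aC; elim: n => [|n IH]; first exact: adelic1.
by have := adelicM aC IH; congr adelic; apply/funext => p; rewrite exprS.
Qed.

Lemma adelic_gt0 C p : adelic C -> 0 < C p.
Proof. by case=> h _; apply: lt_le_trans (h p). Qed.

Lemma adelic_ge1 C p : adelic C -> 1 <= C p. Proof. by case. Qed.

Lemma adelic_prod (I : Type) (r : seq I) (C : I -> nat -> R) :
  (forall i, adelic (C i)) -> adelic (fun p => \prod_(i <- r) C i p).
Proof.
move=> h; elim: r => [|i r IH].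
  by have := adelic1; congr adelic; apply/funext => p; rewrite big_nil.
by have := adelicM (h i) IH; congr adelic; apply/funext => p; rewrite big_cons.
Qed.

Lemma le_adelic_prod (I : finType) (C : I -> nat -> R) i p :
  (forall i, adelic (C i)) -> C i p <= \prod_i C i p.
Proof.
move=> h; rewrite (bigD1 i) //= ler_peMr //; first exact/ltW/adelic_gt0.
by apply: (big_ind (fun x => 1 <= x)) => // [x y|j _]; [exact: mulr_ege1 | exact: adelic_ge1].
Qed.

(** The constant of the ultrametric inequality in the form common to all
    places. *)
Definition kap (p : nat) : R := if p == 0%N then 2 else 1.

Lemma adelic_kap : adelic kap.
Proof.
split=> [p|]; first by rewrite /kap; case: ifP; rewrite ?ler1n.
by exists 1%N => -[].
Qed.

Lemma kapP (K : fieldType) p (w : K -> R) a b : is_base p -> lies_over p w ->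
  w (a + b) <= kap p * Num.max (w a) (w b).
Proof.
move=> bp ow; rewrite /kap; case: eqP => [_|p0].
  apply: le_trans (avD ow.1 _ _) _; rewrite mulr2n mulrDl mul1r.
  by apply: lerD; rewrite le_max lexx ?orbT.
rewrite mul1r; apply: ultrametric ow; by case/orP: bp => // /eqP.
Qed.

Lemma kap_sum (K : fieldType) p (w : K -> R) (I : Type) (s : seq I) (f : I -> K) b :
  is_base p -> lies_over p w -> 0 <= b -> (forall i, w (f i) <= b) ->
  w (\sum_(i <- s) f i) <= kap p ^+ size s * b.
Proof.
move=> bp ow b0 hf; have k1 : 1 <= kap p := adelic_ge1 p adelic_kap.
have k0 := le_trans ler01 k1.
elim: s => [|i s IH]; first by rewrite big_nil (av0 (over_av ow)) mulr_ge0 // exprn_ge0.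
rewrite big_cons exprS -mulrA; apply: le_trans (kapP _ _ bp ow) _.
rewrite ler_wpM2l ?ge_max ?IH ?andbT //.
by apply: le_trans (hf i) _; rewrite ler_peMl // exprn_ege1.
Qed.

Lemma kap_sum_ord (K : fieldType) p (w : K -> R) n (f : 'I_n -> K) b :
  is_base p -> lies_over p w -> 0 <= b -> (forall i, w (f i) <= b) ->
  w (\sum_i f i) <= kap p ^+ n * b.
Proof.
move=> bp ow b0 hf; have := kap_sum (enum 'I_n) bp ow b0 hf.
by rewrite big_enum size_enum_ord.
Qed.

End Adelic.

Section PlacesOfNumberField.
Variable R : realType.

(** The places of a number field of degree [n] over a given [p] come from [n]
    embeddings, the local degree of a place is the number of embeddings that
    yield it, and the product over the embeddings is the norm. *)
Lemma places_structure (K : fieldExtType rat) (n := \dim {:K}) :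
  exists (W : nat -> 'I_n -> K -> R) (N : K -> rat),
  [/\ forall p i, is_base p -> lies_over p (W p i),
      forall p w, is_base p -> lies_over p w -> exists i, w = W p i,
      forall p w, is_base p -> lies_over p w -> local_degree w = #|[pred i | W p i == w]|,
      forall a, a != 0 -> N a != 0 &
      forall p a, is_base p -> \prod_i W p i a = base_abs R p (N a)].
Proof.
have [M [theta [s [sinj coords]]]] := number_field_embeddings K.
have /choice[N NE] := exists_norm sinj coords.
have /choice[w0 hw0] (p : nat) : exists w0 : M -> R, is_base p -> lies_over p w0.
  have [bp|nb] := boolP (is_base p); last by exists (fun=> 0).
  by have [w h] := exists_over R M bp; exists w.
exists (fun p i => pull s (w0 p) i), N; split.
- by move=> p i bp; apply/pull_over/hw0.
- by move=> p w bp ow; apply: (places_are_pulled sinj bp (hw0 p bp) ow).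
- by move=> p w bp ow; apply: (local_degreeE sinj bp (hw0 p bp) ow).
- move=> a a0; have : \prod_i s i a != 0.
    by apply/prodf_neq0 => i _; rewrite fmorph_eq0.
  by rewrite -NE scaler_eq0 oner_eq0 orbF.
- move=> p a bp; rewrite /pull -(av_prod (hw0 p bp).1) -NE.
  exact: over_alg (hw0 p bp).
Qed.

(** At all but finitely many [p], the monic relation that [a] satisfies over
    the rationals has integral coefficients, and the values of [a] are at
    most 1. *)
Lemma alg_bounded (K : fieldExtType rat) (a : K) :
  exists2 C, adelic C & forall p (w : K -> R), is_base p -> lies_over p w -> w a <= C p.
Proof.
have [W [N [W1 W2 _ _ _]]] := places_structure K.
have /polyOver1P[f fE] := minPolyOver 1 a.
have mf : map_poly (in_alg K) f \is monic by rewrite -fE monic_minPoly.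
pose n := (size f).-1.
have szf : size f = n.+1.
  by rewrite /n prednK // -(size_map_poly (in_alg K)) -fE size_minPoly.
have rel : a ^+ n = - \sum_(i < n) f`_i *: a ^+ i.
  have := minPolyxx 1 a; rewrite fE horner_coef size_map_poly szf big_ord_recr /=.
  have -> : (map_poly (in_alg K) f)`_n = 1.
    by move/monicP: mf; rewrite /lead_coef size_map_poly szf.
  rewrite mul1r addrC => /eqP; rewrite addr_eq0 => /eqP ->; congr (- _).
  by apply: eq_bigr => i _; rewrite coef_map /= mulr_algl.
pose B := (\sum_(i < n) `|denq f`_i|%N).+2.
have small p (w : K -> R) : prime p -> (B <= p)%N -> lies_over p w -> w a <= 1.
  move=> pp Bp ow; rewrite leNgt; apply/negP => lt; have aw := ow.1.
  have coefle (i : 'I_n) : base_abs R p f`_i <= 1.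
    rewrite /base_abs; case: eqP => [p0|_]; first by rewrite p0 in pp.
    rewrite /padic_abs; case: eqP => _; first exact: ler01.
    have -> : logn p `|denq f`_i|%N = 0%N.
      apply/eqP; rewrite -leqn0 leqNgt logn_gt0 mem_primes; apply/negP => /and3P[_ d0 /dvdn_leq].
      move=> /(_ d0); rewrite leqNgt; apply/negP; rewrite negbK; apply: leq_trans Bp.
      by rewrite /B ltnS (bigD1 i) //= -addnS leq_addr.
    rewrite expr0 div1r invf_le1 ?exprn_gt0 ?ltr0n ?prime_gt0 //.
    by rewrite exprn_ege1 // ler1n prime_gt0.
  have [n0|n0] := posnP n.
    have := rel; rewrite n0 big_ord0 oppr0 expr0 => /eqP; by rewrite oner_eq0.
  have : w (a ^+ n) <= w a ^+ n.-1.
    rewrite rel (avN aw).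
    apply: (big_ind (fun x => w x <= w a ^+ n.-1)).
    - by rewrite (av0 aw) exprn_ge0 ?av_ge0.
    - move=> x y hx hy; apply: le_trans (ultrametric _ _ pp ow) _.
      by rewrite ge_max hx hy.
    move=> i _; rewrite (overZ _ _ ow) (avX aw) -[leRHS]mul1r.
    have bp : is_base p by rewrite /is_base pp orbT.
    apply: ler_pM; rewrite ?exprn_ge0 ?(av_ge0 aw) ?(av_ge0 (base_abs_valued R bp)) //.
    by apply: ler_weXn2l; [exact: ltW | rewrite -ltnS prednK].
  rewrite (avX aw) -{1}(prednK n0) exprS -ler_pdivlMr; last first.
    by rewrite exprn_gt0 // (lt_trans _ lt).
  by rewrite divff ?leNgt ?lt // expf_neq0 // gt_eqF // (lt_trans _ lt).
exists (fun p => if (p < B)%N && is_base p then 1 + \sum_i W p i a else 1).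
  split=> [p|]; last by exists B => p; rewrite leqNgt => /negPf ->.
  case: ifP => // /andP[_ bp]; rewrite lerDl sumr_ge0 // => i _.
  exact: (av_ge0 (over_av (W1 p i bp))).
move=> p w bp ow; rewrite bp andbT; case: ltnP => [_|Bp].
  have [i ->] := W2 p w bp ow; rewrite (bigD1 i) //= addrCA lerDl addr_ge0 // sumr_ge0 //.
  by move=> j _; apply: (av_ge0 (over_av (W1 p j bp))).
have pp : prime p by case/orP: bp => // /eqP p0; rewrite p0 in Bp.
exact: small pp Bp ow.
Qed.

End PlacesOfNumberField.
(** * Heights *)

Section PlaceSums.
Variables (R : realType) (k : fieldExtType rat).

Definition place_height (L : fieldExtType k) (f : (L -> R) -> R) : R :=
  (\sum_(w \in places R L) (local_degree w)%:R * ln (f w)) / (rel_degree L)%:R.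

Definition size_fun (L : fieldExtType k) (f : (L -> R) -> R) :=
  (forall p w, is_base p -> lies_over p w -> 0 < f w) /\
  exists B, forall p w, is_base p -> lies_over p w -> (B <= p)%N -> f w = 1.

Lemma rel_degree_gt0 (L : fieldExtType k) : 0 < (rel_degree L)%:R :> R.
Proof. by rewrite ltr0n adim_gt0. Qed.

Lemma places_structure_ext (L : fieldExtType k) :
  exists n (W : nat -> 'I_n -> L -> R) (N : L -> rat),
  [/\ n = (\dim {:L} * \dim {:k})%N,
      forall p i, is_base p -> lies_over p (W p i),
      forall p (w : L -> R), is_base p -> lies_over p w -> exists i, w = W p i &
  [/\ forall p (w : L -> R), is_base p -> lies_over p w -> local_degree w = #|[pred i | W p i == w]|,
      forall a, a != 0 -> N a != 0 &
      forall p a, is_base p -> \prod_i W p i a = base_abs R p (N a)]].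
Proof.
have [W [N [h1 h2 h3 h4 h5]]] := places_structure R (baseFieldType L).
have e : baseVspace {:L} = fullv.
  apply/vspaceP => x; rewrite mem_baseVspace.
  by transitivity true; [|symmetry]; exact: memvf.
exists (\dim {:baseFieldType L}), W, N; split=> //.
by rewrite -dim_baseVspace e.
Qed.

(** A place contributes once for each embedding that induces it, that is,
    [local_degree] times: so the sum runs over the embeddings. *)
Lemma place_heightE (L : fieldExtType k) :
  exists n (W : nat -> 'I_n -> L -> R),
  [/\ n = (\dim {:L} * \dim {:k})%N,
      forall p i, is_base p -> lies_over p (W p i),
      forall p (w : L -> R), is_base p -> lies_over p w -> (0 < local_degree w)%N,
      forall f B, (forall p (w : L -> R), is_base p -> lies_over p w -> (B <= p)%N -> f w = 1) ->
        place_height f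
        = (\sum_(p < B | is_base p) \sum_i ln (f (W p i))) / (rel_degree L)%:R &
      forall a, a != 0 -> exists B0, forall B, (B0 <= B)%N ->
        \sum_(p < B | is_base p) \sum_i ln (W p i a) = 0].
Proof.
have [n [W [N [nE W1 W2 [W3 N0 NE]]]]] := places_structure_ext L.
exists n, W; split=> //.
- move=> p w bp ow; rewrite (W3 p w bp ow); have [i ->] := W2 p w bp ow.
  by apply/card_gt0P; exists i; rewrite !inE.
- move=> f B fB; rewrite /place_height; congr (_ / _).
  pose s := undup [seq W (val x.1) x.2 | x : 'I_B * 'I_n <- enum {: 'I_B * 'I_n} & is_base (val x.1)].
  have sP w : reflect (exists p i, [/\ (p < B)%N, is_base p & w = W p i]) (w \in s).
    rewrite mem_undup; apply: (iffP mapP) => [[[p i]]|[p [i [pB bp ->]]]].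
      by rewrite mem_filter => /andP[/= bp _] ->; exists p, i.
    exists (Ordinal pB, i); last by [].
    by rewrite mem_filter /= bp mem_enum.
  rewrite (@fsbigE _ _ _ _ _ s) ?undup_uniq //; first last.
  - move=> w /places_over[p bp ow] ws; rewrite (fB p w bp ow) ?ln1 ?mulr0 //.
    rewrite leqNgt; apply: contra ws => pB; apply/sP.
    by have [i wE] := W2 p w bp ow; exists p, i.
  - by move=> w /sP[p [i [pB bp ->]]]; apply/places_over; exists p => //; apply: W1.
  transitivity (\sum_(w <- s) \sum_(p < B | is_base p) \sum_i
      (if W p i == w then ln (f w) else 0)).
    rewrite big_seq_cond [RHS]big_seq; apply: eq_big => [w|w /andP[/sP[p [i [pB bp wE]]] _]].
      apply: andb_idr => /sP[p [i [_ bp ->]]]; apply/mem_set/places_over.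
      by exists p => //; apply: W1.
    have ow : lies_over p w by rewrite wE; apply: W1.
    rewrite (bigD1 (Ordinal pB)) //= [X in _ + X]big1 ?addr0 => [|p' /andP[bp' ne]].
      rewrite -big_mkcond sumr_const mulr_natl (W3 p w bp ow).
      by congr (_ *+ _); apply: eq_card => j; rewrite !inE.
    apply: big1 => j _; case: eqP => // e; case/eqP: ne; apply: val_inj => /=.
    by apply: (lies_over_inj bp' bp (W1 p' j bp')); rewrite e.
  rewrite exchange_big /=; apply: eq_bigr => p bp.
  rewrite exchange_big /=; apply: eq_bigr => i _.
  rewrite (bigD1_seq (W p i)) ?undup_uniq //=; last by apply/sP; exists p, i.
  by rewrite eqxx big1 ?addr0 // => w; rewrite eq_sym => /negPf ->.
- move=> a a0; have [B0 hB0] := rational_product_formula R (N0 a a0).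
  exists B0 => B /hB0 e; rewrite -[RHS]e; apply: eq_bigr => p bp.
  rewrite -(NE p a bp) ln_prod // => i _; exact: (av_gt0 (over_av (W1 (val p) i bp)) a0).
Qed.

Lemma place_heightM (L : fieldExtType k) f g : @size_fun L f -> size_fun g ->
  place_height (fun w => f w * g w) = place_height f + place_height g.
Proof.
have [n [W [_ W1 _ WE _]]] := place_heightE L.
move=> [f0 [B hB]] [g0 [B' hB']]; pose m := maxn B B'.
have hf p w : is_base p -> lies_over p w -> (m <= p)%N -> f w = 1.
  by move=> bp ow mp; apply: hB ow _ => //; apply: leq_trans mp; rewrite leq_maxl.
have hg p w : is_base p -> lies_over p w -> (m <= p)%N -> g w = 1.
  by move=> bp ow mp; apply: hB' ow _ => //; apply: leq_trans mp; rewrite leq_maxr.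
rewrite (WE f m hf) (WE g m hg) (WE _ m); last first.
  by move=> p w bp ow mp; rewrite (hf p w) ?(hg p w) // mulr1.
rewrite -mulrDl -big_split /=; congr (_ / _); apply: eq_bigr => p bp.
rewrite -big_split /=; apply: eq_bigr => i _.
by rewrite lnM // posrE; [apply: (f0 p) | apply: (g0 p)] => //; apply: W1.
Qed.

(** Sizes that agree up to an adelic constant give heights that agree up to
    a constant that does not depend on the field. *)
Lemma place_height_le C : adelic C -> exists2 c : R, 0 <= c &
  forall (L : fieldExtType k) f g, @size_fun L f -> size_fun g ->
  (forall p w, is_base p -> lies_over p w -> f w <= C p * g w) ->
  place_height f <= place_height g + c.
Proof.
move=> aC; have [C1 [D hD]] := aC.
have lnC p : 0 <= ln (C p) by rewrite ln_ge0.
exists ((\dim {:k})%:R * \sum_(p < D) ln (C p)).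
  by rewrite mulr_ge0 // sumr_ge0.
move=> L f g [f0 [B hB]] [g0 [B' hB']] le.
have [n [W [nE W1 _ WE _]]] := place_heightE L.
pose m := maxn D (maxn B B').
have hf p w : is_base p -> lies_over p w -> (m <= p)%N -> f w = 1.
  move=> bp ow mp; apply: hB ow _ => //; apply: leq_trans mp.
  by rewrite /m maxnCA leq_maxl.
have hg p w : is_base p -> lies_over p w -> (m <= p)%N -> g w = 1.
  move=> bp ow mp; apply: hB' ow _ => //; apply: leq_trans mp.
  by rewrite /m maxnA leq_maxr.
rewrite (WE f m hf) (WE g m hg).
have r0 := rel_degree_gt0 L.
rewrite ler_pdivrMr // mulrDl divfK ?gt_eqF //.
have -> : (\dim {:k})%:R * (\sum_(p < D) ln (C p)) * (rel_degree L)%:R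
    = \sum_(p < D) \sum_(i < n) ln (C p).
  rewrite mulrAC -natrM mulr_sumr; apply: eq_bigr => p _.
  by rewrite sumr_const card_ord nE /rel_degree mulnC mulr_natl.
have -> : \sum_(p < D) \sum_(i < n) ln (C p) = \sum_(p < m) \sum_(i < n) ln (C p).
  rewrite (big_ord_widen m (fun p => \sum_(i < n) ln (C p))) ?leq_maxl //.
  rewrite [RHS](bigID (fun p : 'I_m => p < D)%N) /= [X in _ = _ + X]big1 ?addr0 // => p.
  by rewrite -leqNgt => Dp; rewrite hD // ln1 big1.
rewrite [X in _ <= _ + X](bigID (fun p : 'I_m => is_base p)) /= addrA.
apply: ler_wpDr; first by do 2![apply: sumr_ge0 => ? _].
rewrite -big_split /=; apply: ler_sum => p bp.
rewrite -big_split /=; apply: ler_sum => i _.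
have ow := W1 p i bp; have gp := g0 _ _ bp ow.
rewrite addrC -lnM ?posrE ?adelic_gt0 // ler_ln ?posrE ?(f0 p) ?mulr_gt0 ?adelic_gt0 //.
exact: le.
Qed.

Lemma place_height_eq (L : fieldExtType k) f g :
  (forall p w, is_base p -> lies_over p w -> f w = g w) ->
  place_height f = @place_height L g.
Proof.
move=> h; rewrite /place_height; congr (_ / _); apply: eq_fsbigr => w.
by rewrite inE => /places_over[p bp ow]; rewrite (h p).
Qed.

Lemma size_funM (L : fieldExtType k) f g : @size_fun L f -> size_fun g ->
  size_fun (fun w => f w * g w).
Proof.
move=> [f0 [B hB]] [g0 [B' hB']]; split=> [p w bp ow|].
  by rewrite mulr_gt0 ?(f0 p) ?(g0 p).
exists (maxn B B') => p w bp ow; rewrite geq_max => /andP[h1 h2].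
by rewrite (hB p) // (hB' p) // mulr1.
Qed.

Lemma size_fun1 (L : fieldExtType k) : @size_fun L (fun=> 1).
Proof. by split=> //; exists 0%N. Qed.

Lemma size_funX (L : fieldExtType k) f n : @size_fun L f -> size_fun (fun w => f w ^+ n).
Proof.
move=> [f0 [B hB]]; split=> [p w bp ow|]; first by rewrite exprn_gt0 // (f0 p).
by exists B => p w bp ow h; rewrite (hB p) // expr1n.
Qed.

Lemma place_height1 (L : fieldExtType k) : @place_height L (fun=> 1) = 0.
Proof.
have h := place_heightM (size_fun1 L) (size_fun1 L).
rewrite (@place_height_eq L _ (fun=> 1)) in h; first by lra.
by move=> *; rewrite mulr1.
Qed.

Lemma place_heightX (L : fieldExtType k) f n : @size_fun L f ->
  place_height (fun w => f w ^+ n) = n%:R * place_height f.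
Proof.
move=> sf; elim: n => [|n IH].
  by rewrite mul0r -(place_height1 L); apply: place_height_eq => *; rewrite expr0.
rewrite -natr1 mulrDl mul1r -IH -place_heightM //; last exact: size_funX.
by apply: place_height_eq => *; rewrite exprSr.
Qed.

Lemma alg_bounded_ext (L : fieldExtType k) (a : L) :
  exists2 C : nat -> R, adelic C &
    forall p (w : L -> R), is_base p -> lies_over p w -> w a <= C p.
Proof. exact: (alg_bounded R (a : baseFieldType L)). Qed.

Lemma place_restr_over (L : fieldExtType k) p (w : L -> R) :
  lies_over p w -> lies_over p (place_restr w).
Proof.
move=> [aw hw]; split; last by move=> q; rewrite /place_restr -hw -[in RHS](fmorph_rat (in_alg L)).
rewrite /place_restr; split=> [a|a|a b|a b].
- exact: av_ge0.
- rewrite (av_eq0 aw); split=> [/eqP|->]; last by rewrite scale0r.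
  by rewrite scaler_eq0 oner_eq0 orbF => /eqP.
- by rewrite -(avM aw) -scalerAl mul1r scalerA.
- by rewrite scalerDl; apply: avD.
Qed.

(** The places of [L] restrict to places of [k], so the constant does not depend
    on [L]. *)
Lemma scalar_bounded (a : k) : exists2 C : nat -> R, adelic C &
  forall (L : fieldExtType k) p (w : L -> R), is_base p -> lies_over p w -> w a%:A <= C p.
Proof.
have [C aC hC] := alg_bounded R a.
by exists C => // L p w bp /place_restr_over; apply: hC.
Qed.

Lemma size_fun_abs (L : fieldExtType k) (a : L) : a != 0 -> size_fun (fun w : L -> R => w a).
Proof.
move=> a0; split=> [p w bp ow|]; first exact: (av_gt0 (over_av ow) a0).
have [C aC hC] := alg_bounded_ext a; have [D aD hD] := alg_bounded_ext a^-1.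
have [_ [B hB]] := adelicM aC aD; exists B => p w bp ow Bp.
have aw := over_av ow; have w0 := av_gt0 aw a0.
have h1 := hC p w bp ow; have h2 := hD p w bp ow; have h3 := hB p Bp.
have C1 := adelic_ge1 p aC; have D1 := adelic_ge1 p aD.
have c1 : C p = 1 by apply/eqP; rewrite eq_le C1 andbT; nra.
have d1 : D p = 1 by apply/eqP; rewrite eq_le D1 andbT; nra.
apply/eqP; rewrite eq_le -{1}c1 h1 /=.
by move: h2; rewrite (avV aw) d1 invf_le1.
Qed.

(** The product formula: the values over [p] multiply to the value of the norm,
    a rational number. *)
Lemma place_height_abs (L : fieldExtType k) (a : L) : a != 0 ->
  place_height (fun w : L -> R => w a) = 0.
Proof.
move=> a0; have [_ [B hB]] := size_fun_abs a0.
have [n [W [_ W1 _ WE WN]]] := place_heightE L.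
have [B0 hB0] := WN a a0.
rewrite (WE _ (maxn B B0)) => [|p w bp ow mp]; first by rewrite hB0 ?leq_maxr ?mul0r.
by apply: (hB p) => //; apply: leq_trans mp; rewrite leq_maxl.
Qed.

Lemma local_degree_gt0 (L : fieldExtType k) p (w : L -> R) :
  is_base p -> lies_over p w -> (0 < local_degree w)%N.
Proof. by have [n [W [_ _ h _ _]]] := place_heightE L; apply: h. Qed.

Definition smax (L : fieldType) (w : L -> R) (s : seq L) : R :=
  \big[Num.max/0]_(a <- s) w a.

Section Smax.
Variables (L : fieldType) (w : L -> R).
Hypothesis aw : absolute_value w.
Implicit Types s : seq L.

Lemma smax_ge0 s : 0 <= smax w s.
Proof.
by rewrite /smax; elim/big_ind: _ => // [x y hx hy|i _]; rewrite ?le_max ?hx ?av_ge0.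
Qed.

Lemma le_smax s a : a \in s -> w a <= smax w s.
Proof.
rewrite /smax; elim: s => // b s IH; rewrite inE big_cons le_max.
by case/predU1P => [->|/IH ->]; rewrite ?lexx ?orbT.
Qed.

Lemma smax_le s b : 0 <= b -> (forall a, a \in s -> w a <= b) -> smax w s <= b.
Proof.
move=> b0 h; rewrite /smax big_seq; elim/big_ind: _ => // x y hx hy.
by rewrite ge_max hx hy.
Qed.

Lemma smax_gt0 s a : a \in s -> a != 0 -> 0 < smax w s.
Proof. by move=> h a0; apply: lt_le_trans (le_smax h); apply: av_gt0. Qed.

Lemma smaxZ c s : smax w [seq c * a | a <- s] = w c * smax w s.
Proof.
rewrite /smax big_map; elim: s => [|a s IH]; first by rewrite !big_nil mulr0.
by rewrite !big_cons IH avM // maxr_pMr ?av_ge0.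
Qed.

Lemma smax_sub s t : {subset s <= t} -> smax w s <= smax w t.
Proof. by move=> h; apply: smax_le => [|a /h]; [exact: smax_ge0 | exact: le_smax]. Qed.

End Smax.

Lemma size_fun_smax (L : fieldExtType k) (s : seq L) a : a \in s -> a != 0 ->
  size_fun (fun w => smax w s).
Proof.
move=> sa a0; split=> [p w bp ow|]; first exact: (smax_gt0 (over_av ow) sa a0).
have [_ [B hB]] := size_fun_abs a0.
have [C aC hC] : exists2 C : nat -> R, adelic C & forall p (w : L -> R) b, is_base p -> lies_over p w ->
    b \in s -> w b <= C p.
  elim: s {sa} => [|b s [C aC hC]]; first by exists (fun=> 1); [exact: adelic1|].
  have [D aD hD] := alg_bounded_ext b.
  exists (fun p => C p * D p); first exact: adelicM.
  move=> p w c bp ow; rewrite inE => /predU1P[->|cs].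
    by apply: le_trans (hD p w bp ow) _; rewrite ler_peMl ?adelic_ge1 // ltW ?adelic_gt0.
  by apply: le_trans (hC p w c bp ow cs) _; rewrite ler_peMr ?adelic_ge1 // ltW ?adelic_gt0.
have [_ [B' hB']] := aC.
exists (maxn B B') => p w bp ow; rewrite geq_max => /andP[h1 h2].
have aw := over_av ow; apply/eqP; rewrite eq_le; apply/andP; split.
  by apply: (smax_le) => // b bs; rewrite -(hB' p h2); apply: hC.
by rewrite -(hB p w bp ow h1) le_smax.
Qed.

(** The logarithmic height of a vector of homogeneous coordinates. *)
Definition vheight (L : fieldExtType k) (s : seq L) : R :=
  place_height (fun w => smax w s).

Lemma vheightZ (L : fieldExtType k) (s : seq L) c a : c != 0 -> a \in s -> a != 0 ->
  vheight [seq c * b | b <- s] = vheight s.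
Proof.
move=> c0 sa a0; rewrite -[RHS]add0r -(place_height_abs c0) /vheight -place_heightM.
- by apply: place_height_eq => p w bp ow; rewrite smaxZ //; apply: over_av ow.
- exact: size_fun_abs.
- exact: size_fun_smax sa a0.
Qed.

Lemma vheight_ge0 (L : fieldExtType k) (s : seq L) a : a \in s -> a != 0 -> 0 <= vheight s.
Proof.
move=> sa a0; rewrite -(place_height_abs a0); have [c c0 hc] := place_height_le (adelic1 R).
have [n [W [_ W1 _ WE _]]] := place_heightE L.
have [f0 [B hB]] := size_fun_abs a0; have [g0 [B' hB']] := size_fun_smax sa a0.
pose m := maxn B B'.
rewrite /vheight (WE _ m) => [|p w bp ow mp]; last first.
  by apply: (hB p) => //; apply: leq_trans mp; rewrite leq_maxl.
rewrite (WE _ m) => [|p w bp ow mp]; last first.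
  by apply: (hB' p) => //; apply: leq_trans mp; rewrite leq_maxr.
rewrite ler_pM2r ?invr_gt0 ?rel_degree_gt0 //; apply: ler_sum => p bp; apply: ler_sum => i _.
have ow := W1 p i bp.
rewrite ler_ln ?posrE; [exact: le_smax | exact: f0 ow | exact: g0 ow].
Qed.

Lemma vheight1 (L : fieldExtType k) (a : L) : a != 0 -> vheight [:: a] = 0.
Proof.
move=> a0; rewrite -(place_height_abs a0); apply: place_height_eq => p w bp ow.
by rewrite /smax big_cons big_nil; apply/max_idPl; apply: av_ge0 (over_av ow) _.
Qed.

Lemma std_heightE (L : fieldExtType k) (x : 'I_3 -> L) : nonzero_vec x ->
  std_height R x = vheight [:: x i0; x i1; x i2].
Proof.
move=> [j xj]; rewrite /std_height /vheight /place_height; congr (_ / _).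
apply: eq_fsbigr => w; rewrite inE => /places_over[p bp ow].
have aw := over_av ow; have n0 := local_degree_gt0 bp ow.
have smp : 0 < smax w [:: x i0; x i1; x i2].
  apply: (smax_gt0 aw _ xj); rewrite !inE.
  by case: j {xj} => -[|[|[|//]]] h; apply/or3P; [constructor 1|constructor 2|constructor 3];
    apply/eqP; congr x; apply: val_inj.
rewrite mulr_natl -lnXn //; congr ln.
rewrite 3!big_ord_recl big_ord0 /smax 3!big_cons big_nil /nabs.
set n := local_degree w in n0 *.
have mx (a b : R) : 0 <= a -> 0 <= b -> Num.max (a ^+ n) (b ^+ n) = Num.max a b ^+ n.
  move=> ha hb; have [ab|ba] := leP a b.
    by apply/max_idPr; rewrite ler_pXn2r.
  by apply/max_idPl; rewrite ler_pXn2r // ltW.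
have -> : (0 : R) = 0 ^+ n by rewrite expr0n; case: n n0 {mx}.
have e0 : ord0 = i0 :> 'I_3 by apply: val_inj.
have e1 : lift ord0 ord0 = i1 :> 'I_3 by apply: val_inj.
have e2 : lift ord0 (lift ord0 ord0) = i2 :> 'I_3 by apply: val_inj.
have w0 := av_ge0 aw.
by rewrite e2 e1 e0 !mx ?le_max ?w0 // ?expr0n; case: n n0 {mx}.
Qed.

End PlaceSums.
(** * Values of polynomials, and the height of the point O *)

Section Evaluation.
Variable k : fieldExtType rat.
Implicit Types (L : fieldExtType k).

Lemma map_mevalE n L (G : {mpoly k[n]}) (x : 'I_n -> L) :
  (map_mpoly (in_alg L) G).@[x] = \sum_(m <- msupp G) (G@_m)%:A * \prod_i x i ^+ m i.
Proof.
have -> : map_mpoly (in_alg L) G = \sum_(m <- msupp G) map_mpoly (in_alg L) (G@_m *: 'X_[m]).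
  by rewrite {1}[G]mpolyE (raddf_sum (map_mpoly (in_alg L))).
rewrite (raddf_sum (meval x)); apply: eq_bigr => m _ /=.
by rewrite map_mpolyZ map_mpolyX mevalZ mevalX.
Qed.

Lemma eval_atE L (G : {mpoly k[3]}) (x : 'I_3 -> L) :
  eval_at G x = \sum_(m <- msupp G) (G@_m)%:A * \prod_i x i ^+ m i.
Proof. exact: map_mevalE. Qed.

Lemma eval_atD L (G G' : {mpoly k[3]}) (x : 'I_3 -> L) :
  eval_at (G + G') x = eval_at G x + eval_at G' x.
Proof. by rewrite /eval_at raddfD mevalD. Qed.

Lemma eval_atM L (G G' : {mpoly k[3]}) (x : 'I_3 -> L) :
  eval_at (G * G') x = eval_at G x * eval_at G' x.
Proof. by rewrite /eval_at rmorphM mevalM. Qed.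

Lemma eval_atZ L c (G : {mpoly k[3]}) (x : 'I_3 -> L) :
  eval_at (c *: G) x = c%:A * eval_at G x.
Proof. by rewrite /eval_at map_mpolyZ mevalZ. Qed.

Lemma eval_atXU L i (x : 'I_3 -> L) : eval_at 'X_i x = x i.
Proof. by rewrite /eval_at map_mpolyX mevalXU. Qed.

Lemma eval_at0 L (x : 'I_3 -> L) : eval_at 0 x = 0.
Proof. by rewrite /eval_at raddf0 meval0. Qed.

Lemma eval_at_sum L (I : Type) (r : seq I) (f : I -> {mpoly k[3]}) (x : 'I_3 -> L) :
  eval_at (\sum_(i <- r) f i) x = \sum_(i <- r) eval_at (f i) x.
Proof. by rewrite /eval_at (raddf_sum (map_mpoly (in_alg L))) (raddf_sum (meval x)). Qed.

Lemma eval_at_homog L e (G : {mpoly k[3]}) (c : L) (x : 'I_3 -> L) : G \is e.-homog ->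
  eval_at G (fun i => c * x i) = c ^+ e * eval_at G x.
Proof.
move=> /dhomogP hG; rewrite !eval_atE mulr_sumr !big_seq; apply: eq_bigr => m /hG <-.
rewrite mulrCA; congr (_ * _); rewrite /= mdegE -prodrXr -big_split /=.
by apply: eq_bigr => i _; rewrite exprMn.
Qed.

Variable R : realType.

(** Monomials are at most 1 where the coordinates are, so that only the
    coefficients and the number of terms matter. *)
Lemma eval_at_bounded (G : {mpoly k[3]}) : exists2 C : nat -> R, adelic C &
  forall L p (w : L -> R) (y : 'I_3 -> L), is_base p -> lies_over p w ->
    (forall i, w (y i) <= 1) -> w (eval_at G y) <= C p.
Proof.
elim/mpolyind: G => [|c m G _ _ [C aC hC]].
  exists (fun=> 1); first exact: adelic1.
  by move=> L p w y bp ow _; rewrite eval_at0 (av0 (over_av ow)).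
have [D aD hD] := scalar_bounded R c.
exists (fun p => kap R p * (D p * C p)).
  by apply: adelicM; [exact: adelic_kap | exact: adelicM].
move=> L p w y bp ow hy; have aw := over_av ow.
rewrite eval_atD eval_atZ; apply: le_trans (kapP _ _ bp ow) _.
rewrite ler_pM2l ?(adelic_gt0 p (adelic_kap R)) // ge_max; apply/andP; split; last first.
  by apply: le_trans (hC L p w y bp ow hy) _; rewrite ler_peMl ?adelic_ge1 // ltW // adelic_gt0.
rewrite (avM aw); apply: (@le_trans _ _ (D p * 1)); last first.
  by rewrite ler_pM2l ?adelic_gt0 // adelic_ge1.
apply: ler_pM; rewrite ?(av_ge0 aw) //; first exact: hD.
rewrite /eval_at map_mpolyX mevalX (av_prod aw).
suff /andP[] : 0 <= \prod_i w (y i ^+ m i) <= 1 by [].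
apply: (big_ind (fun z => 0 <= z <= 1)) => [|u v /andP[u0 u1] /andP[v0 v1]|i _].
- by rewrite ler01 lexx.
- by rewrite mulr_ge0 // mulr_ile1.
- by rewrite (avX aw) exprn_ge0 ?(av_ge0 aw) // exprn_ile1 ?(av_ge0 aw).
Qed.

Lemma nonzero3 L (x : 'I_3 -> L) : nonzero_vec x ->
  exists2 a, a \in [:: x i0; x i1; x i2] & a != 0.
Proof.
move=> [j xj]; exists (x j) => //; rewrite !inE.
by case: j {xj} => -[|[|[|//]]] h; apply/or3P; [constructor 1|constructor 2|constructor 3];
  apply/eqP; congr x; apply: val_inj.
Qed.

Lemma smax3P L (w : L -> R) (x : 'I_3 -> L) : absolute_value w -> nonzero_vec x ->
  exists2 j, x j != 0 & smax w [:: x i0; x i1; x i2] = w (x j).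
Proof.
move=> aw nx; have [a ia a0] := nonzero3 nx.
have s0 := smax_gt0 aw ia a0.
have [j jE] : exists j, smax w [:: x i0; x i1; x i2] = w (x j).
  rewrite /smax !big_cons big_nil.
  have [_|_] := leP (w (x i0)) (Num.max (w (x i1)) (Num.max (w (x i2)) 0)); last by exists i0.
  have [_|_] := leP (w (x i1)) (Num.max (w (x i2)) 0); last by exists i1.
  by exists i2; apply/max_idPl/av_ge0.
by exists j => //; apply: contraTneq s0 => xj; rewrite jE xj (av0 aw) ltxx.
Qed.

Lemma le_smax3 L (w : L -> R) (x : 'I_3 -> L) i : w (x i) <= smax w [:: x i0; x i1; x i2].
Proof.
apply: le_smax; rewrite !inE.
by case: i => -[|[|[|//]]] h; apply/or3P; [constructor 1|constructor 2|constructor 3];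
  apply/eqP; congr x; apply: val_inj.
Qed.

Lemma chart_le1 L (w : L -> R) (x : 'I_3 -> L) j : absolute_value w -> x j != 0 ->
  smax w [:: x i0; x i1; x i2] = w (x j) -> forall i, w (chart j x i) <= 1.
Proof.
move=> aw xj e i; rewrite /chart (avM aw) (avV aw) ler_pdivrMr ?(av_gt0 aw) //.
by rewrite mul1r -e le_smax3.
Qed.

(** On the part of projective space where the [j]-th coordinate dominates, an
    inclusion of ideal sheaves becomes an inequality. *)
Lemma ideal_sheaf_bound (S T : seq {mpoly k[3]}) : ideal_sheaf_le S T ->
  exists2 C : nat -> R, adelic C &
  forall L p (w : L -> R) (j : 'I_3) (y : 'I_3 -> L) G, is_base p -> lies_over p w ->
    y j = 1 -> (forall i, w (y i) <= 1) -> G \in S ->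
    w (eval_at G y) <= C p * smax w [seq eval_at H y | H <- T].
Proof.
move=> hST.
have one (j : 'I_3) G : exists2 C : nat -> R, adelic C & G \in S ->
  forall L p (w : L -> R) (y : 'I_3 -> L), is_base p -> lies_over p w ->
    y j = 1 -> (forall i, w (y i) <= 1) ->
    w (eval_at G y) <= C p * smax w [seq eval_at H y | H <- T].
  have [GS|] := boolP (G \in S); last by exists (fun=> 1); first exact: adelic1.
  have [N [c cE]] := hST G GS j.
  have [D aD hD] : exists2 D : 'I_(size T) -> nat -> R, (forall i, adelic (D i)) &
      forall i L p (w : L -> R) (y : 'I_3 -> L), is_base p -> lies_over p w ->
      (forall i, w (y i) <= 1) -> w (eval_at (c i) y) <= D i p.
    have /choice[D hD] : forall i, exists D, adelic D /\
      forall L p (w : L -> R) (y : 'I_3 -> L), is_base p -> lies_over p w ->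
        (forall i, w (y i) <= 1) -> w (eval_at (c i) y) <= D p.
      by move=> i; have [D aD h] := eval_at_bounded (c i); exists D.
    by exists D => i; case: (hD i).
  pose P := (fun p => \prod_i D i p) : nat -> R.
  have aP : adelic P by exact: (adelic_prod (index_enum _) aD).
  exists (fun p => kap R p ^+ size T * P p).
    by apply: adelicM => //; apply/adelicX/adelic_kap.
  move=> _ L p w y bp ow yj hy; have aw := over_av ow.
  have -> : eval_at G y = \sum_(i < size T) eval_at (c i) y * eval_at T`_i y.
    transitivity (eval_at ('X_j ^+ N * G) y).
      have -> : eval_at ('X_j ^+ N * G) y = eval_at ('X_j ^+ N) y * eval_at G y.
        exact: eval_atM.
      suff -> : eval_at ('X_j ^+ N) y = 1 by rewrite mul1r.
      by rewrite /eval_at rmorphXn /= map_mpolyX rmorphXn /= mevalXU yj expr1n.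
    by rewrite cE eval_at_sum; apply: eq_bigr => i _; rewrite eval_atM.
  set M := smax w _; have M0 : 0 <= M by apply: smax_ge0.
  have term (i : 'I_(size T)) : w (eval_at (c i) y * eval_at T`_i y) <= P p * M.
    rewrite (avM aw); apply: ler_pM; rewrite ?(av_ge0 aw) //.
      by apply: le_trans (hD i L p w y bp ow hy) _; apply: (le_adelic_prod (C := D)).
    by apply: le_smax; apply: map_f; rewrite mem_nth.
  have P0 : 0 <= P p * M by rewrite mulr_ge0 // ltW // adelic_gt0.
  by rewrite -mulrA; apply: kap_sum_ord.
have /choice[C hC] : forall jG : 'I_3 * 'I_(size S), exists C, adelic C /\
  forall L p (w : L -> R) (y : 'I_3 -> L), is_base p -> lies_over p w ->
    y jG.1 = 1 -> (forall i, w (y i) <= 1) ->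
    w (eval_at S`_jG.2 y) <= C p * smax w [seq eval_at H y | H <- T].
  move=> [j i]; have [C aC hC] := one j S`_i; exists C; split=> //.
  by apply: hC; rewrite mem_nth.
exists (fun p => \prod_jG C jG p).
  by apply: adelic_prod => jG; case: (hC jG).
move=> L p w j y G bp ow yj hy GS.
have iS : (index G S < size S)%N by rewrite index_mem.
have [aC h] := hC (j, Ordinal iS).
have := h L p w y bp ow yj hy; rewrite /= nth_index // => /le_trans; apply.
rewrite ler_wpM2r ?smax_ge0 //; first exact: over_av ow.
by apply: (le_adelic_prod (C := C)) => jG; case: (hC jG).
Qed.

(** The finitely many places of [k] where [g] is not zero lie over finitely many
    [p]. *)
Lemma Mk_adelic (g : (k -> R) -> R) : Mk_constant g ->
  exists2 C : nat -> R, adelic C &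
  forall p (v : k -> R), is_base p -> lies_over p v -> g v <= ln (C p).
Proof.
move=> /finite_seqP[s sE].
pose c v p := if is_base p && `[< lies_over p v >] then expR `|g v| else 1.
have ac v : adelic (c v).
  split=> [p|]; first by rewrite /c; case: ifP => // _; rewrite -[leLHS]expR0 ler_expR.
  have [[p0 [bp0 ov0]]|no] := pselect (exists p0, is_base p0 /\ lies_over p0 v).
    exists p0.+1 => p p0p; rewrite /c; case: ifP => // /andP[bp /asboolP ov].
    by move: p0p; rewrite (lies_over_inj bp0 bp ov0 ov) ltnn.
  exists 0%N => p _; rewrite /c; case: ifP => // /andP[bp /asboolP ov].
  by case: no; exists p.
exists (fun p => \prod_(v <- s) c v p); first exact: adelic_prod.
move=> p v bp ov; have cge u : 1 <= c u p by apply: adelic_ge1.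
have pge (r : seq (k -> R)) : 1 <= \prod_(u <- r) c u p.
  by elim/big_ind: _ => // x y; apply: mulr_ege1.
have [gv|gv] := eqVneq (g v) 0.
  by rewrite gv; apply: ln_ge0; apply: pge.
have vs : v \in s.
  have : [set` s] v by rewrite -sE; split; [by apply/places_over; exists p | exact/eqP].
  by [].
apply: le_trans (ler_norm _) _; rewrite -[leLHS]expRK.
have ce : c v p = expR `|g v| by rewrite /c bp /=; case: asboolP.
rewrite ler_ln ?posrE ?expR_gt0 //; last exact: lt_le_trans ltr01 (pge s).
rewrite -ce.
elim: s vs {sE} => // u s IH; rewrite inE big_cons => /predU1P[->|/IH h].
  by apply: ler_peMr; [exact: le_trans ler01 (cge _) | exact: pge].
by apply: le_trans h _; apply: ler_peMl; [exact: le_trans ler01 (pge _) | exact: cge].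
Qed.

End Evaluation.
Section HeightOfO.
Variables (R : realType) (k : fieldExtType rat).

Lemma size_funV (L : fieldExtType k) f : @size_fun R k L f -> size_fun (fun w => (f w)^-1).
Proof.
move=> [f0 [B hB]]; split=> [p w bp ow|]; first by rewrite invr_gt0 (f0 p).
by exists B => p w bp ow h; rewrite (hB p) // invr1.
Qed.

(** Where the [j]-th coordinate dominates, the Weil function of a divisor is
    the logarithm of its equation up to an adelic constant. *)
Lemma weil_divisor_bound (G : {mpoly k[3]}) (la : place_fun R k (\bar R)) :
  weil_function_divisor G la ->
  exists2 C : nat -> R, adelic C &
  forall (L : fieldExtType k) p (w : L -> R) (x : 'I_3 -> L) j, is_base p -> lies_over p w ->
    x j != 0 -> (forall i, w (chart j x i) <= 1) ->
    let n : R := (local_degree w)%:R in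
    let g := eval_at G (chart j x) in
    if g == 0 then la L w x = +oo%E
    else exists2 r, la L w x = r%:E & `|r + n * ln (w g)| <= n * ln (C p).
Proof.
move=> hG.
have /choice[C hC] : forall j : 'I_3, exists C : nat -> R, adelic C /\
  forall (L : fieldExtType k) p (w : L -> R) (x : 'I_3 -> L), is_base p -> lies_over p w ->
    x j != 0 -> (forall i, w (chart j x i) <= 1) ->
    let n : R := (local_degree w)%:R in
    let g := eval_at G (chart j x) in
    if g == 0 then la L w x = +oo%E
    else exists2 r, la L w x = r%:E & `|r + n * ln (w g)| <= n * ln (C p).
  move=> j; have [al [_ _ bnd laE]] := hG j.
  have [|de hde hal] := bnd (fun=> 0).
    rewrite /Mk_constant [X in finite_set X](_ : _ = set0) //.
    by rewrite -subset0 => v [_]; apply.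
  have [C aC hC] := Mk_adelic hde; exists C; split=> // L p w x bp ow xj hx n g.
  have pw : places R L w by apply/places_over; exists p.
  have aw := over_av ow; have n0 := local_degree_gt0 bp ow.
  have yj : chart j x j = 1 by rewrite /chart divff.
  have alb : `|al L w (chart j x)| <= n * ln (C p).
    apply: le_trans (hal L w _ pw yj _) _; first by move=> i; rewrite expR0.
    by rewrite ler_wpM2l //; apply/hC/place_restr_over.
  rewrite (laE L w x pw xj) -/g /nabs; case: eqP => [->|/eqP g0].
    by rewrite (av0 aw) expr0n eqn0Ngt n0 /= lexx.
  have wg := av_gt0 aw g0.
  rewrite lne_EFin ?exprn_gt0 // lnXn // -mulr_natl -/n.
  by exists (- (n * ln (w g)) + al L w (chart j x)) => //; rewrite addrAC addNr add0r.
have aP : adelic (fun p => \prod_j C j p) by apply: adelic_prod => j; case: (hC j).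
exists (fun p => \prod_j C j p) => // L p w x j bp ow xj hx n g; have [aC h] := hC j.
have := h L p w x bp ow xj hx; rewrite /= -/n -/g; case: eqP => // _ [r rE hr].
exists r => //; apply: le_trans hr _; rewrite ler_wpM2l //.
rewrite ler_ln ?posrE ?(adelic_gt0 p aC) ?(adelic_gt0 p aP) //.
by apply: (le_adelic_prod (C := C)) => i; case: (hC i).
Qed.

Lemma smax_witness (L : fieldType) (w : L -> R) (s : seq L) : 0 < smax w s ->
  exists2 a, a \in s & smax w s = w a.
Proof.
rewrite /smax; elim: s => [|a s IH]; first by rewrite big_nil ltxx.
rewrite big_cons; have [le|lt] := leP (w a) (\big[Num.max/0]_(b <- s) w b).
  by move=> /IH[b bs ->]; exists b => //; rewrite inE bs orbT.
by exists a => //; rewrite inE eqxx.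
Qed.

Lemma eval_seq_O (L : fieldExtType k) (x : 'I_3 -> L) :
  [seq eval_at H x | H <- subscheme_O k] = [:: x i0; x i1].
Proof. by rewrite /= !eval_atXU. Qed.

(** The equations of the divisors and the forms [x, y] generate the same ideal
    sheaf, so their maxima agree up to an adelic constant. *)
Lemma weil_O_bound (la : place_fun R k (\bar R)) :
  weil_function_subscheme (subscheme_O k) la ->
  exists2 C : nat -> R, adelic C &
  forall (L : fieldExtType k) p (w : L -> R) (x : 'I_3 -> L), is_base p -> lies_over p w ->
    nonzero_vec x -> (exists2 a, a \in [:: x i0; x i1] & a != 0) ->
    `|fine (la L w x) - (local_degree w)%:R * ln (smax w [:: x i0; x i1; x i2] / smax w [:: x i0; x i1])|
      <= (local_degree w)%:R * ln (C p).
Proof.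
move=> [E [lE [_ [hET hTE] wE laE]]].
have [C1 aC1 hC1] := ideal_sheaf_bound R hET.
have [C2 aC2 hC2] := ideal_sheaf_bound R hTE.
have /choice[D hD] (i : 'I_(size E)) : exists D : nat -> R, adelic D /\
  forall (L : fieldExtType k) p (w : L -> R) (x : 'I_3 -> L) j, is_base p -> lies_over p w ->
    x j != 0 -> (forall i, w (chart j x i) <= 1) ->
    let n : R := (local_degree w)%:R in
    let g := eval_at E`_i (chart j x) in
    if g == 0 then lE i L w x = +oo%E
    else exists2 r, lE i L w x = r%:E & `|r + n * ln (w g)| <= n * ln (D p).
  by have [D aD h] := weil_divisor_bound (wE i (ltn_ord i)); exists D.
have aD i : adelic (D i) by case: (hD i).
pose P (p : nat) := \prod_i D i p; have aP : adelic P := adelic_prod (index_enum _) aD.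
exists (fun p => C1 p * C2 p * P p); first by do 2?[apply: adelicM].
move=> L p w x bp ow nx nO; set n : R := (local_degree w)%:R.
have aw := over_av ow; have [j xj sE] := smax3P aw nx.
have hy := chart_le1 aw xj sE; pose y := chart j x.
have yj : y j = 1 by rewrite /y /chart divff.
have wxj := av_gt0 aw xj.
have n0 : 0 < n by rewrite ltr0n (local_degree_gt0 bp ow).
have c1 := adelic_gt0 p aC1; have c2 := adelic_gt0 p aC2; have c3 := adelic_gt0 p aP.
have c11 := adelic_ge1 p aC1; have c21 := adelic_ge1 p aC2; have c31 := adelic_ge1 p aP.
set r := smax w [:: y i0; y i1].
have rE : r = smax w [:: x i0; x i1] / w (x j).
  rewrite /r /y /chart -(avV aw) [RHS]mulrC -(smaxZ aw) /=.
  by rewrite ![_ * (x j)^-1]mulrC.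
have r0 : 0 < r by rewrite rE divr_gt0 //; case: nO => a ia a0; apply: (smax_gt0 aw ia a0).
have -> : smax w [:: x i0; x i1; x i2] / smax w [:: x i0; x i1] = r^-1.
  by rewrite sE rE invf_div.
rewrite lnV // mulrN opprK.
have up (i : 'I_(size E)) : w (eval_at E`_i y) <= C1 p * r.
  by rewrite /r -eval_seq_O; apply: (hC1 L p w j y) => //; rewrite mem_nth.
have [i0' low] : exists i : 'I_(size E), r <= C2 p * w (eval_at E`_i y).
  have : r <= C2 p * smax w [seq eval_at H y | H <- E].
    apply: smax_le => [|a]; first by rewrite mulr_ge0 ?smax_ge0 // ltW.
    by rewrite -eval_seq_O => /mapP[H HT ->]; apply: (hC2 L p w j y).
  move=> rle; have s0 : 0 < smax w [seq eval_at H y | H <- E].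
    by rewrite -(pmulr_rgt0 _ c2); apply: lt_le_trans rle.
  have [a /mapP[H HE ->] aE] := smax_witness s0.
  have iH : (index H E < size E)%N by rewrite index_mem.
  by exists (Ordinal iH); rewrite /= nth_index // -aE.
have lnP i : ln (D i p) <= ln (P p).
  by rewrite ler_ln ?posrE ?adelic_gt0 //; apply: (le_adelic_prod (C := D)).
have lnC : ln (C1 p * C2 p * P p) = ln (C1 p) + ln (C2 p) + ln (P p).
  by rewrite !lnM ?posrE ?mulr_gt0.
have l1 : 0 <= ln (C1 p) by rewrite ln_ge0.
have l2 : 0 <= ln (C2 p) by rewrite ln_ge0.
set b := - (n * (ln (C1 p) + ln r)) - n * ln (P p).
have lower (i : 'I_(size E)) : (b%:E <= lE i L w x)%E.
  have [_ /(_ L p w x j bp ow xj hy)] := hD i; rewrite /= -/n -/y.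
  case: eqP => [_ ->|/eqP g0 [v -> hv]]; first exact: leey.
  rewrite lee_fin; have wg := av_gt0 aw g0.
  have h1 : ln (w (eval_at E`_i y)) <= ln (C1 p) + ln r.
    by rewrite -lnM ?posrE // ler_ln ?posrE ?mulr_gt0.
  have h2 := ler_wpM2l (ltW n0) h1; have h3 := ler_wpM2l (ltW n0) (lnP i).
  by move: hv; rewrite /b ler_norml => /andP[hv _]; lra.
have wg : 0 < w (eval_at E`_i0' y) by rewrite -(pmulr_rgt0 _ c2); apply: lt_le_trans low.
have g0 : eval_at E`_i0' y != 0 by apply: contraTneq wg => ->; rewrite (av0 aw) ltxx.
have [_ /(_ L p w x j bp ow xj hy)] := hD i0'; rewrite /= -/n -/y (negPf g0) => -[v vE hv].
have la_le : (la L w x <= v%:E)%E.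
  by rewrite laE -vE; apply: bigmin_le_cond.
have le_la : (b%:E <= la L w x)%E.
  rewrite laE; elim/big_ind: _ => [|u t hu ht|i _]; first exact: leey.
    by rewrite le_min hu ht.
  exact: lower.
move: la_le le_la; case: (la L w x) => [t| |] //=; rewrite !lee_fin => tv bt.
have h1 : ln r <= ln (C2 p) + ln (w (eval_at E`_i0' y)).
  by rewrite -lnM ?posrE // ler_ln ?posrE ?mulr_gt0.
have h2 := ler_wpM2l (ltW n0) h1; have h3 := ler_wpM2l (ltW n0) (lnP i0').
have hv2 := ler_normlW hv; rewrite lnC ler_norml.
have := mulr_ge0 (ltW n0) l1; have := mulr_ge0 (ltW n0) l2.
by rewrite /b in bt => ? ?; apply/andP; split; lra.
Qed.

Lemma height_of_O (hO : global_fun R k) : height_function (subscheme_O k) hO ->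
  exists2 c : R, 0 <= c & forall (L : fieldExtType k) (x : 'I_3 -> L),
    nonzero_vec x -> (exists2 a, a \in [:: x i0; x i1] & a != 0) ->
    `|hO L x - (vheight R [:: x i0; x i1; x i2] - vheight R [:: x i0; x i1])| <= c.
Proof.
move=> [la /weil_O_bound[C aC hC] hE].
have [c c0 hc] := place_height_le k aC; exists c => // L x nx nO.
have [a ia a0] := nO.
have ia' : a \in [:: x i0; x i1; x i2].
  by move: ia; rewrite !inE => /orP[->|->]; rewrite ?orbT.
set s3 := [:: x i0; x i1; x i2]; set s2 := [:: x i0; x i1].
have sz3 := size_fun_smax R ia' a0; have sz2 := size_fun_smax R ia a0.
have szq := size_funM sz3 (size_funV sz2).
have eq3 : vheight R s3 = place_height (fun w : L -> R => smax w s3 / smax w s2) + vheight R s2.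
  rewrite -place_heightM //; apply: place_height_eq => p w bp ow.
  by rewrite divfK // gt_eqF // (sz2.1 p w bp ow).
rewrite eq3 addrK.
pose f (w : L -> R) := expR (fine (la L w x) / (local_degree w)%:R).
have key p w : is_base p -> lies_over p w ->
    `|ln (f w) - ln (smax w s3 / smax w s2)| <= ln (C p).
  move=> bp ow; have n0 : 0 < (local_degree w)%:R :> R by rewrite ltr0n (local_degree_gt0 bp ow).
  have := hC L p w x bp ow nx nO; rewrite -/s3 -/s2 /f expRK.
  set n : R := (local_degree w)%:R in n0 *; set v := fine _; set q := ln (_ / _).
  rewrite [n * ln (C p)]mulrC -ler_pdivrMr // => h.
  have -> : v / n - q = (v - n * q) / n by rewrite mulrBl [n * q]mulrC mulfK ?gt_eqF.
  by rewrite normrM normfV (gtr0_norm n0).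
have f0 w : 0 < f w by apply: expR_gt0.
have cmp p w : is_base p -> lies_over p w ->
    f w <= C p * (smax w s3 / smax w s2) /\ smax w s3 / smax w s2 <= C p * f w.
  move=> bp ow; have q0 := szq.1 p w bp ow; have Cp := adelic_gt0 p aC.
  have := key p w bp ow; rewrite ler_norml; move: q0.
  move: (smax w s3 / smax w s2) => q q0 /andP[h1 h2].
  have cq := mulr_gt0 Cp q0; have cf := mulr_gt0 Cp (f0 w); have fw := f0 w.
  by split; rewrite -ler_ln ?posrE // lnM ?posrE //; lra.
have szf : size_fun f.
  split=> [p w bp ow|]; first exact: f0.
  have [_ [B hB]] := szq; have [_ [B' hB']] := aC.
  exists (maxn B B') => p w bp ow; rewrite geq_max => /andP[h1 h2].
  have [] := cmp p w bp ow; rewrite (hB p w bp ow h1) (hB' p h2) !mul1r => k1 k2.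
  by apply/eqP; rewrite eq_le k1 k2.
have -> : hO L x = place_height f.
  rewrite hE //; last first.
    move: ia a0; rewrite !inE => /orP[/eqP->|/eqP->] a0.
      by exists 'X_i0; rewrite ?inE ?eqxx // eval_atXU.
    by exists 'X_i1; rewrite ?inE ?eqxx ?orbT // eval_atXU.
  rewrite /place_height; congr (_ / _); apply: eq_fsbigr => w.
  rewrite inE => /places_over[p bp ow]; rewrite /f expRK mulrC divfK //.
  by rewrite pnatr_eq0 -lt0n (local_degree_gt0 bp ow).
have u1 := hc L f _ szf szq (fun p w bp ow => (cmp p w bp ow).1).
have u2 := hc L _ f szq szf (fun p w bp ow => (cmp p w bp ow).2).
by rewrite ler_norml; apply/andP; split; lra.
Qed.

End HeightOfO.
(** * Bivariate polynomials *)

Section Gauss.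
Variable k : fieldType.
Implicit Types (r : {poly k}) (D Q G : {poly {poly k}}).

Definition irreducible_elt (T : unitRingType) (G : T) :=
  forall A B, G = A * B -> A \is a GRing.unit \/ B \is a GRing.unit.

(** A divisor of minimal positive degree is prime. *)
Lemma exists_prime_divisor r : (1 < size r)%N -> exists q : {poly k},
  [/\ (1 < size q)%N, q %| r & forall a b, q %| a * b -> q %| a \/ q %| b].
Proof.
move=> r1; pose P n := `[< exists q : {poly k}, [/\ (1 < size q)%N, q %| r & size q = n] >].
have exP : exists n, P n by exists (size r); apply/asboolP; exists r; split.
case: (ex_minnP exP) => n /asboolP[q [q1 qr sq]] minn.
exists q; split=> // a b qab.
have gq : gcdp q a %| q := dvdp_gcdl q a.
have q0 : q != 0 by rewrite -size_poly_gt0 (ltn_trans _ q1).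
have [g1|g1] := leqP (size (gcdp q a)) 1.
  right; rewrite -(Gauss_dvdpr b (q := a)) //.
  by rewrite /coprimep eqn_leq g1 lt0n size_poly_eq0 gcdp_eq0 negb_and q0.
left; have le : (n <= size (gcdp q a))%N.
  by apply: minn; apply/asboolP; exists (gcdp q a); split=> //; apply: dvdp_trans qr.
have : gcdp q a %= q by rewrite -dvdp_size_eqp // eqn_leq dvdp_leq //= sq.
by rewrite eqp_sym => /eqp_dvdl ->; apply: dvdp_gcdr.
Qed.

Lemma dvd_coefs (q : {poly k}) D : (forall i, q %| D`_i) -> exists D', D = q%:P * D'.
Proof.
move=> h; exists (map_poly (fun c => c %/ q) D); apply/polyP => i.
by rewrite coefCM coef_map_id0 ?div0p // divpKC.
Qed.

Lemma prime_dvd_coefs (q : {poly k}) D Q :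
  (forall a b, q %| a * b -> q %| a \/ q %| b) ->
  (forall i, q %| (D * Q)`_i) -> (forall i, q %| D`_i) \/ (forall i, q %| Q`_i).
Proof.
move=> pq h; apply: contrapT => /not_orP[nD nQ].
have minw S : ~ (forall i, q %| S`_i) -> exists2 i, ~~ (q %| S`_i) & forall j, (j < i)%N -> q %| S`_j.
  move=> nS; have ex : exists i, ~~ (q %| S`_i).
    by apply: contra_notP nS => no i; apply/negPn/negP => ?; apply: no; exists i.
  case: (ex_minnP ex) => i hi mini; exists i => // j ji; apply: contraLR ji => nj.
  by rewrite -leqNgt mini.
have [i di li] := minw D nD; have [j dj lj] := minw Q nQ.
have := h (i + j)%N; rewrite coefM (bigD1 (Ordinal (leq_addr j i : i < (i + j).+1)%N)) //= addKn.
rewrite dvdp_addl; first by case/pq => hh; [move: di | move: dj]; rewrite hh.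
apply: (big_ind (fun c => q %| c)) => [|x y|a ne]; [exact: dvdp0 | exact: dvdp_add |].
have [lt|ge] := ltnP a i; first by rewrite dvdp_mulr // li.
rewrite dvdp_mull // lj // ltn_subLR; last by rewrite -ltnS.
rewrite ltn_add2r ltn_neqAle ge andbT; apply: contraNneq ne => ia.
by apply/eqP/val_inj.
Qed.

(** Gauss's lemma: a factorization up to a polynomial [r] in the first
    variable can be cleared of [r], one prime divisor at a time. *)
Lemma clear_content r G D Q : r != 0 -> r%:P * G = D * Q ->
  exists r1 r2 D' Q', [/\ r1 != 0, r2 != 0, D = r1%:P * D', Q = r2%:P * Q' & G = D' * Q'].
Proof.
have [n] := ubnP (size r); elim: n r D Q => // n IH r D Q; rewrite ltnS => rn r0 e.
have [r1|r1] := leqP (size r) 1.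
  have cr := size1_polyC r1; set c := r`_0 in cr.
  have c0 : c != 0 by move: r0; rewrite cr polyC_eq0.
  exists r, 1, ((c^-1)%:P%:P * D), Q; split=> //; first exact: oner_neq0.
  - by rewrite mulrA cr -!polyCM divff // mul1r.
  - by rewrite mul1r.
  - by rewrite -mulrA -e cr mulrA -!polyCM mulVf // mul1r.
have [q [q1 qr pq]] := exists_prime_divisor r1.
have q0 : q != 0 by rewrite -size_poly_gt0 (ltn_trans _ q1).
have /dvdpP[r' rE] := qr.
have r'0 : r' != 0 by apply: contraNneq r0 => z; rewrite rE z mul0r.
have sr' : (size r' < n)%N.
  apply: leq_trans rn; rewrite rE size_mul // -subn1 -addnBA ?(ltn_trans _ q1) //.
  by rewrite -[X in (X < _)%N]addn0 ltn_add2l subn_gt0.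
have dv i : q %| (D * Q)`_i.
  by rewrite -e coefCM rE mulrAC dvdp_mull.
have qP0 : q%:P != 0 :> {poly {poly k}} by rewrite polyC_eq0.
case: (prime_dvd_coefs pq dv) => /dvd_coefs[S SE].
  have e' : r'%:P * G = S * Q.
    by apply: (mulfI qP0); rewrite mulrA -polyCM [q * r']mulrC -rE e SE mulrA.
  have [r1' [r2 [D' [Q' [a b c d f]]]]] := IH r' S Q sr' r'0 e'.
  exists (q * r1'), r2, D', Q'; split=> //; first by rewrite mulf_neq0.
  by rewrite SE c polyCM mulrA.
have e' : r'%:P * G = D * S.
  by apply: (mulfI qP0); rewrite mulrA -polyCM [q * r']mulrC -rE e SE mulrCA.
have [r1' [r2 [D' [Q' [a b c d f]]]]] := IH r' D S sr' r'0 e'.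
exists r1', (q * r2), D', Q'; split=> //; first by rewrite mulf_neq0.
by rewrite SE d polyCM mulrA.
Qed.

Lemma unit_size1 (T : idomainType) (p : {poly T}) : p \is a GRing.unit -> size p = 1%N.
Proof. by rewrite poly_unitE => /andP[/eqP]. Qed.

(** An irreducible polynomial that does not divide [P] has a nonzero
    combination with [P] that only involves the first variable. *)
Lemma irreducible_elimination G P : irreducible_elt G -> (1 < size G)%N ->
  ~ (exists Q, P = G * Q) -> exists r A B, r != 0 /\ r%:P = A * G + B * P.
Proof.
move=> irrG G1 ndvd.
have P0 : P != 0 by apply/eqP => P0; apply: ndvd; exists 0; rewrite mulr0.
have [P1|P1] := leqP (size P) 1.
  exists P`_0, 0, 1; rewrite mul0r add0r mul1r -(size1_polyC P1); split=> //.
  by apply: contraNneq P0 => h; rewrite (size1_polyC P1) h.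
have [res|res] := eqVneq (resultant G P) 0; last first.
  have [[A B] _ e] := resultant_in_ideal G1 P1.
  by exists (resultant G P), A, B.
move/eqP: res; rewrite resultant_eq0 => D1; set D := gcdp G P in D1.
have /Pdiv.Idomain.dvdpP[[c Q] /= c0 e] : D %| G := dvdp_gcdl G P.
have /Pdiv.Idomain.dvdpP[[c' Q'] /= c'0 e'] : D %| P := dvdp_gcdr G P.
case: ndvd; move: e e'; rewrite -!mul_polyC => e e'.
have [r1 [r2 [Q1 [D' [r10 r20 QE DE GE]]]]] := clear_content c0 e.
have sD' : (1 < size D')%N by move: D1; rewrite DE mul_polyC size_scale.
case: (irrG _ _ GE) => [uQ|/unit_size1 sD]; last by rewrite sD in sD'.
have {}e' : c'%:P * P = G * (Q1^-1 * (r2%:P * Q')).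
  rewrite e' DE GE; set Z := Q1^-1.
  have -> : Q1 * D' * (Z * (r2%:P * Q')) = Q1 * Z * (D' * (r2%:P * Q')) by ring.
  by rewrite /Z mulrV // mul1r; ring.
have [s1 [s2 [G' [T [s10 s20 GE' _ PE]]]]] := clear_content c'0 e'.
case: (irrG _ _ GE') => [us|/unit_size1 sG].
  set Z := (s1%:P)^-1; exists (Z * T); rewrite [in RHS]GE' PE.
  transitivity (G' * (s1%:P * Z) * T); last by ring.
  by rewrite /Z mulrV // mulr1.
by move: G1; rewrite GE' mul_polyC size_scale // sG.
Qed.

End Gauss.
Section PolynomialSizes.
Variables (R : realType) (k : fieldExtType rat).
Implicit Types (L : fieldExtType k) (r : {poly k}) (G : {poly {poly k}}).

Definition ev1 L (t : L) (r : {poly k}) : L := (map_poly (in_alg L) r).[t].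
HB.instance Definition _ L t :=
  GRing.RMorphism.copy (@ev1 L t) (horner_eval t \o map_poly (in_alg L)).

Definition ev2 L (t z : L) (G : {poly {poly k}}) : L := (map_poly (ev1 t) G).[z].
HB.instance Definition _ L t z :=
  GRing.RMorphism.copy (@ev2 L t z) (horner_eval z \o map_poly (ev1 t)).

Lemma ev1C L (t : L) c : ev1 t c%:P = c%:A.
Proof. by rewrite /ev1 map_polyC hornerC. Qed.
Lemma ev1X L (t : L) : ev1 t 'X = t.
Proof. by rewrite /ev1 map_polyX hornerX. Qed.
Lemma ev2C L (t z : L) r : ev2 t z r%:P = ev1 t r.
Proof. by rewrite /ev2 map_polyC hornerC. Qed.
Lemma ev2X L (t z : L) : ev2 t z 'X = z.
Proof. by rewrite /ev2 map_polyX hornerX. Qed.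

Lemma ev1E L (t : L) r n : (size r <= n)%N -> ev1 t r = \sum_(i < n) (r`_i)%:A * t ^+ i.
Proof.
move=> rn; rewrite /ev1 (horner_coef_wide _ (n := n)); last by rewrite size_map_poly.
by apply: eq_bigr => i _; rewrite coef_map.
Qed.

Lemma ev2E L (t z : L) G n : (size G <= n)%N -> ev2 t z G = \sum_(i < n) ev1 t G`_i * z ^+ i.
Proof.
move=> Gn; rewrite /ev2 (horner_coef_wide _ (n := n)).
  by apply: eq_bigr => i _; rewrite coef_map.
exact: leq_trans (size_poly _ _) Gn.
Qed.

Definition msize1 L (w : L -> R) (t : L) : R := smax w [:: 1; t].

Lemma msize1_ge1 L p (w : L -> R) t : lies_over p w -> 1 <= msize1 w t.
Proof. by move=> ow; rewrite -(av1 (over_av ow)) le_smax // inE eqxx. Qed.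

Lemma msize1_ge L (w : L -> R) t : w t <= msize1 w t.
Proof. by rewrite le_smax // !inE eqxx orbT. Qed.

Lemma msize1_le L p (w : L -> R) t b : lies_over p w -> 1 <= b -> w t <= b -> msize1 w t <= b.
Proof.
move=> ow b1 tb; apply: smax_le => [|a]; first exact: le_trans b1.
by rewrite !inE => /orP[]/eqP-> //; rewrite (av1 (over_av ow)).
Qed.

Lemma msize1_eq L p (w : L -> R) t : lies_over p w -> 1 <= w t -> msize1 w t = w t.
Proof. by move=> ow t1; apply/eqP; rewrite eq_le msize1_ge (msize1_le ow). Qed.

Lemma size_fun_msize1 L (t : L) : size_fun (fun w => msize1 w t).
Proof. by apply: (@size_fun_smax _ _ _ _ 1); rewrite ?inE ?eqxx ?oner_neq0. Qed.

Lemma ev1_bounded r n : (size r <= n.+1)%N -> exists2 C : nat -> R, adelic C &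
  forall L p (w : L -> R) (t : L), is_base p -> lies_over p w ->
    w (ev1 t r) <= C p * msize1 w t ^+ n.
Proof.
move=> rn; have /choice[D hD] (i : 'I_n.+1) : exists D : nat -> R, adelic D /\
    forall L p (w : L -> R), is_base p -> lies_over p w -> w (r`_i)%:A <= D p.
  by have [D aD h] := scalar_bounded R r`_i; exists D.
have aD i : adelic (D i) by case: (hD i).
have aP : adelic (fun p => \prod_i D i p) := adelic_prod (index_enum _) aD.
exists (fun p => kap R p ^+ n.+1 * \prod_i D i p).
  by apply: adelicM => //; apply/adelicX/adelic_kap.
move=> L p w t bp ow; have aw := over_av ow; have M1 := msize1_ge1 t ow.
rewrite (ev1E t rn) -mulrA; apply: kap_sum_ord => //.
  by rewrite mulr_ge0 ?exprn_ge0 ?(le_trans ler01 M1) // ltW // (adelic_gt0 p aP).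
move=> i; rewrite (avM aw) (avX aw); apply: ler_pM; rewrite ?exprn_ge0 ?(av_ge0 aw) //.
  by apply: le_trans (le_adelic_prod i p aD); apply: (hD i).2.
apply: le_trans (_ : msize1 w t ^+ i <= _); last by rewrite ler_weXn2l // -ltnS.
by apply: lerXn2r; rewrite ?nnegrE ?(av_ge0 aw) ?msize1_ge // (le_trans ler01).
Qed.

Lemma ev2_bounded G s : (forall i, (size (G`_i)%R <= s.+1)%N) ->
  exists2 C : nat -> R, adelic C &
  forall L p (w : L -> R) (t z : L), is_base p -> lies_over p w ->
    w (ev2 t z G) <= C p * msize1 w t ^+ s * msize1 w z ^+ (size G).-1.
Proof.
move=> sG; have /choice[D hD] (i : 'I_(size G)) : exists D : nat -> R, adelic D /\
    forall L p (w : L -> R) (t : L), is_base p -> lies_over p w ->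
      w (ev1 t G`_i) <= D p * msize1 w t ^+ s.
  by have [D aD h] := ev1_bounded (sG i); exists D.
have aD i : adelic (D i) by case: (hD i).
have aP : adelic (fun p => \prod_i D i p) := adelic_prod (index_enum _) aD.
exists (fun p => kap R p ^+ size G * \prod_i D i p).
  by apply: adelicM => //; apply/adelicX/adelic_kap.
move=> L p w t z bp ow; have aw := over_av ow.
have M1 := msize1_ge1 t ow; have Z1 := msize1_ge1 z ow.
have Ms : 0 <= msize1 w t ^+ s by rewrite exprn_ge0 // (le_trans ler01).
rewrite (ev2E t z (leqnn _)) -!mulrA; apply: kap_sum_ord => //.
  rewrite !mulr_ge0 ?exprn_ge0 ?(le_trans ler01 Z1) ?(le_trans ler01 M1) //.
  by rewrite ltW // (adelic_gt0 p aP).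
move=> i; rewrite mulrA (avM aw) (avX aw).
apply: ler_pM; rewrite ?exprn_ge0 ?(av_ge0 aw) //.
  apply: le_trans ((hD i).2 L p w t bp ow) _.
  by rewrite ler_wpM2r // (le_adelic_prod i p aD).
apply: le_trans (_ : msize1 w z ^+ i <= _).
  by apply: lerXn2r; rewrite ?nnegrE ?(av_ge0 aw) ?msize1_ge // (le_trans ler01).
by rewrite ler_weXn2l // -ltnS prednK // (leq_trans _ (ltn_ord i)).
Qed.

(** Away from a bounded set, a polynomial has the size of its leading term. *)
Lemma leading_term_dominates r : r != 0 -> exists2 C : nat -> R, adelic C &
  forall L p (w : L -> R) (t : L), is_base p -> lies_over p w ->
    w t <= C p \/ msize1 w t ^+ (size r).-1 <= C p * w (ev1 t r).
Proof.
move=> r0; set n := (size r).-1.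
have sr : size r = n.+1 by rewrite /n prednK // lt0n size_poly_eq0.
have lc0 : r`_n != 0 by have := lead_coef_eq0 r; rewrite /lead_coef -/n => ->.
have [D aD hD] := scalar_bounded R (r`_n)^-1.
have [B aB hB] := @ev1_bounded (take_poly n r) n.-1 (leq_trans (size_take_poly _ _) (leqSpred _)).
have ak := adelic_kap R.
exists (fun p => D p * (kap R p * B p)); first by do 2?[apply: adelicM].
move=> L p w t bp ow; have aw := over_av ow; set C := D p * _.
have D1 := adelic_ge1 p aD; have B1 := adelic_ge1 p aB; have k1 := adelic_ge1 p ak.
have D0 := adelic_gt0 p aD; have B0 := adelic_gt0 p aB; have k0 := adelic_gt0 p ak.
have C1 : 1 <= C by rewrite mulr_ege1 // mulr_ege1.
have [t1|t1] := leP (w t) 1; first by left; apply: le_trans C1.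
have tn0 : 0 < w t ^+ n.-1 by rewrite exprn_gt0 // (lt_trans ltr01).
have mt : msize1 w t = w t by apply: msize1_eq ow _; apply: ltW.
have rE : ev1 t r = (r`_n)%:A * t ^+ n + ev1 t (take_poly n r).
  rewrite (@ev1E _ _ _ n.+1) ?sr // big_ord_recr addrC /=; congr (_ + _).
  rewrite (@ev1E _ _ _ n) ?size_take_poly //; apply: eq_bigr => i _.
  by rewrite coef_take_poly ltn_ord.
have lt_n : w t ^+ n <= D p * (kap R p * Num.max (w (ev1 t r)) (B p * w t ^+ n.-1)).
  have -> : w t ^+ n = w ((r`_n)^-1%:A) * w (ev1 t r - ev1 t (take_poly n r)).
    rewrite -(avM aw) rE addrK mulrA -scalerAl mul1r scalerA mulVf // scale1r mul1r.
    by rewrite (avX aw).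
  apply: ler_pM; rewrite ?(av_ge0 aw) //; first exact: hD.
  apply: le_trans (kapP _ _ bp ow) _; rewrite (avN aw) ler_pM2l // ge_max !le_max lexx /=.
  by apply/orP; right; rewrite -mt; apply: hB.
rewrite mt; have [le|lt] := leP (w (ev1 t r)) (B p * w t ^+ n.-1); last first.
  right; apply: le_trans lt_n _; rewrite (max_idPl (ltW lt)) /C -!mulrA ler_pM2l // ler_pM2l //.
  by rewrite ler_peMl // av_ge0.
rewrite (max_idPr le) in lt_n.
case: (posnP n) => [n0|n0].
  right; rewrite {1}n0 expr0.
  have : 1 <= D p * w (ev1 t r).
    have -> : ev1 t r = (r`_n)%:A.
      by rewrite rE n0 (@ev1E _ _ (take_poly 0 r) 0) ?size_take_poly // big_ord0 addr0 expr0 mulr1.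
    apply: (@le_trans _ _ (w ((r`_n)^-1%:A) * w (r`_n)%:A)).
      by rewrite -(avM aw) -scalerAl mul1r scalerA mulVf // scale1r (av1 aw).
    by rewrite ler_wpM2r ?av_ge0 //; apply: hD.
  move/le_trans; apply; rewrite /C -mulrA ler_pM2l // -[leLHS]mul1r.
  by rewrite ler_wpM2r ?av_ge0 // mulr_ege1.
left; move: lt_n; rewrite -{1}(prednK n0) exprS !mulrA ler_pM2r // /C.
by rewrite !mulrA.
Qed.

Lemma root_bounded r : r != 0 -> exists2 C : nat -> R, adelic C &
  forall L p (w : L -> R) (t : L), is_base p -> lies_over p w -> ev1 t r = 0 ->
    msize1 w t <= C p.
Proof.
move=> /leading_term_dominates[C aC hC]; exists C => // L p w t bp ow rt.
apply: (msize1_le ow); first exact: adelic_ge1.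
case: (hC L p w t bp ow) => //; rewrite rt (av0 (over_av ow)) mulr0 => h.
have := lt_le_trans ltr01 (exprn_ege1 (size r).-1 (msize1_ge1 t ow)).
by rewrite ltNge h.
Qed.

Lemma root_height r : r != 0 -> exists c : R, forall L (t : L), ev1 t r = 0 ->
  vheight R [:: 1; t] <= c.
Proof.
move=> /root_bounded[C aC hC]; have [c c0 hc] := place_height_le k aC.
exists c => L t rt; rewrite -[c]add0r -(place_height1 R L).
apply: hc (size_fun_msize1 t) (size_fun1 R L) _ => p w bp ow.
by rewrite mulr1; apply: hC.
Qed.

Lemma vheight1_ge0 L (t : L) : 0 <= vheight R [:: 1; t].
Proof. by apply: (@vheight_ge0 _ _ _ _ 1); rewrite ?inE ?eqxx ?oner_neq0. Qed.

End PolynomialSizes.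

Section Bidegree.
Variables (R : realType) (k : fieldExtType rat).
Implicit Types (L : fieldExtType k).
Variables (G : {poly {poly k}}) (n s : nat).
Hypotheses (irrG : irreducible_elt G) (szG : size G = n.+1) (n0 : (0 < n)%N).
Hypothesis degG : forall i, (size (G`_i)%R <= s.+1)%N.

Lemma coefs_no_common_root L (t : L) : exists j, ev1 t G`_j != 0.
Proof.
apply: contrapT => no.
have rt i : ev1 t G`_i = 0 by apply/eqP/negPn/negP => h; apply: no; exists i.
pose D := \big[@gcdp k/0]_(i < n.+1) G`_i.
have rtD : ev1 t D = 0.
  rewrite /D; elim/big_ind: _ => [|a b ha hb|i _]; [exact: rmorph0 | | exact: rt].
  by apply/eqP; rewrite -[_ == 0]/(root _ _) gcdp_map root_gcd; apply/andP; split; apply/eqP.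
have dvD i : D %| G`_i.
  have [lt|ge] := ltnP i n.+1; last by rewrite nth_default ?szG // dvdp0.
  have gen (l : seq 'I_n.+1) : Ordinal lt \in l -> \big[@gcdp k/0]_(j <- l) G`_j %| G`_i.
    elim: l => // j l IH; rewrite inE big_cons => /predU1P[<-|/IH h]; first exact: dvdp_gcdl.
    exact: dvdp_trans (dvdp_gcdr _ _) h.
  by apply: gen; rewrite mem_index_enum.
have Gn0 : G`_n != 0.
  by have := lead_coef_eq0 G; rewrite /lead_coef szG => ->; rewrite -size_poly_eq0 szG.
have D0 : D != 0 by apply: contraNneq Gn0 => D0; have := dvD n; rewrite D0 dvd0p.
have sD : (1 < size D)%N.
  rewrite ltnNge; apply/negP => /size1_polyC DE; move: rtD; rewrite DE ev1C => /eqP.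
  rewrite scaler_eq0 oner_eq0 orbF => /eqP z; move: D0; by rewrite DE z eqxx.
have [G' GE] := dvd_coefs dvD.
case: (irrG GE) => [|/unit_size1 sG'].
  by rewrite poly_unitE coefC eqxx /= => /andP[_ /unit_size1]; move: sD => /[swap] ->.
by have := szG; rewrite GE mul_polyC size_scale // sG' => -[n1]; have := n0; rewrite -n1.
Qed.

(** The leading coefficient [G_j (t)] that survives at [t] gives a crude bound:
    multiply the relation by a power of [z] and compare. *)
Lemma crude_height_bound : exists2 c : R, 0 <= c & forall L (t z : L), ev2 t z G = 0 ->
  vheight R [:: 1; z] <= s%:R * vheight R [:: 1; t] + c.
Proof.
have /choice[C hC] (j : 'I_n.+1) : exists C : nat -> R, adelic C /\
    forall L p (w : L -> R) (t z : L), is_base p -> lies_over p w ->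
    w (ev2 t z (take_poly j G)) <= C p * msize1 w t ^+ s * msize1 w z ^+ j.-1 /\
    w (ev1 t G`_j) <= C p * msize1 w t ^+ s.
  have [|B aB hB] := @ev2_bounded R k (take_poly j G) s.
    by move=> i; rewrite coef_take_poly; case: ifP; rewrite ?size_poly0.
  have [D aD hD] := ev1_bounded R (degG j).
  exists (fun p => B p * D p); split; first exact: adelicM.
  move=> L p w t z bp ow.
  have B1 := adelic_ge1 p aB; have D1 := adelic_ge1 p aD.
  have B0 := adelic_gt0 p aB; have D0 := adelic_gt0 p aD.
  have M1 := msize1_ge1 t ow; have Z1 := msize1_ge1 z ow.
  have M0 : 0 <= msize1 w t ^+ s by rewrite exprn_ge0 // (le_trans ler01).
  split.
    apply: le_trans (hB L p w t z bp ow) _; apply: ler_pM.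
    - by rewrite mulr_ge0 // ltW.
    - by rewrite exprn_ge0 // (le_trans ler01).
    - by rewrite ler_wpM2r // ler_peMr // ltW.
    - by rewrite ler_weXn2l // -!subn1 leq_sub2r // size_take_poly.
  by apply: le_trans (hD L p w t bp ow) _; rewrite ler_wpM2r // ler_peMl // ltW.
have aC j : adelic (C j) by case: (hC j).
have aP : adelic (fun p => \prod_j C j p) := adelic_prod (index_enum _) aC.
have [c c0 hc] := place_height_le k aP; exists c => // L t z Gz.
pose P j := ev1 t G`_j != 0.
have exP : exists j, P j := coefs_no_common_root t.
have bndP j : P j -> (j <= n)%N.
  rewrite /P leqNgt; apply: contraNN => nj; by rewrite nth_default ?szG // rmorph0.
case: (ex_maxnP exP bndP) => j Pj maxj.
have jn : (j < n.+1)%N by rewrite ltnS bndP.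
have GE : ev2 t z (take_poly j G) = - (ev1 t G`_j * z ^+ j).
  have : ev2 t z G = ev2 t z (take_poly j G) + ev1 t G`_j * z ^+ j.
    rewrite (@ev2E _ _ _ _ _ n.+1) ?szG // (@ev2E _ _ _ _ (take_poly j G) j) ?size_take_poly //.
    rewrite -(big_mkord predT (fun i => ev1 t G`_i * z ^+ i)) (big_cat_nat (n := j.+1)) //=.
    rewrite [X in _ + X]big1_seq ?addr0 => [|i]; last first.
      rewrite mem_index_iota => /andP[_ /andP[ji _]]; have [->|ni] := eqVneq (ev1 t G`_i) 0.
        by rewrite mul0r.
      by have := maxj i ni; rewrite leqNgt ji.
    rewrite big_nat_recr //= big_mkord; congr (_ + _); apply: eq_bigr => i _.
    by rewrite coef_take_poly ltn_ord.
  by rewrite Gz => /esym/eqP; rewrite addr_eq0 => /eqP.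
have j0 : (0 < j)%N.
  rewrite lt0n; apply: contraNneq Pj => j0; move/eqP: GE.
  rewrite j0 (@ev2E _ _ _ _ (take_poly 0 G) 0) ?size_take_poly // big_ord0 expr0 mulr1.
  by rewrite eq_sym oppr_eq0.
have key p (w : L -> R) : is_base p -> lies_over p w ->
    w (ev1 t G`_j) * msize1 w z <= \prod_j C j p * msize1 w t ^+ s.
  move=> bp ow; have aw := over_av ow.
  have [_ /(_ L p w t z bp ow)[h1 h2]] := hC (Ordinal jn); rewrite /= in h1 h2.
  have le := le_adelic_prod (Ordinal jn) p aC.
  have M0 : 0 <= msize1 w t ^+ s by rewrite exprn_ge0 // (le_trans ler01 (msize1_ge1 t ow)).
  apply: le_trans (_ : C (Ordinal jn) p * msize1 w t ^+ s <= _); last by rewrite ler_wpM2r.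
  have [z1|z1] := leP (w z) 1.
    by apply: le_trans h2; rewrite ler_piMr ?av_ge0 //; apply: (msize1_le ow).
  have zp : 0 < w z by rewrite (lt_trans ltr01).
  have mz : msize1 w z = w z by apply: (msize1_eq ow); apply: ltW.
  have zj : w z ^+ j = w z * w z ^+ j.-1 by rewrite -exprS prednK.
  move: h1; rewrite GE (avN aw) (avM aw) (avX aw) mz zj mulrA.
  by rewrite ler_pM2r // exprn_gt0.
have sz1 := size_fun_msize1 R t; have sz2 := size_fun_msize1 R z.
have sz3 := size_fun_abs R Pj.
have := hc L _ _ (size_funM sz3 sz2) (size_funX s sz1) key.
by rewrite place_heightM // place_heightX // place_height_abs // add0r.
Qed.

(** Polynomials [u 0, ..., u (b + n - 1)], not all zero and of degree at most
    [c], that satisfy the linear recurrence with characteristic polynomial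
    [G]: there are more unknown coefficients than equations. *)
Lemma exists_recurrent_seq (b c : nat) : (b * s < n * c.+1)%N ->
  exists u : nat -> {poly k}, [/\ forall i, (size (u i) <= c.+1)%N,
    exists2 i, (i < b + n)%N & u i != 0 &
    forall l, (l < b)%N -> \sum_(j < n.+1) G`_j * u (l + j)%N = 0].
Proof.
move=> lt; pose J : finType := ('I_(b + n) * 'I_c.+1)%type.
(* The unknowns are the coefficients of the [u i]; row [l] of the matrices lists
   the coefficients of the [l]th equation. *)
pose x (m : J) : 'M[k]_(b, (c + s).+1) :=
  \matrix_(l, e) (\sum_(j < n.+1) if (l + j == m.1)%N then G`_j * 'X^(m.2) else 0)`_e.
have [|q [m0 qm0] hq] := @linear_dependence k _ J x.
  rewrite dimvf /dim /= card_prod !card_ord.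
  by move: lt; clear; nia.
pose u i : {poly k} := \poly_(a < c.+1) (if insub i is Some i' then q (i', inord a) else 0).
have uE i : (i < b + n)%N -> forall i' : 'I_(b + n), val i' = i ->
    u i = \sum_(a < c.+1) q (i', a) *: 'X^a.
  move=> ib i' i'E; rewrite /u poly_def; apply: eq_bigr => a _.
  case: insubP => [i'' _ i''E|]; last by rewrite ib.
  by congr (q (_, _) *: _); [apply: val_inj; rewrite i''E | rewrite inord_val].
have su i : (size (u i) <= c.+1)%N by apply: size_poly.
exists u; split=> //.
  exists (val m0.1); [exact: ltn_ord | apply/eqP => u0; case/eqP: qm0].
  have := congr1 (fun r : {poly k} => r`_(val m0.2)) u0; rewrite coef_poly ltn_ord coef0.
  case: insubP => [i _ /val_inj ->|]; last by rewrite ltn_ord.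
  by rewrite inord_val -surjective_pairing => ->.
move=> l lb; apply/polyP => e; rewrite coef0.
have [le|ge] := ltnP e (c + s).+1; last first.
  rewrite nth_default //; apply: leq_trans ge.
  apply: leq_trans (size_sum _ _ _) _; apply/bigmax_leqP => j _.
  apply: leq_trans (size_polyMleq _ _) _.
  by have := degG j; have := su (l + j)%N; clear; lia.
have := congr1 (fun A : 'M[k]_(b, (c + s).+1) => A (Ordinal lb) (Ordinal le)) hq.
rewrite summxE mxE; under eq_bigr do rewrite !mxE -coefZ.
rewrite -coef_sum => e0; apply: (etrans _ e0) => {e0}; apply: (congr1 (fun r : {poly k} => r`_e)).
under [RHS]eq_bigr do rewrite scaler_sumr.
rewrite [RHS]exchange_big /=; apply: eq_bigr => j _.
have lj : (l + j < b + n)%N by have := ltn_ord j; move: lb; clear; lia.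
rewrite (uE _ lj (Ordinal lj) erefl) mulr_sumr.
pose f (i : 'I_(b + n)) (a : 'I_c.+1) : {poly k} := q (i, a) *:
   (if (l + j == i)%N then G`_j * 'X^a else 0).
transitivity (\sum_i \sum_a f i a); last first.
  by rewrite pair_bigA /=; apply: eq_bigr => -[i a].
rewrite (bigD1 (Ordinal lj)) //= [X in _ = _ + X]big1 /f ?addr0; last first.
  move=> i ne; apply: big1 => a _; case: eqP => [h|_]; last by rewrite scaler0.
  by case/eqP: ne; apply: val_inj.
by apply: eq_bigr => a _; rewrite eqxx scalerAr.
Qed.

End Bidegree.
Section BidegreeBound.
Variables (R : realType) (k : fieldExtType rat).
Implicit Types (L : fieldExtType k).
Variables (G : {poly {poly k}}) (n s : nat).
Hypotheses (irrG : irreducible_elt G) (szG : size G = n.+1) (n0 : (0 < n)%N).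
Hypothesis degG : forall i, (size (G`_i)%R <= s.+1)%N.

(** At a large zero [z] of [G], the quotient of [G] by a power of [z] is, up
    to sign, the quotient of the lower part of [G]. *)
Lemma drop_bounded i : exists2 C : nat -> R, adelic C &
  forall L p (w : L -> R) (t z : L), is_base p -> lies_over p w -> ev2 t z G = 0 ->
    w (ev2 t z (drop_poly i.+1 G)) <= C p * msize1 w t ^+ s.
Proof.
have [|B aB hB] := @ev2_bounded R k (drop_poly i.+1 G) s.
  by move=> j; rewrite coef_drop_poly.
have [|D aD hD] := @ev2_bounded R k (take_poly i.+1 G) s.
  by move=> j; rewrite coef_take_poly; case: ifP; rewrite ?size_poly0.
exists (fun p => B p * D p); first exact: adelicM.
move=> L p w t z bp ow Gz; have aw := over_av ow.
have B1 := adelic_ge1 p aB; have D1 := adelic_ge1 p aD.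
have B0 := adelic_gt0 p aB; have D0 := adelic_gt0 p aD.
have M1 := msize1_ge1 t ow; have Z1 := msize1_ge1 z ow.
have M0 : 0 <= msize1 w t ^+ s by rewrite exprn_ge0 // (le_trans ler01).
have [z1|z1] := leP (w z) 1.
  have mz : msize1 w z = 1 by apply/eqP; rewrite eq_le Z1 (msize1_le ow).
  apply: le_trans (hB L p w t z bp ow) _.
  by rewrite mz expr1n mulr1 ler_wpM2r // ler_peMr // ltW.
have zp : 0 < w z by rewrite (lt_trans ltr01).
have mz : msize1 w z = w z by apply: (msize1_eq ow); apply: ltW.
have e : w (ev2 t z (drop_poly i.+1 G)) * w z ^+ i.+1 = w (ev2 t z (take_poly i.+1 G)).
  rewrite -(avX aw) -(avM aw) -(avN aw); congr (w _); apply/eqP.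
  rewrite eq_sym -subr_eq0 opprK -Gz -[in X in _ == X](poly_take_drop i.+1 G).
  by rewrite rmorphD rmorphM rmorphXn /= ev2X.
have zi : 0 < w z ^+ i by rewrite exprn_gt0.
apply: le_trans (_ : w (ev2 t z (drop_poly i.+1 G)) * w z <= _).
  by rewrite ler_peMr ?av_ge0 // ltW.
rewrite -(ler_pM2r zi) -[leLHS]mulrA -exprS e; apply: le_trans (hD L p w t z bp ow) _.
rewrite mz; apply: ler_pM.
- by rewrite mulr_ge0 // ltW.
- by rewrite exprn_ge0 // ltW.
- by rewrite ler_wpM2r // ler_peMl // ltW.
- by rewrite ler_weXn2l 1?ltW // -!subn1 leq_subLR add1n size_take_poly.
Qed.

Variables (b c : nat) (u : nat -> {poly k}).
Hypothesis su : forall i, (size (u i) <= c.+1)%N.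
Hypothesis hu : forall l, (l < b)%N -> \sum_(j < n.+1) G`_j * u (l + j)%N = 0.

(** On the curve, multiplication by the second coordinate shifts the index. *)
Definition recurrence_form (l : nat) : {poly {poly k}} :=
  \sum_(i < n) (u (l + i)%N)%:P * drop_poly i.+1 G.

Lemma recurrence_formS l : (l < b)%N ->
  recurrence_form l * 'X = (u l)%:P * G + recurrence_form l.+1.
Proof.
move=> lb; have dropE i : drop_poly i.+1 G * 'X = drop_poly i G - (G`_i)%:P.
  apply/polyP => j; rewrite coefMX coefB coefC !coef_drop_poly; case: j => [|j] /=.
    by rewrite subrr.
  by rewrite subr0 addnS addSn.
have dropn : drop_poly n G = (G`_n)%:P.
  apply/polyP => j; rewrite coefC coef_drop_poly; case: j => //= j.
  by rewrite nth_default // szG addSn ltnS leq_addl.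
have -> : recurrence_form l * 'X =
    \sum_(i < n) (u (l + i)%N)%:P * drop_poly i G - \sum_(i < n) (G`_i * u (l + i)%N)%:P.
  rewrite mulr_suml -sumrB; apply: eq_bigr => i _.
  by rewrite -mulrA dropE mulrBr polyCM [(G`_i)%:P * _]mulrC.
have := hu lb; rewrite big_ord_recr /= => /eqP; rewrite addr_eq0 => /eqP h.
rewrite -(rmorph_sum (@polyC {poly k})) h rmorphN opprK /= polyCM -dropn [drop_poly n G * _]mulrC.
rewrite -(big_ord_recr n (fun i => (u (l + i)%N)%:P * drop_poly i G)) big_ord_recl /=.
rewrite addn0 drop_poly0l; congr (_ + _); apply: eq_bigr => i _.
by rewrite /bump /= add1n addnS addSn.
Qed.

Lemma recurrence_form_neq0 : (exists2 i, (i < b + n)%N & u i != 0) ->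
  (size (recurrence_form 0) <= n)%N /\ recurrence_form 0 != 0.
Proof.
have Gn0 : G`_n != 0.
  by have := lead_coef_eq0 G; rewrite /lead_coef szG => ->; rewrite -size_poly_eq0 szG.
move=> ex; have {}ex : exists i, (i < b + n)%N && (u i != 0).
  by case: ex => i h1 h2; exists i; rewrite h1.
case: (ex_minnP ex) => m /andP[mb um] minm; split.
  apply: leq_trans (size_sum _ _ _) _; apply/bigmax_leqP => i _.
  rewrite mul_polyC; apply: leq_trans (size_scale_leq _ _) _.
  by rewrite size_drop_poly szG subSS leq_subr.
have uz i : (i < m)%N -> u i = 0.
  move=> im; have ib := ltn_trans im mb; apply/eqP; apply: contraLR im => ui.
  by rewrite -leqNgt minm // ib.
have mn : (m < n)%N.
  rewrite ltnNge; apply/negP => nm; have lb : (m - n < b)%N by move: mb nm; clear; lia.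
  have := hu lb; rewrite big_ord_recr /= subnK // big1 => [|i _]; last first.
    by rewrite uz ?mulr0 //; have := ltn_ord i; move: nm; clear; lia.
  by move/eqP; rewrite add0r mulf_eq0 (negPf um) (negPf Gn0).
apply/eqP => /(congr1 (fun S : {poly {poly k}} => S`_(n.-1 - m)%N)).
rewrite coef0 coef_sum (bigD1 (Ordinal mn)) //= coefCM coef_drop_poly add0n.
have -> : (n.-1 - m + m.+1 = n)%N by move: mn; clear; lia.
rewrite big1 => [|i ne].
  by move/eqP; rewrite addr0 mulf_eq0 (negPf um) (negPf Gn0).
rewrite coefCM coef_drop_poly; have [im|mi] := ltnP i m; first by rewrite uz // mul0r.
rewrite [X in _ * X]nth_default ?mulr0 // szG.
have : (m < i)%N by rewrite ltn_neqAle mi andbT; apply: contraNneq ne => h; apply/eqP/val_inj.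
by move: mn {ne}; clear; lia.
Qed.

Lemma recurrence_form_bounded l : exists2 C : nat -> R, adelic C &
  forall L p (w : L -> R) (t z : L), is_base p -> lies_over p w -> ev2 t z G = 0 ->
    w (ev2 t z (recurrence_form l)) <= C p * msize1 w t ^+ (c + s).
Proof.
have /choice[D hD] (i : 'I_n) : exists D : nat -> R, adelic D /\
    forall L p (w : L -> R) (t z : L), is_base p -> lies_over p w -> ev2 t z G = 0 ->
      w (ev2 t z ((u (l + i)%N)%:P * drop_poly i.+1 G)) <= D p * msize1 w t ^+ (c + s).
  have [B aB hB] := drop_bounded i; have [C aC hC] := @ev1_bounded R k _ _ (su (l + i)).
  exists (fun p => C p * B p); split; first exact: adelicM.
  move=> L p w t z bp ow Gz; have aw := over_av ow.
  rewrite rmorphM /= ev2C (avM aw) exprD mulrACA.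
  by apply: ler_pM; rewrite ?av_ge0 //; [apply: hC | apply: hB].
have aD i : adelic (D i) by case: (hD i).
have aP : adelic (fun p => \prod_i D i p) := adelic_prod (index_enum _) aD.
exists (fun p => kap R p ^+ n * \prod_i D i p).
  by apply: adelicM => //; apply/adelicX/adelic_kap.
move=> L p w t z bp ow Gz; rewrite /recurrence_form rmorph_sum -mulrA /=.
have M0 : 0 <= msize1 w t ^+ (c + s) by rewrite exprn_ge0 // (le_trans ler01 (msize1_ge1 t ow)).
apply: kap_sum_ord => //; first by rewrite mulr_ge0 // ltW // (adelic_gt0 p aP).
move=> i; apply: le_trans ((hD i).2 L p w t z bp ow Gz) _.
by rewrite ler_wpM2r // (le_adelic_prod i p aD).
Qed.

Lemma recurrence_bound : (exists2 i, (i < b + n)%N & u i != 0) ->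
  exists C : R, forall L (t z : L), ev2 t z G = 0 -> ev2 t z (recurrence_form 0) != 0 ->
    b%:R * vheight R [:: 1; z] <= (c + s)%:R * vheight R [:: 1; t] + C.
Proof.
move=> ex; have [B aB hB] := recurrence_form_bounded 0.
have [D aD hD] := recurrence_form_bounded b.
have [C C0 hC] := place_height_le k (adelicM aB aD).
exists C => L t z Gz nz.
have phiE l : (l <= b)%N -> ev2 t z (recurrence_form l) = ev2 t z (recurrence_form 0) * z ^+ l.
  elim: l => [|l IH] lb; first by rewrite expr0 mulr1.
  rewrite exprSr mulrA -IH ?(ltnW lb) // -[X in _ = _ * X](ev2X t z) -rmorphM.
  by rewrite recurrence_formS // rmorphD rmorphM /= Gz mulr0 add0r.
have sz1 := size_fun_msize1 R t; have sz2 := size_fun_msize1 R z.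
have sz3 := size_fun_abs R nz.
rewrite -[X in X <= _]add0r -(place_height_abs R nz).
rewrite -(place_heightX b sz2) -(place_heightX (c + s) sz1) -(place_heightM sz3 (size_funX b sz2)).
apply: hC; [exact: size_funM sz3 (size_funX b sz2) | exact: size_funX|].
move=> p w bp ow; have aw := over_av ow.
have B1 := adelic_ge1 p aB; have D1 := adelic_ge1 p aD.
have B0 := adelic_gt0 p aB; have D0 := adelic_gt0 p aD.
have M0 : 0 <= msize1 w t ^+ (c + s) by rewrite exprn_ge0 // (le_trans ler01 (msize1_ge1 t ow)).
have [z1|z1] := leP (w z) 1.
  have mz : msize1 w z = 1 by apply/eqP; rewrite eq_le (msize1_ge1 z ow) (msize1_le ow).
  rewrite mz expr1n mulr1; apply: le_trans (hB L p w t z bp ow Gz) _.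
  by rewrite ler_wpM2r // ler_peMr // ltW.
rewrite (msize1_eq ow (ltW z1)) -(avX aw) -(avM aw) -phiE //.
apply: le_trans (hD L p w t z bp ow Gz) _.
by rewrite ler_wpM2r // ler_peMl // ltW.
Qed.

End BidegreeBound.

(** On a curve [G = 0] of degree [n] in [z] and [s] in [t], the height of [z]
    is at most [s / n] times that of [t], up to an arbitrarily small proportion.  The
    powers of [z] up to [b] multiply a suitable nonzero form of small degree in
    [t] into forms of the same small degree. *)
Lemma bidegree_bound (R : realType) (k : fieldExtType rat) (G : {poly {poly k}}) (n s : nat) :
  irreducible_elt G -> size G = n.+1 -> (0 < n)%N -> (forall i, (size (G`_i)%R <= s.+1)%N) ->
  forall eps : R, 0 < eps -> exists c : R, forall (L : fieldExtType k) (t z : L),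
    ev2 t z G = 0 ->
    vheight R [:: 1; z] <= (s%:R / n%:R + eps) * vheight R [:: 1; t] + c.
Proof.
move=> irrG szG n0 degG eps e0.
have [b b0 hb] : exists2 b, (0 < b)%N & s%:R <= eps * b%:R.
  exists (Num.truncn (s%:R / eps)).+1 => //; rewrite mulrC -ler_pdivrMr //.
  exact/ltW/truncnS_gt.
pose c := (b * s %/ n)%N.
have lt : (b * s < n * c.+1)%N by rewrite [X in (_ < X)%N]mulnC ltn_ceil.
have le : (c * n <= b * s)%N by apply: leq_divM.
have [u [su ex hu]] := exists_recurrent_seq degG lt.
have [C hC] := recurrence_bound R szG degG su hu ex.
have [sP P0] := recurrence_form_neq0 szG hu ex.
set P := recurrence_form G n u 0 in hC sP P0.
have ndvd : ~ (exists Q, P = G * Q).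
  move=> [Q PE]; have Q0 : Q != 0 by apply: contraNneq P0 => Q0; rewrite PE Q0 mulr0.
  have G0 : G != 0 by rewrite -size_poly_eq0 szG.
  move: sP; rewrite PE size_mul // szG; have : (0 < size Q)%N by rewrite size_poly_gt0.
  by clear; case: (size Q) => // q _; rewrite addSn addnS /= -ltnS ltnNge ltnS leq_addr.
have G1 : (1 < size G)%N by rewrite szG.
have [r [A [B [r0 rE]]]] := irreducible_elimination irrG G1 ndvd.
have [c1 hc1] := root_height R r0.
have [c2 c20 hc2] := crude_height_bound R irrG szG n0 degG.
have bR : 0 < b%:R :> R by rewrite ltr0n.
have nR : 0 < n%:R :> R by rewrite ltr0n.
exists (Num.max (C / b%:R) (s%:R * c1 + c2)) => L t z Gz.
have ht := vheight1_ge0 R t; have s0 : 0 <= s%:R :> R by [].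
have co : 0 <= s%:R / n%:R + eps by rewrite addr_ge0 ?divr_ge0 // ltW.
have [Pz|Pz] := eqVneq (ev2 t z P) 0.
  have rt : ev1 t r = 0.
    by rewrite -(ev2C t z) rE rmorphD !rmorphM /= Gz Pz !mulr0 addr0.
  apply: le_trans (hc2 L t z Gz) _.
  apply: le_trans (_ : s%:R * c1 + c2 <= _); first by rewrite lerD2r ler_wpM2l // hc1.
  apply: le_trans (_ : Num.max (C / b%:R) (s%:R * c1 + c2) <= _); first by rewrite le_max lexx orbT.
  by rewrite lerDr mulr_ge0.
apply: le_trans (_ : ((c + s)%:R * vheight R [:: 1; t] + C) / b%:R <= _).
  by rewrite ler_pdivlMr // mulrC hC.
rewrite mulrDl; apply: lerD; last by rewrite le_max lexx.
rewrite mulrAC ler_wpM2r //.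
rewrite natrD mulrDl; apply: lerD; last by rewrite ler_pdivrMr.
rewrite ler_pdivrMr // mulrAC ler_pdivlMr // -!natrM ler_nat; by rewrite [X in (_ <= X)%N]mulnC.
Qed.
(** * The multiplicity at O in terms of monomials *)

Lemma big3 (T : Type) (idx : T) (op : Monoid.law idx) (f : 'I_3 -> T) :
  \big[op/idx]_(i < 3) f i = op (f i0) (op (f i1) (f i2)).
Proof.
rewrite !big_ord_recl big_ord0 Monoid.mulm1.
by congr (op _ (op _ _)); congr f; apply: val_inj.
Qed.

Lemma ord3P (i : 'I_3) : [\/ i = i0, i = i1 | i = i2].
Proof.
by case: i => -[|[|[|//]]] h; [constructor 1|constructor 2|constructor 3]; apply: val_inj.
Qed.

Lemma mdeg3 (m : 'X_{1..3}) : mdeg m = (m i0 + (m i1 + m i2))%N.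
Proof. by rewrite mdegE big3. Qed.

Lemma mnm3_eq (m m' : 'X_{1..3}) : m i0 = m' i0 -> m i1 = m' i1 -> m i2 = m' i2 -> m = m'.
Proof. by move=> e0 e1 e2; apply/mnmP => i; case: (ord3P i) => ->. Qed.

Lemma tofrac_div_eq (T : idomainType) (P Q D E : T) : D != 0 -> E != 0 ->
  tofrac P / tofrac D = tofrac Q / tofrac E -> P * E = Q * D.
Proof.
move=> D0 E0 /eqP; rewrite eqr_div ?tofrac_eq0 // => /eqP e.
by apply/eqP; rewrite -tofrac_eq !tofracM e.
Qed.

Lemma tofrac_div_add (T : idomainType) (P Q D E : T) : D != 0 -> E != 0 ->
  tofrac P / tofrac D + tofrac Q / tofrac E = tofrac (P * E + Q * D) / tofrac (D * E).
Proof. by move=> D0 E0; rewrite addf_div ?tofrac_eq0 // tofracD !tofracM. Qed.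

Lemma tofrac_div_mul (T : idomainType) (P Q D E : T) :
  tofrac P / tofrac D * (tofrac Q / tofrac E) = tofrac (P * Q) / tofrac (D * E).
Proof. by rewrite mulf_div !tofracM. Qed.

Lemma tofrac_div_prod (T : idomainType) n (r H z : T) (a : 'I_n -> T) (m : T) : z != 0 ->
  m * z ^+ n = r * \prod_j a j ->
  tofrac m / tofrac H = tofrac r / tofrac H * \prod_j (tofrac (a j) / tofrac z).
Proof.
move=> z0 e; have zn : tofrac z ^+ n != 0 :> {fraction T} by rewrite expf_neq0 // tofrac_eq0.
rewrite mulrAC; congr (_ / _); rewrite prodf_div prodr_const card_ord.
rewrite -(rmorph_prod (@tofrac T)) mulrA -tofracM -e tofracM (rmorphXn (@tofrac T)) mulfK ?zn //.
Qed.

Section VanishingOrder.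
Variable k : fieldExtType rat.
Implicit Types (P Q F : {mpoly k[3]}) (m : 'X_{1..3}).

(** Membership in the [n]th power of the ideal generated by the first two
    coordinates. *)
Definition order_ge n P := forall m, m \in msupp P -> (n <= m i0 + m i1)%N.

(** The form [P(tx, ty, z)], as a polynomial in [t]. *)
Definition stretch : {mpoly k[3]} -> {poly {mpoly k[3]}} :=
  mmap (@polyC {mpoly k[3]} \o @mpolyC 3 k) (fun i => ('X_i)%:P * 'X ^+ (i != i2)).
HB.instance Definition _ := GRing.RMorphism.copy stretch
  (mmap (@polyC {mpoly k[3]} \o @mpolyC 3 k) (fun i => ('X_i)%:P * 'X ^+ (i != i2))).

Lemma stretch_monomial c m : stretch (c *: 'X_[m]) = (c *: 'X_[m])%:P * 'X^(m i0 + m i1).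
Proof.
rewrite /stretch mmapZ mmapX /= -mul_mpolyC polyCM -mulrA; congr (_ * _).
have -> : 'X_[m] = 'X_i0 ^+ m i0 * ('X_i1 ^+ m i1 * 'X_i2 ^+ m i2) :> {mpoly k[3]}.
  by rewrite mpolyXE_id big3.
rewrite /mmap1 big3 /= !rmorphM !rmorphXn /= !expr1 expr0 mulr1 exprD.
have swap (S : comPzRingType) (x y z u v : S) : x * u * (y * v * z) = x * (y * z) * (u * v).
  by ring.
by move: ('X_i0)%:P ('X_i1)%:P ('X_i2)%:P 'X => x y z t; rewrite !exprMn swap.
Qed.

Lemma stretchE P : stretch P = \sum_(m <- msupp P) (P@_m *: 'X_[m])%:P * 'X^(m i0 + m i1).
Proof.
rewrite {1}[P]mpolyE raddf_sum; apply: eq_bigr => m _; exact: stretch_monomial.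
Qed.

Lemma coef_stretch P l m : ((stretch P)`_l)@_m = (P@_m) *+ (m i0 + m i1 == l)%N.
Proof.
rewrite stretchE coef_sum raddf_sum /=.
under eq_bigr do rewrite coefCM coefXn.
have [mP|mP] := boolP (m \in msupp P); last first.
  rewrite (memN_msupp_eq0 mP) mul0rn big1_seq // => m' /andP[_ m'P].
  rewrite mulr_natr mcoeffMn mcoeffZ mcoeffX; case: eqP => [e|]; last by rewrite mulr0 mul0rn.
  by rewrite -e m'P in mP.
rewrite (bigD1_seq m) ?msupp_uniq //= [X in _ + X]big1 => [|m' ne].
  by rewrite addr0 mulr_natr mcoeffMn mcoeffZ mcoeffX eqxx mulr1 eq_sym.
by rewrite mulr_natr mcoeffMn mcoeffZ mcoeffX (negPf ne) mulr0 mul0rn.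
Qed.

Lemma order_geP n P : order_ge n P <-> forall l, (l < n)%N -> (stretch P)`_l = 0.
Proof.
split=> [h l ln|h m mP].
  apply/mpolyP => m; rewrite coef_stretch mcoeff0; case: eqP => // e.
  have [mP|/memN_msupp_eq0 -> //] := boolP (m \in msupp P).
  by have := h m mP; rewrite e leqNgt ln.
rewrite leqNgt; apply/negP => /h /(congr1 (mcoeff m)); rewrite coef_stretch eqxx mulr1n mcoeff0.
by move/eqP; rewrite mcoeff_eq0 mP.
Qed.

Lemma order_geD n P Q : order_ge n P -> order_ge n Q -> order_ge n (P + Q).
Proof. by move=> hP hQ m /msuppD_le; rewrite mem_cat => /orP[/hP|/hQ]. Qed.

Lemma order_geM i j P Q : order_ge i P -> order_ge j Q -> order_ge (i + j) (P * Q).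
Proof.
move=> hP hQ m /msuppM_le/allpairsP[[m1 m2] /= [/hP h1 /hQ h2 ->]].
by rewrite !mnmDE; move: h1 h2; clear; lia.
Qed.

Lemma order_ge0 P : order_ge 0 P. Proof. by []. Qed.

Lemma order_ge_zero n : order_ge n 0. Proof. by move=> m; rewrite msupp0. Qed.

Lemma order_geX n m : (n <= m i0 + m i1)%N -> order_ge n 'X_[m].
Proof. by move=> h m'; rewrite msuppX inE => /eqP->. Qed.

Lemma order_ge_sum (I : Type) (r : seq I) (p : pred I) f n :
  (forall i, p i -> order_ge n (f i)) -> order_ge n (\sum_(i <- r | p i) f i).
Proof. by move=> h; apply: big_ind => //; [exact: order_ge_zero | move=> *; apply: order_geD]. Qed.

Lemma order_ge_exp n i P : order_ge i P -> order_ge (i * n) (P ^+ n).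
Proof.
move=> h; elim: n => [|n IH]; first by rewrite muln0.
by rewrite exprS mulnS; apply: order_geM.
Qed.

(** The first factor has a nonzero constant term in the variable of [stretch]. *)
Lemma order_ge_cancel n P Q : P.@[point_O k] != 0 -> order_ge n (P * Q) -> order_ge n Q.
Proof.
move=> PO /order_geP h; apply/order_geP => l; elim/ltn_ind: l => l IH ln.
have P0 : (stretch P)`_0 != 0.
  apply: contraNneq PO => P0; rewrite {1}[P]mpolyE raddf_sum /= big1_seq // => m /andP[_ mP].
  have := congr1 (mcoeff m) P0; rewrite coef_stretch mcoeff0.
  have [m0|m0] := eqVneq (m i0 + m i1)%N 0%N.
    by rewrite mulr1n => ->; rewrite scale0r meval0.
  move=> _; rewrite mevalZ mevalX big3 /point_O /= !expr0n.
  by move: m0; rewrite addn_eq0 negb_and => /orP[] /negPf->; rewrite ?mul0r ?mulr0.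
have := h l ln; rewrite rmorphM coefM big_ord_recl /= big1 ?addr0 ?subn0 => [|i _].
  by move/eqP; rewrite mulf_eq0 (negPf P0) => /eqP.
rewrite [X in _ * X]IH ?mulr0 //; last by rewrite /bump; lia.
by rewrite /bump /=; have := ltn_ord i; lia.
Qed.

Lemma homog_vanish_O e P : P \is e.-homog -> P.@[point_O k] = 0 -> order_ge 1 P.
Proof.
move=> /dhomogP hP PO m mP; rewrite lt0n; apply: contraPneq PO => m0.
have mE m' : m' \in msupp P -> (m' i0 + m' i1 = 0)%N -> m' = m.
  move=> m'P m'0; have := hP m mP; have := hP m' m'P.
  rewrite /= !mdeg3 => e1 e2.
  by apply: mnm3_eq; move: e1 e2 m'0 m0; clear; lia.
rewrite [P]mpolyE raddf_sum /= (bigD1_seq m) ?msupp_uniq //= big1_seq ?addr0.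
  rewrite mevalZ mevalX big3 /point_O /= !expr0n expr1n.
  move/eqP: m0; rewrite addn_eq0 => /andP[-> ->]; rewrite !mulr1.
  by apply/eqP; rewrite mcoeff_eq0 mP.
move=> m' /andP[ne m'P]; rewrite mevalZ mevalX big3 /point_O /= !expr0n.
case: (posnP (m' i0 + m' i1)) => [/mE e'|]; first by rewrite e' ?eqxx in ne.
by rewrite addn_gt0 => /orP[] /lt0n_neq0/negPf ->; rewrite ?mul0r ?mulr0.
Qed.

Let fraction_order_ge n (f : {fraction {mpoly k[3]}}) :=
  exists P D, [/\ D.@[point_O k] != 0, order_ge n P & f = tofrac P / tofrac D].

Let meval_neq0 D : D.@[point_O k] != 0 -> D != 0.
Proof. by apply: contraNneq => ->; rewrite meval0. Qed.

(** The fractions with a numerator of order at least [n] contain the [n]th power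
    of the maximal ideal; the denominator of [F / z^d] does not vanish at O. *)
Lemma ideal_in_pow_order d F n : F \is d.-homog -> ideal_in_pow F n -> order_ge n F.
Proof.
move=> hF hn; pose z : {mpoly k[3]} := 'X_i2 ^+ d.
have zO : z.@[point_O k] != 0 by rewrite /z rmorphXn /= mevalXU /point_O eqxx expr1n oner_neq0.
have [|N [r [a [hr ha e]]]] := hn (tofrac F / tofrac z).
  exists d, F, z; split=> //; last by exists 1; rewrite mul1r.
  by rewrite /z -[d in d.-homog]mul1n; apply: dhomogMn; rewrite dhomogX /= mdeg1.
have good0 : fraction_order_ge n 0.
  exists 0, 1; rewrite meval1 oner_neq0 tofrac0 mul0r; split=> //; exact: order_ge_zero.
have goodD f g : fraction_order_ge n f -> fraction_order_ge n g -> fraction_order_ge n (f + g).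
  move=> [P [D [DO hP ->]]] [Q [E [EO hQ ->]]]; exists (P * E + Q * D), (D * E).
  rewrite mevalM mulf_neq0 //; split=> //.
    by apply: order_geD; rewrite -[n]addn0; apply: order_geM.
  by rewrite tofrac_div_add ?meval_neq0.
have goodM i j f g : fraction_order_ge i f -> fraction_order_ge j g ->
    fraction_order_ge (i + j) (f * g).
  move=> [P [D [DO hP ->]]] [Q [E [EO hQ ->]]]; exists (P * Q), (D * E).
  by rewrite mevalM mulf_neq0 // tofrac_div_mul; split=> //; apply: order_geM.
have good1 : fraction_order_ge 0 1.
  by exists 1, 1; rewrite meval1 oner_neq0 tofrac1 divr1.
have [P [D [DO hP]]] : fraction_order_ge n (tofrac F / tofrac z).
  rewrite e; apply: (big_ind (fraction_order_ge n)) => // i _.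
  rewrite (_ : fraction_order_ge n = fraction_order_ge (0 + n)) //; apply: (goodM).
    by have [e' [P [D [_ _ DO _ ->]]]] := hr i; exists P, D.
  have : fraction_order_ge (\sum_(j < n) 1) (\prod_(j < n) a i j).
    apply: (big_rec2 fraction_order_ge); first exact: good1.
    move=> j y f _ hf; apply: goodM hf; have [e' [Q [E [hQ _ EO QO ->]]]] := ha i j.
    by exists Q, E; split=> //; apply: homog_vanish_O hQ QO.
  by rewrite sum1_card card_ord.
move/tofrac_div_eq => h.
have {}h : F * D = P * z.
  by apply: h; apply: meval_neq0.
apply: (order_ge_cancel DO); rewrite mulrC h -[n]addn0; exact: order_geM.
Qed.

(** A monomial of order at least [n] is a product of [n] factors [x] or [y] and
    of another monomial; dividing each factor by [z] gives elements of the
    maximal ideal. *)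
Lemma order_ideal_in_pow F n : order_ge n F -> ideal_in_pow F n.
Proof.
move=> hF f [e [G [H [hG hH HO [Q GE] ->]]]].
have oG : order_ge n G by rewrite GE -[n]add0n; apply: order_geM.
pose m_ (i : 'I_(size (msupp G))) := nth 0%MM (msupp G) i.
have mG i : m_ i \in msupp G by rewrite mem_nth.
pose b m j := if (j < m i0)%N then i0 else i1 : 'I_3.
pose rest m : 'X_{1..3} :=
  [multinom (if i == i0 then m i0 - n else if i == i1 then m i1 - (n - m i0) else m i2 + n)%N | i < 3].
have restE m : m \in msupp G -> 'X_[m] * 'X_i2 ^+ n = 'X_[rest m] * \prod_(j < n) 'X_(b m j) :> {mpoly k[3]}.
  move=> /oG nm; have -> : \prod_(j < n) 'X_(b m j) = 'X_i0 ^+ (minn n (m i0)) * 'X_i1 ^+ (n - m i0) :> {mpoly k[3]}.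
    elim: n {hF oG rest nm} => [|n IH]; first by rewrite big_ord0 min0n sub0n !expr0 mulr1.
    rewrite big_ord_recr /= IH /b; case: ltnP => h.
      have -> : minn n.+1 (m i0) = n.+1 by lia.
      have -> : (n.+1 - m i0 = n - m i0)%N by lia.
      by rewrite exprSr [RHS]mulrAC.
    have -> : minn n.+1 (m i0) = m i0 by lia.
    by rewrite subSn // exprSr mulrA.
  rewrite !mpolyXn -!mpolyXD; congr 'X_[_].
  apply: mnm3_eq; rewrite !mnmDE !mulmnE !mnm1E !mnmE /=; move: nm; clear; lia.
exists (size (msupp G)), (fun i => tofrac (G@_(m_ i) *: 'X_[rest (m_ i)]) / tofrac H),
  (fun i j => tofrac 'X_(b (m_ i) j) / tofrac 'X_i2).
have zO : ('X_i2 : {mpoly k[3]}).@[point_O k] != 0 by rewrite mevalXU /point_O eqxx oner_neq0.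
split=> [i|i j|].
- exists e, (G@_(m_ i) *: 'X_[rest (m_ i)]), H; split=> //.
  apply: dhomogZ; rewrite dhomogX /=; have /dhomogP/(_ _ (mG i)) /= := hG.
  have := oG _ (mG i); rewrite !mdeg3 !mnmE /=; move: (m_ i) => m.
  by move=> h1 h2; apply/eqP; move: h1 h2; clear; lia.
- exists 1%N, 'X_(b (m_ i) j), 'X_i2; split=> //; rewrite ?dhomogX /= ?mdeg1 //.
  by rewrite mevalXU /b /point_O; case: ifP.
transitivity (\sum_(i < size (msupp G)) tofrac (G@_(m_ i) *: 'X_[m_ i]) / tofrac H).
  rewrite -mulr_suml -(raddf_sum (@tofrac {mpoly k[3]})); congr (tofrac _ / _).
  by rewrite {1}[G]mpolyE (big_nth 0%MM) big_mkord.
apply: eq_bigr => i _; apply: tofrac_div_prod; first exact: meval_neq0.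
by rewrite -!scalerAl restE.
Qed.

Lemma multiplicity_monomials d F n : F \is d.-homog -> multiplicity_at_O F n ->
  order_ge n F /\ ~ order_ge n.+1 F.
Proof.
move=> hF [hn maxn]; split; first exact: ideal_in_pow_order hF hn.
by move=> /order_ideal_in_pow /maxn; rewrite ltnn.
Qed.

End VanishingOrder.
(** * Dehomogenization of a plane curve *)

Section Dehomogenization.
Variable k : fieldExtType rat.
Implicit Types (P Q F : {mpoly k[3]}) (m : 'X_{1..3}).

(** The polynomial [P(1, y, z)], in [y] over the polynomials in [z]. *)
Definition dehom : {mpoly k[3]} -> {poly {poly k}} :=
  mmap (@polyC {poly k} \o @polyC k)
    (fun i => if i == i0 then 1 else if i == i1 then 'X else 'X%:P).
HB.instance Definition _ := GRing.RMorphism.copy dehom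
  (mmap (@polyC {poly k} \o @polyC k)
    (fun i => if i == i0 then 1 else if i == i1 then 'X else 'X%:P)).

Lemma dehomE P : dehom P = \sum_(m <- msupp P) (P@_m *: 'X^(m i2))%:P * 'X^(m i1).
Proof.
apply: eq_bigr => m _; rewrite /mmap1 big3 /= expr1n mul1r -mul_polyC polyCM rmorphXn.
by rewrite -mulrA [X in _ * X]mulrC.
Qed.

Lemma dehomX i : dehom 'X_i = if i == i0 then 1 else if i == i1 then 'X else 'X%:P.
Proof. by rewrite /dehom mmapX mmap1U. Qed.

Lemma dehomC c : dehom c%:MP = c%:P%:P.
Proof. by rewrite /dehom mmapC. Qed.

Lemma coef_dehom P j l : ((dehom P)`_j)`_l =
  \sum_(m <- msupp P) P@_m *+ ((m i1 == j) && (m i2 == l)).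
Proof.
rewrite dehomE coef_sum coef_sum; apply: eq_bigr => m _.
rewrite coefCM coefXn mulr_natr coefMn coefZ coefXn mulr_natr -mulrnA mulnb andbC.
by rewrite [j == _]eq_sym [l == _]eq_sym.
Qed.

Lemma coef_dehom_homog d P m : P \is d.-homog -> mdeg m = d ->
  ((dehom P)`_(m i1))`_(m i2) = P@_m.
Proof.
move=> /dhomogP hP md; rewrite coef_dehom.
have uniqm m' : m' \in msupp P -> (m' i1 == m i1) && (m' i2 == m i2) -> m' = m.
  move=> /hP /=; rewrite -md !mdeg3 => e /andP[/eqP e1 /eqP e2].
  by apply: mnm3_eq => //; move: e; rewrite e1 e2; clear; lia.
have [mP|mP] := boolP (m \in msupp P); last first.
  rewrite (memN_msupp_eq0 mP) big1_seq // => m' /andP[_ m'P].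
  have [/(uniqm m' m'P) e|//] := boolP ((m' i1 == m i1) && (m' i2 == m i2)).
  by rewrite -e m'P in mP.
rewrite (bigD1_seq m) ?msupp_uniq //= !eqxx big1_seq ?addr0 // => m' /andP[ne m'P].
have [/(uniqm m' m'P) e|//] := boolP ((m' i1 == m i1) && (m' i2 == m i2)).
by rewrite e eqxx in ne.
Qed.

Lemma dehom_inj d P Q : P \is d.-homog -> Q \is d.-homog -> dehom P = dehom Q -> P = Q.
Proof.
move=> hP hQ e; apply/mpolyP => m; have [md|md] := eqVneq (mdeg m) d.
  by rewrite -(coef_dehom_homog hP md) e (coef_dehom_homog hQ md).
by rewrite !(dhomog_nemf_coeff _ md).
Qed.

Lemma homogX i : ('X_i : {mpoly k[3]}) \is 1.-homog.
Proof. by rewrite dhomogX /= mdeg1. Qed.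

Lemma homogXn i n : ('X_i ^+ n : {mpoly k[3]}) \is n.-homog.
Proof. by have := dhomogMn n (homogX i); rewrite mul1n. Qed.

Lemma dehom_Xn0 n : dehom ('X_i0 ^+ n) = 1.
Proof. by rewrite rmorphXn /= dehomX expr1n. Qed.

Lemma dehom_surj A : exists e P, P \is e.-homog /\ dehom P = A.
Proof.
pose good A := exists e P, P \is e.-homog /\ dehom P = A.
have goodD A1 A2 : good A1 -> good A2 -> good (A1 + A2).
  move=> [e1 [P1 [h1 <-]]] [e2 [P2 [h2 <-]]].
  exists (e1 + e2)%N, ('X_i0 ^+ e2 * P1 + 'X_i0 ^+ e1 * P2).
  rewrite rmorphD !rmorphM /= !dehom_Xn0 !mul1r; split=> //.
  apply: dhomogD; last by apply: dhomogM => //; apply: homogXn.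
  by rewrite addnC; apply: dhomogM => //; apply: homogXn.
have goodM A1 A2 : good A1 -> good A2 -> good (A1 * A2).
  move=> [e1 [P1 [h1 <-]]] [e2 [P2 [h2 <-]]]; exists (e1 + e2)%N, (P1 * P2).
  by rewrite rmorphM; split=> //; apply: dhomogM.
have goodC (r : {poly k}) : good r%:P.
  elim/poly_ind: r => [|r c IH].
    by exists 0%N, 0; rewrite rmorph0; split=> //; apply: dhomog0.
  rewrite polyCD polyCM; apply: goodD; last first.
    by exists 0%N, c%:MP; rewrite dehomC; split=> //; rewrite -[c%:MP]mulr1 mul_mpolyC; apply/dhomogZ/dhomog1.
  by apply: goodM => //; exists 1%N, 'X_i2; rewrite dehomX; split=> //; apply: homogX.
elim/poly_ind: A => [|A c IH]; first exact: (goodC 0).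
apply: goodD (goodC c); apply: goodM IH _.
by exists 1%N, 'X_i1; rewrite dehomX; split=> //; apply: homogX.
Qed.

(** The restriction to the line [x = 0]. *)
Definition at_x0 P : {mpoly k[3]} := P \mPo [tuple 0; 'X_i1; 'X_i2].
HB.instance Definition _ :=
  GRing.RMorphism.copy at_x0 (comp_mpoly [tuple 0; 'X_i1; 'X_i2]).

Lemma at_x0_eq0 P : at_x0 P = 0 -> exists Q, P = 'X_i0 * Q.
Proof.
move=> P0; have atX m : at_x0 'X_[m] = if m i0 == 0%N then 'X_[m] else 0.
  rewrite /at_x0 comp_mpolyX big3 !(tnth_nth 0) /=.
  have [m0|m0] := eqVneq (m i0) 0%N; last by rewrite expr0n (negPf m0) mul0r.
  by rewrite [RHS]mpolyXE_id big3 m0 !expr0.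
have m0 m : m \in msupp P -> (0 < m i0)%N.
  move=> mP; rewrite lt0n; apply: contraTneq mP => m0; rewrite -mcoeff_eq0.
  have := congr1 (mcoeff m) P0; rewrite {1}[P]mpolyE rmorph_sum raddf_sum mcoeff0 /=.
  rewrite (eq_bigr (fun m' => P@_m' *+ ((m' i0 == 0%N) && (m' == m)))) => [|m' _].
    have [mP|/memN_msupp_eq0 -> //] := boolP (m \in msupp P).
    rewrite (bigD1_seq m) ?msupp_uniq //= eqxx m0 eqxx big1 ?addr0 => [/eqP //|m' /negPf->].
    by rewrite andbF.
  rewrite -mul_mpolyC rmorphM /= {1}/at_x0 comp_mpolyC mul_mpolyC mcoeffZ atX.
  by case: eqP => _; rewrite ?mcoeff0 ?mulr0 // mcoeffX mulr_natr.
exists (\sum_(m <- msupp P) P@_m *: 'X_[m - U_(i0)]); rewrite mulr_sumr {1}[P]mpolyE.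
rewrite !big_seq; apply: eq_bigr => m mP; rewrite -scalerAr -mpolyXD addmC submK //.
by apply/mnm_lepP => i; rewrite mnm1E; case: eqP => //= <-; apply: m0.
Qed.

Lemma at_x0_Xn n P : (0 < n)%N -> at_x0 ('X_i0 ^+ n * P) = 0.
Proof.
move=> n0; rewrite rmorphM rmorphXn /= {1}/at_x0 comp_mpolyXU /= expr0n.
by rewrite -[n == _]negbK -lt0n n0 mul0r.
Qed.

Lemma factor_x P : P != 0 -> exists i Q, P = 'X_i0 ^+ i * Q /\ at_x0 Q != 0.
Proof.
have [n] := ubnP (msize P); elim: n P => // n IH P; rewrite ltnS => sP P0.
have [/at_x0_eq0[Q PE]|] := eqVneq (at_x0 P) 0; last by exists 0%N, P; rewrite mul1r.
have Q0 : Q != 0 by apply: contraNneq P0 => Q0; rewrite PE Q0 mulr0.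
have x0 : 'X_i0 != 0 :> {mpoly k[3]} by rewrite -msize_poly_eq0 msizeX.
have [|i [Q' [QE nz]]] := IH Q _ Q0; last first.
  by exists i.+1, Q'; rewrite PE {1}QE mulrA -exprS.
by move: sP; rewrite PE msizeM // msizeX mdeg1 add2n.
Qed.

(** The form [x] is prime. *)
Lemma cancel_x a b P Q : at_x0 P != 0 -> at_x0 Q != 0 ->
  'X_i0 ^+ a * P = 'X_i0 ^+ b * Q -> a = b /\ P = Q.
Proof.
have x0 : 'X_i0 != 0 :> {mpoly k[3]} by rewrite -msize_poly_eq0 msizeX.
have xn n : 'X_i0 ^+ n != 0 :> {mpoly k[3]} by rewrite expf_neq0.
wlog ab : a b P Q / (a <= b)%N.
  move=> H hP hQ e; case: (leqP a b) => h; first exact: H e.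
  by have [-> ->] := H b a Q P (ltnW h) hQ hP (esym e).
move=> hP hQ; rewrite -(subnKC ab) exprD -mulrA => /(mulfI (xn a)) PE.
case: (posnP (b - a)) => ba; last by move: hP; rewrite PE at_x0_Xn ?eqxx.
by rewrite PE ba mul1r addn0.
Qed.

Variables (d : nat) (F : {mpoly k[3]}).
Hypotheses (hF : F \is d.-homog) (irrF : irreducible_elt F) (F0 : at_x0 F != 0).

(** A factorization of [F(1, y, z)] homogenizes to a factorization of [F] times a
    power of [x], and the powers of [x] cancel since [x] does not divide [F]. *)
Lemma dehom_irreducible : irreducible_elt (dehom F).
Proof.
have Fn0 : F != 0 by apply: contraNneq F0 => ->; rewrite rmorph0.
move=> A B AB; have [e [P [hP PA]]] := dehom_surj A; have [f [Q [hQ QB]]] := dehom_surj B.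
have e1 : 'X_i0 ^+ (e + f) * F = 'X_i0 ^+ d * (P * Q).
  apply: (@dehom_inj (e + f + d)).
  - by apply: dhomogM => //; apply: homogXn.
  - by rewrite addnC; apply: dhomogM; [apply: homogXn | apply: dhomogM].
  - by rewrite !rmorphM /= !dehom_Xn0 !mul1r PA QB.
have x0 : 'X_i0 != 0 :> {mpoly k[3]} by rewrite -msize_poly_eq0 msizeX.
have PQ0 : P * Q != 0.
  apply: contraTneq isT => z; move/eqP: e1; rewrite z mulr0 mulf_eq0 (negPf Fn0) orbF.
  by rewrite expf_eq0 (negPf x0) andbF.
have [P0 Q0] : P != 0 /\ Q != 0 by apply/andP; rewrite -negb_or -mulf_eq0.
have [i [P' [PE nP]]] := factor_x P0; have [j [Q' [QE nQ]]] := factor_x Q0.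
have [_ FE] : (e + f)%N = (d + i + j)%N /\ F = P' * Q'.
  apply: cancel_x F0 _ _; first by rewrite rmorphM mulf_neq0.
  by rewrite e1 PE QE !exprD -!mulrA; do 2 congr (_ * _); rewrite mulrCA.
have PA' : dehom P' = A by rewrite -PA PE rmorphM /= dehom_Xn0 mul1r.
have QB' : dehom Q' = B by rewrite -QB QE rmorphM /= dehom_Xn0 mul1r.
by case: (irrF FE) => u; [left; rewrite -PA' | right; rewrite -QB']; apply: rmorph_unit.
Qed.

Lemma dehom_not_dvd f H : H \is f.-homog -> ~ (exists Q, H = Q * F) ->
  ~ (exists A, dehom H = dehom F * A).
Proof.
move=> hH nd [A AE]; apply: nd; have [e [P [hP PA]]] := dehom_surj A.
have e1 : 'X_i0 ^+ (e + d) * H = 'X_i0 ^+ f * (F * P).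
  apply: (@dehom_inj (e + d + f)).
  - by apply: dhomogM => //; apply: homogXn.
  - by rewrite addnC [(e + d)%N]addnC; apply: dhomogM; [apply: homogXn | apply: dhomogM].
  - by rewrite !rmorphM /= !dehom_Xn0 !mul1r AE PA.
have x0 n : 'X_i0 ^+ n != 0 :> {mpoly k[3]} by rewrite expf_neq0 // -msize_poly_eq0 msizeX.
have [P0|P0] := eqVneq P 0.
  exists 0; rewrite mul0r; apply: (mulfI (x0 (e + d)%N)).
  by rewrite e1 P0 !mulr0.
have [H0|H0] := eqVneq H 0; first by exists 0; rewrite mul0r.
have [i [P' [PE nP]]] := factor_x P0; have [j [H' [HE nH]]] := factor_x H0.
have [_ HE'] : (e + d + j)%N = (f + i)%N /\ H' = F * P'.
  apply: cancel_x nH _ _; first by rewrite rmorphM mulf_neq0.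
  by rewrite exprD -mulrA -HE e1 PE exprD -mulrA; congr (_ * _); rewrite mulrCA.
by exists ('X_i0 ^+ j * P'); rewrite HE HE' -mulrA; congr (_ * _); rewrite mulrC.
Qed.

End Dehomogenization.
(** * Heights on a curve in general position *)

Lemma automorphism_irreducible (T : unitRingType) (f g : {rmorphism T -> T}) (G : T) :
  cancel f g -> cancel g f -> irreducible_elt G -> irreducible_elt (f G).
Proof.
move=> fK gK irrG A B e; have {}e : G = g A * g B by rewrite -[LHS]fK e rmorphM.
have unitf H : g H \is a GRing.unit -> H \is a GRing.unit.
  by move/(rmorph_unit f); rewrite gK.
by have [/unitf u|/unitf u] := irrG _ _ e; [left | right].
Qed.

Lemma swap_irreducible (K : fieldType) (G : {poly {poly K}}) :
  irreducible_elt G -> irreducible_elt (swapXY G).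
Proof.
exact: (@automorphism_irreducible {poly {poly K}} (@swapXY K) (@swapXY K) G swapXYK swapXYK).
Qed.

Section HeightComparison.
Variables (R : realType) (k : fieldExtType rat).

Lemma vheight_le C : adelic C -> exists2 c : R, 0 <= c &
  forall (L : fieldExtType k) (s t : seq L) a b, a \in s -> a != 0 -> b \in t -> b != 0 ->
    (forall p (w : L -> R), is_base p -> lies_over p w -> smax w s <= C p * smax w t) ->
    vheight R s <= vheight R t + c.
Proof.
move=> aC; have [c c0 hc] := place_height_le k aC; exists c => // L s t a b sa a0 tb b0 h.
by apply: hc h; [apply: size_fun_smax sa a0 | apply: size_fun_smax tb b0].
Qed.

Lemma swap_ev2 (L : fieldExtType k) (t z : L) (G : {poly {poly k}}) :
  ev2 t z (swapXY G) = ev2 z t G.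
Proof.
have [N [sG sE]] : exists N, (size G <= N)%N /\ forall i, (size (G`_i)%R <= N)%N.
  exists (size G + sizeY G)%N; split; first exact: leq_addr.
  by move=> i; apply: leq_trans (max_size_coefXY _ _) (leq_addl _ _).
have sS : (size (swapXY G) <= N)%N.
  apply/leq_sizeP => j Nj; apply/polyP => i; rewrite coef_swapXY coef0 nth_default //.
  exact: leq_trans Nj.
have sSE i : (size ((swapXY G)`_i)%R <= N)%N.
  apply/leq_sizeP => j Nj; rewrite coef_swapXY.
  by rewrite (_ : G`_j = 0) ?coef0 //; apply: nth_default; apply: leq_trans Nj.
rewrite (ev2E _ _ sS) (ev2E _ _ sG).
rewrite (eq_bigr (fun i : 'I_N => \sum_(j < N) ((G`_j)`_i)%:A * t ^+ j * z ^+ i)); last first.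
  move=> i _; rewrite (ev1E _ (sSE i)) mulr_suml; apply: eq_bigr => j _.
  by rewrite coef_swapXY.
rewrite exchange_big /=; apply: eq_bigr => j _; rewrite (ev1E _ (sE j)) mulr_suml.
by apply: eq_bigr => i _; rewrite mulrAC.
Qed.

Lemma ev2_dehom (L : fieldExtType k) (t z : L) (P : {mpoly k[3]}) :
  ev2 t z (dehom P) = eval_at P (fun i => if i == i0 then 1 else if i == i1 then z else t).
Proof.
rewrite dehomE rmorph_sum eval_atE; apply: eq_bigr => m _.
rewrite rmorphM rmorphXn /= ev2X ev2C big3 /= expr1n mul1r -mul_polyC rmorphM rmorphXn /=.
by rewrite ev1C ev1X -mulrA; congr (_ * _); rewrite mulrC.
Qed.

Lemma eval_at_dehom (L : fieldExtType k) e (P : {mpoly k[3]}) (x : 'I_3 -> L) :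
  P \is e.-homog -> x i0 != 0 ->
  eval_at P x = x i0 ^+ e * ev2 (x i2 / x i0) (x i1 / x i0) (dehom P).
Proof.
move=> hP x0; rewrite ev2_dehom -(eval_at_homog _ _ hP); congr eval_at; apply/funext => i.
by case: (ord3P i) => ->; rewrite /= ?mulr1 // mulrC divfK.
Qed.

End HeightComparison.

Section GeneralPosition.
Variables (R : realType) (k : fieldExtType rat) (d s : nat) (F : {mpoly k[3]}).
Hypotheses (d0 : (0 < d)%N) (hF : F \is d.-homog) (irrF : irreducible_elt F).
Hypothesis Fy : F.@[fun i => (i == i1)%:R] != 0.
Hypothesis hs : forall m, m \in msupp F -> (m i2 <= s)%N.
Hypothesis hs' : exists2 m, m \in msupp F & m i2 = s.

Let top : 'X_{1..3} := (U_(i1) *+ d)%MM.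

Let topE : [/\ top i0 = 0%N, top i1 = d, top i2 = 0%N & mdeg top = d].
Proof. by rewrite mdeg3 !mulmnE !mnm1E /= mul0n mul1n addn0. Qed.

Let top_uniq m : mdeg m = d -> (d <= m i1)%N -> m = top.
Proof.
have [e0 e1 e2 _] := topE; rewrite mdeg3 => md mi.
by apply: mnm3_eq; rewrite ?e0 ?e1 ?e2; move: md mi; clear; lia.
Qed.

Let top_neq0 : F@_top != 0.
Proof.
have [e0 e1 e2 et] := topE; apply: contraNneq Fy => F0.
rewrite {1}[F]mpolyE raddf_sum /= big1_seq // => m /andP[_ mF].
have md : mdeg m = d by have /dhomogP/(_ m mF) := hF.
rewrite mevalZ mevalX big3 /= !expr0n expr1n mul1r.
case: eqP => [m0|]; last by rewrite !mul0r mulr0.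
case: eqP => [m2|]; last by rewrite !mulr0.
rewrite (top_uniq md) ?F0 ?mul0r //; by move: md; rewrite mdeg3 m0 m2 addn0 add0n => ->.
Qed.

Lemma at_x0_neq0 : at_x0 F != 0.
Proof.
apply: contraNneq Fy => F0; have := congr1 (meval (fun i => (i == i1)%:R)) F0.
rewrite /at_x0 comp_mpoly_meval meval0 => <-; apply/eqP/meval_eq => i.
by case: (ord3P i) => ->; rewrite (tnth_nth 0) /= ?meval0 ?mevalXU.
Qed.

Lemma dehom_sizes : size (dehom F) = d.+1 /\ forall i, (size ((dehom F)`_i)%R <= s.+1)%N.
Proof.
have [e0 e1 e2 et] := topE; split=> [|i]; last first.
  apply/leq_sizeP => j sj; rewrite coef_dehom big1_seq // => m /andP[_ /hs ms].
  by case: andP => // -[_ /eqP e]; move: sj; rewrite -e ltnNge ms.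
apply/anti_leq/andP; split; last first.
  rewrite ltnNge; apply: contraNN top_neq0 => le.
  rewrite -(coef_dehom_homog hF et) e1 e2 (_ : (dehom F)`_d = 0) ?coef0 //.
  exact: nth_default.
apply/leq_sizeP => j dj; apply/polyP => l; rewrite coef0 coef_dehom big1_seq // => m /andP[_ mF].
have : mdeg m = d by have /dhomogP/(_ m mF) := hF.
by rewrite mdeg3; case: eqP => //= e; move: dj; rewrite -e; clear; lia.
Qed.

Lemma swap_dehom_sizes : size (swapXY (dehom F)) = s.+1 /\
  forall i, (size ((swapXY (dehom F))`_i)%R <= d.+1)%N.
Proof.
have [sF sE] := dehom_sizes; split=> [|i]; last first.
  apply/leq_sizeP => j dj; rewrite coef_swapXY.
  by rewrite (_ : (dehom F)`_j = 0) ?coef0 //; apply: nth_default; rewrite sF.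
apply/anti_leq/andP; split.
  by apply/leq_sizeP => j sj; apply/polyP => i; rewrite coef_swapXY coef0 nth_default ?(leq_trans (sE i)).
have [m mF ms] := hs'; have md : mdeg m = d by have /dhomogP/(_ m mF) := hF.
rewrite ltnNge; apply: contraTN mF => le; rewrite -mcoeff_eq0.
rewrite -(coef_dehom_homog hF md) ms -coef_swapXY.
by rewrite (_ : (swapXY (dehom F))`_s = 0) ?coef0 //; apply: nth_default.
Qed.

Lemma swap_dehom_irreducible : irreducible_elt (swapXY (dehom F)).
Proof. exact: swap_irreducible (dehom_irreducible hF irrF at_x0_neq0). Qed.

(** The monomial [y^d] occurs in the equation, and the other ones are small
    where [x] and [z] are small with respect to [y]. *)
Lemma dominated_y : exists2 C : nat -> R, adelic C &
  forall (L : fieldExtType k) p (w : L -> R) x, is_base p -> lies_over p w ->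
    eval_at F x = 0 -> w (x i1) <= C p * smax w [:: x i0; x i2].
Proof.
have [e0 e1 e2 et] := topE; pose m_ (i : 'I_(size (msupp F))) := nth 0%MM (msupp F) i.
have /choice[D hD] (i : 'I_(size (msupp F))) : exists D : nat -> R, adelic D /\
    forall (L : fieldExtType k) p (w : L -> R), is_base p -> lies_over p w ->
    w (F@_(m_ i))%:A <= D p.
  by have [D aD h] := scalar_bounded R F@_(m_ i); exists D.
have aD i : adelic (D i) by case: (hD i).
have aP : adelic (fun p => \prod_i D i p) := adelic_prod (index_enum _) aD.
have [E aE hE] := scalar_bounded R (F@_top)^-1.
pose B p := kap R p ^+ size (msupp F) * \prod_i D i p.
have aB : adelic B by apply: adelicM => //; apply/adelicX/adelic_kap.
exists (fun p => E p * B p); first exact: adelicM.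
move=> L p w x bp ow Fx; have aw := over_av ow; set N := smax w _.
have N0 : 0 <= N by apply: smax_ge0.
have EB1 : 1 <= E p * B p by rewrite mulr_ege1 ?adelic_ge1.
have [le|lt] := leP (w (x i1)) N; first by apply: le_trans le _; rewrite ler_peMl.
have w1 : 0 < w (x i1) by apply: le_lt_trans lt.
have x1 : x i1 != 0 by apply: contraTneq w1 => ->; rewrite (av0 aw) ltxx.
(* Where [y] dominates, divide by it: the other two coordinates become at most
   [th], and so does every monomial except [y^d]. *)
pose y i := x i / x i1; pose th := N / w (x i1).
have th0 : 0 <= th by rewrite divr_ge0 // ltW.
have th1 : th <= 1 by rewrite ler_pdivrMr // mul1r ltW.
have Fy0 : eval_at F y = 0.
  transitivity (eval_at F (fun i => (x i1)^-1 * x i)); last by rewrite (eval_at_homog _ _ hF) Fx mulr0.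
  by congr eval_at; apply/funext => i; rewrite /y mulrC.
have wy i : i != i1 -> w (y i) <= th.
  move=> ne; rewrite /y (avM aw) (avV aw) ler_pM2r ?invr_gt0 //; apply: le_smax.
  by case: (ord3P i) ne => -> //; rewrite !inE eqxx ?orbT.
have y1 : y i1 = 1 by rewrite /y divff.
pose f i : L := if m_ i == top then 0 else (F@_(m_ i))%:A * \prod_j y j ^+ (m_ i) j.
have topE' : (F@_top)%:A = - \sum_i f i.
  apply/eqP; rewrite -addr_eq0; apply/eqP; apply: etrans Fy0.
  rewrite eval_atE (big_nth 0%MM) big_mkord.
  have tF : top \in msupp F by rewrite -[_ \in _]negbK -mcoeff_eq0 top_neq0.
  have it : (index top (msupp F) < size (msupp F))%N by rewrite index_mem.
  have mt : m_ (Ordinal it) = top by rewrite /m_ nth_index.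
  rewrite [in LHS](bigD1 (Ordinal it)) //= [in RHS](bigD1 (Ordinal it)) //= {1}/f mt eqxx add0r.
  rewrite -/(m_ (Ordinal it)) mt big3 /= e0 e1 e2 y1 expr1n !expr0 !mulr1; congr (_ + _).
  apply: eq_bigr => i ne; rewrite /f ifN //; apply: contraNneq ne => mi; apply/eqP/val_inj => /=.
  by rewrite -mi index_uniq ?msupp_uniq.
have fle i : w (f i) <= \prod_i D i p * th.
  have P0 : 0 <= \prod_i D i p * th by rewrite mulr_ge0 // ltW // (adelic_gt0 p aP).
  rewrite /f; case: eqP => [_|mt]; first by rewrite (av0 aw).
  rewrite (avM aw); apply: ler_pM; rewrite ?av_ge0 //.
    by apply: le_trans ((hD i).2 L p w bp ow) _; apply: le_adelic_prod.
  have md : mdeg (m_ i) = d by have /dhomogP/(_ (m_ i)) := hF; apply; apply: mem_nth.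
  rewrite big3 /= y1 expr1n mul1r (avM aw) !(avX aw).
  have w0 : w (y i0) <= 1 by apply: le_trans th1; apply: wy.
  have w2 : w (y i2) <= 1 by apply: le_trans th1; apply: wy.
  have pw v a : 0 <= v -> v <= th -> (0 < a)%N -> v ^+ a <= th.
    move=> v0 vt; case: a => // a _; rewrite exprS -[leRHS]mulr1; apply: ler_pM => //.
      exact: exprn_ge0.
    by apply: exprn_ile1 => //; apply: le_trans th1.
  case: (posnP (m_ i i0)) => a0; last first.
    rewrite -[leRHS]mulr1; apply: ler_pM; rewrite ?exprn_ge0 ?av_ge0 //; last first.
      by rewrite exprn_ile1 ?av_ge0.
    by apply: pw; rewrite ?av_ge0 //; apply: wy.
  rewrite a0 expr0 mul1r; apply: pw; rewrite ?av_ge0 //; first exact: wy.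
  rewrite lt0n; apply/eqP => a2; case: mt; apply: top_uniq => //.
  by move: md; rewrite mdeg3 a0 a2 addn0 add0n => ->.
have : 1 <= E p * (B p * th).
  rewrite -(av1 aw) (_ : 1 = ((F@_top)^-1)%:A * (F@_top)%:A :> L); last first.
    by rewrite -scalerAl mul1r scalerA mulVf // scale1r.
  rewrite (avM aw) topE' (avN aw); apply: ler_pM; rewrite ?av_ge0 //; first exact: hE.
  rewrite /B -mulrA; apply: kap_sum_ord => //.
  by rewrite mulr_ge0 // ltW // (adelic_gt0 p aP).
by rewrite /th !mulrA ler_pdivlMr // mul1r.
Qed.

End GeneralPosition.
Section CurveHeights.
Variables (R : realType) (k : fieldExtType rat).

Lemma vheight0 (L : fieldExtType k) (a : L) : a != 0 -> vheight R [:: 0; a] = 0.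
Proof.
move=> a0; rewrite -(vheight1 R a0); apply: place_height_eq => p w bp ow.
have aw := over_av ow; rewrite /smax !big_cons (av0 aw); apply/max_idPr.
by rewrite le_max (av_ge0 aw).
Qed.

Lemma vheight_ratio (L : fieldExtType k) (a b : L) : a != 0 ->
  vheight R [:: 1; b / a] = vheight R [:: a; b].
Proof.
move=> a0; rewrite -(@vheightZ R _ _ [:: 1; b / a] a 1) ?inE ?eqxx ?oner_neq0 //=.
by rewrite mulr1 mulrC divfK.
Qed.

Lemma eval_at_scalar (L : fieldExtType k) (P : {mpoly k[3]}) (a : 'I_3 -> k) :
  eval_at P (fun i => (a i)%:A : L) = (P.@[a])%:A.
Proof.
rewrite eval_atE [in RHS](mpolyE P) raddf_sum scaler_suml; apply: eq_bigr => m _.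
rewrite /= mevalZ mevalX -scalerA -[in LHS]scalerAl mul1r; congr (_ *: _).
rewrite -[RHS]/(in_alg L _) (rmorph_prod (in_alg L)) /=.
by apply: eq_bigr => i _; rewrite -[RHS]/(in_alg L _) (rmorphXn (in_alg L)).
Qed.

Variables (d s : nat) (F : {mpoly k[3]}).
Hypotheses (d0 : (0 < d)%N) (hF : F \is d.-homog) (irrF : irreducible_elt F).
Hypothesis Fy : F.@[fun i => (i == i1)%:R] != 0.
Hypothesis hs : forall m, m \in msupp F -> (m i2 <= s)%N.
Hypothesis hs' : exists2 m, m \in msupp F & m i2 = s.

(** The coordinate [y] is dominated by [x] and [z], which do not both vanish
    since [(0 : 1 : 0)] is not on the curve. *)
Lemma projection_height : exists2 c : R, 0 <= c &
  forall (L : fieldExtType k) (x : 'I_3 -> L), nonzero_vec x -> eval_at F x = 0 ->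
  (exists2 a, a \in [:: x i0; x i2] & a != 0) /\
  vheight R [:: x i0; x i1; x i2] <= vheight R [:: x i0; x i2] + c.
Proof.
have [C aC hC] := dominated_y R hF Fy; have [c c0 hc] := vheight_le k aC.
exists c => // L x nx Fx.
have [a ia a0] := nonzero3 nx.
have ex : exists2 a, a \in [:: x i0; x i2] & a != 0.
  have [x0|x0] := eqVneq (x i0) 0; last by exists (x i0); rewrite ?inE ?eqxx.
  have [x2|x2] := eqVneq (x i2) 0; last by exists (x i2); rewrite ?inE ?eqxx ?orbT.
  have xE : x = fun i => x i1 * ((i == i1)%:R : k)%:A.
    apply/funext => i; case: (ord3P i) => -> /=; rewrite ?x0 ?x2 ?scale0r ?mulr0 //.
    by rewrite scale1r mulr1.
  move: Fx; rewrite {1}xE (eval_at_homog _ _ hF) eval_at_scalar => /eqP.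
  rewrite mulf_eq0 scaler_eq0 (negPf Fy) oner_eq0 !orbF expf_eq0 => /andP[_ /eqP x1].
  by move: ia a0; rewrite x0 x1 x2 !inE !orbb => /eqP-> /eqP.
split=> //; have [b ib b0] := ex; apply: hc ia a0 ib b0 _ => p w bp ow.
have aw := over_av ow; have C1 := adelic_ge1 p aC.
have M0 : 0 <= smax w [:: x i0; x i2] by apply: smax_ge0.
apply: smax_le => [|u]; first by rewrite mulr_ge0 // (le_trans ler01).
rewrite !inE => /or3P[]/eqP->; last 2 [by apply: hC].
  by apply: le_trans (_ : smax w [:: x i0; x i2] <= _); rewrite ?le_smax ?inE ?eqxx // ler_peMl.
by apply: le_trans (_ : smax w [:: x i0; x i2] <= _); rewrite ?le_smax ?inE ?eqxx ?orbT // ler_peMl.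
Qed.

Lemma curve_height_upper (eps : R) : 0 < eps -> exists c : R,
  forall (L : fieldExtType k) (x : 'I_3 -> L), nonzero_vec x -> eval_at F x = 0 ->
  (exists2 a, a \in [:: x i0; x i1] & a != 0) ->
  vheight R [:: x i0; x i1] <= (s%:R / d%:R + eps) * vheight R [:: x i0; x i1; x i2] + c.
Proof.
move=> e0; have [sF cF] := dehom_sizes hF Fy hs.
have irr := dehom_irreducible hF irrF (at_x0_neq0 Fy).
have [c hc] := bidegree_bound irr sF d0 cF e0.
have [c1 c10 hc1] := vheight_le k (adelic1 R).
have co : 0 <= s%:R / d%:R + eps by rewrite addr_ge0 ?divr_ge0 // ltW.
exists (`|c| + (s%:R / d%:R + eps) * c1) => L x nx Fx nO.
have [a ia a0] := nonzero3 nx; have H2 := vheight_ge0 R ia a0.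
have [x0|x0] := eqVneq (x i0) 0.
  have x1 : x i1 != 0 by case: nO => b; rewrite !inE x0 => /orP[]/eqP-> //; rewrite eqxx.
  rewrite {1}x0 vheight0 //; apply: addr_ge0; first exact: mulr_ge0.
  by apply: addr_ge0 => //; apply: mulr_ge0.
have := hc L (x i2 / x i0) (x i1 / x i0); rewrite !vheight_ratio // => h.
apply: le_trans (h _) _.
  by move/eqP: Fx; rewrite (eval_at_dehom hF x0) mulf_eq0 expf_eq0 (negPf x0) andbF => /eqP.
rewrite addrCA addrC -mulrDr; apply: lerD; last exact: ler_norm.
rewrite ler_wpM2l //; apply: (hc1 L _ _ (x i0) (x i0)); rewrite ?inE ?eqxx //.
move=> p w bp ow; rewrite mul1r; apply: smax_sub (over_av ow) _ _ _ => b.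
by rewrite !inE => /orP[]->; rewrite ?orbT.
Qed.

Lemma curve_height_lower (eps : R) : 0 < eps -> exists c : R,
  forall (L : fieldExtType k) (x : 'I_3 -> L), nonzero_vec x -> eval_at F x = 0 ->
  (exists2 a, a \in [:: x i0; x i1] & a != 0) ->
  (s%:R / d%:R - eps) * vheight R [:: x i0; x i1; x i2] <= vheight R [:: x i0; x i1] + c.
Proof.
move=> e0; have [s0|s0] := posnP s.
  exists 0 => L x nx Fx [b ib b0]; rewrite s0 mul0r add0r addr0 mulNr.
  have [a ia a0] := nonzero3 nx; have H2 := vheight_ge0 R ia a0.
  by apply: le_trans (vheight_ge0 R ib b0); rewrite oppr_le0 mulr_ge0 // ltW.
set rho : R := s%:R / d%:R; have r0 : 0 < rho by rewrite divr_gt0 ?ltr0n.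
have [sF cF] := swap_dehom_sizes hF Fy hs hs'.
have irr := swap_dehom_irreducible hF irrF Fy.
(* This proportion works because
   [(rho - eps) * (1 / rho + eps / rho ^+ 2) = 1 - (eps / rho) ^+ 2]. *)
have e'0 : 0 < eps / rho ^+ 2 by rewrite divr_gt0 // exprn_gt0.
have [c hc] := bidegree_bound irr sF s0 cF e'0.
have [c1 c10 hc1] := projection_height; pose C := rho * (`|c| + c1).
have C0 : 0 <= C by rewrite mulr_ge0 ?addr_ge0 // ltW.
exists C => L x nx Fx [b ib b0].
have [a ia a0] := nonzero3 nx; have H2 := vheight_ge0 R ia a0.
have H1 := vheight_ge0 R ib b0.
have [neg|pos] := leP (rho - eps) 0.
  by apply: le_trans (_ : 0 <= _); [rewrite mulr_le0_ge0 | rewrite addr_ge0].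
have le_rho : rho - eps <= rho by rewrite gerBl ltW.
have [[b' ib' b'0] hproj] := hc1 L x nx Fx.
have [x0|x0] := eqVneq (x i0) 0.
  have h0 : vheight R [:: x i0; x i2] = 0.
    by rewrite x0 vheight0 //; case/or3P: ib' b'0 => // /eqP->; rewrite ?x0 ?eqxx.
  rewrite h0 add0r in hproj; apply: le_trans (_ : C <= _); last by rewrite lerDr.
  apply: ler_pM => //; first exact: ltW.
  by apply: le_trans hproj _; rewrite lerDr.
have := hc L (x i1 / x i0) (x i2 / x i0); rewrite !vheight_ratio // => h.
have {}h := h (etrans (swap_ev2 _ _ _) _).
have z : ev2 (x i2 / x i0) (x i1 / x i0) (dehom F) = 0.
  by move/eqP: Fx; rewrite (eval_at_dehom hF x0) mulf_eq0 expf_eq0 (negPf x0) andbF => /eqP.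
have {h z} h := h z.
set h2 := vheight R [:: x i0; x i1; x i2] in H2 hproj *.
set h1 := vheight R [:: x i0; x i1] in H1 h *.
have {hproj} h' : h2 <= (d%:R / s%:R + eps / rho ^+ 2) * h1 + (`|c| + c1).
  apply: le_trans hproj _; rewrite addrA lerD2r; apply: le_trans h _.
  by rewrite lerD2l ler_norm.
apply: le_trans (ler_wpM2l (ltW pos) h') _; rewrite mulrDr; apply: lerD; last first.
  by rewrite ler_wpM2r // addr_ge0.
rewrite mulrA -[leRHS]mul1r ler_wpM2r //.
have -> : d%:R / s%:R = rho^-1 :> R by rewrite /rho invf_div.
have -> : (rho - eps) * (rho^-1 + eps / rho ^+ 2) = 1 - (eps / rho) ^+ 2.
  by field; apply: lt0r_neq0.
by rewrite gerBl sqr_ge0.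
Qed.

(** Only finitely many points lie on another curve: their [z / x] is a root of
    a fixed polynomial. *)
Lemma exceptional_height f H : H \is f.-homog -> ~ (exists Q, H = Q * F) ->
  exists c : R, forall (L : fieldExtType k) (x : 'I_3 -> L), nonzero_vec x ->
    eval_at F x = 0 -> eval_at H x = 0 -> vheight R [:: x i0; x i1; x i2] <= c.
Proof.
move=> hH nd; have [sF cF] := dehom_sizes hF Fy hs.
have irr := dehom_irreducible hF irrF (at_x0_neq0 Fy).
have sF1 : (1 < size (dehom F))%N by rewrite sF ltnS.
have nd' := dehom_not_dvd hF (at_x0_neq0 Fy) hH nd.
have [r [A [B [r0 rE]]]] := irreducible_elimination irr sF1 nd'.
have [c1 hc1] := root_height R r0; have [c2 c20 hc2] := projection_height.
exists (`|c1| + c2) => L x nx Fx Hx; have [[b ib b0] hproj] := hc2 L x nx Fx.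
apply: le_trans hproj _; rewrite lerD2r; have [x0|x0] := eqVneq (x i0) 0.
  by rewrite x0 vheight0 //; case/or3P: ib b0 => // /eqP->; rewrite ?x0 ?eqxx.
rewrite -vheight_ratio //; apply: le_trans (ler_norm c1); apply: hc1.
have z P e : P \is e.-homog -> eval_at P x = 0 -> ev2 (x i2 / x i0) (x i1 / x i0) (dehom P) = 0.
  move=> hP /eqP; rewrite (eval_at_dehom hP x0) mulf_eq0 expf_eq0 (negPf x0) andbF.
  by move/eqP.
rewrite -(ev2C _ (x i1 / x i0)) rE rmorphD !rmorphM /= (z _ _ hF Fx) (z _ _ hH Hx).
by rewrite !mulr0 addr0.
Qed.

End CurveHeights.
(** * Relative heights on an arbitrary plane curve *)

Section Composition.
Variable k : fieldType.

Lemma homog_comp n l d e (P : {mpoly k[n]}) (lq : n.-tuple {mpoly k[l]}) :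
  P \is d.-homog -> (forall i, tnth lq i \is e.-homog) -> P \mPo lq \is (e * d).-homog.
Proof.
move=> /dhomogP hP hq; rewrite comp_mpolyEX big_seq; apply: rpred_sum => m /hP /= <-.
apply: dhomogZ; rewrite comp_mpolyX mdegE big_distrr /=.
elim: (index_enum _) => [|i r IH]; first by rewrite !big_nil; apply: dhomog1.
by rewrite !big_cons; apply: dhomogM IH; apply: dhomogMn.
Qed.

End Composition.

Lemma map_meval_comp (k : fieldExtType rat) (L : fieldExtType k) n l (P : {mpoly k[n]})
    (lq : n.-tuple {mpoly k[l]}) (x : 'I_l -> L) :
  (map_mpoly (in_alg L) (P \mPo lq)).@[x] =
  (map_mpoly (in_alg L) P).@[fun i => (map_mpoly (in_alg L) (tnth lq i)).@[x]].
Proof.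
rewrite comp_mpolyEX (raddf_sum (map_mpoly (in_alg L))) (raddf_sum (meval x)) map_mevalE.
apply: eq_bigr => m _; rewrite /= map_mpolyZ mevalZ comp_mpolyX; congr (_ * _).
rewrite (rmorph_prod (map_mpoly (in_alg L))) (rmorph_prod (meval x)).
by apply: eq_bigr => i _; rewrite /= rmorphXn /= (rmorphXn (meval x)).
Qed.

Section ChangeOfCoordinates.
Variables (k : fieldExtType rat) (b c : k).
Implicit Types (P Q : {mpoly k[3]}).

(** The automorphism [(x : y : z) -> (y : x + b y : z + c y)] fixes O and sends
    [(0 : 1 : 0)] to [(1 : b : c)]. *)
Definition to_general : {mpoly k[3]} -> {mpoly k[3]} :=
  comp_mpoly [tuple 'X_i1; 'X_i0 + b *: 'X_i1; 'X_i2 + c *: 'X_i1].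
HB.instance Definition _ := GRing.RMorphism.copy to_general
  (comp_mpoly [tuple 'X_i1; 'X_i0 + b *: 'X_i1; 'X_i2 + c *: 'X_i1]).

Definition of_general : {mpoly k[3]} -> {mpoly k[3]} :=
  comp_mpoly [tuple 'X_i1 - b *: 'X_i0; 'X_i0; 'X_i2 - c *: 'X_i0].
HB.instance Definition _ := GRing.RMorphism.copy of_general
  (comp_mpoly [tuple 'X_i1 - b *: 'X_i0; 'X_i0; 'X_i2 - c *: 'X_i0]).

Lemma comp_mpolyA (lq lp : 3.-tuple {mpoly k[3]}) P :
  (forall i, (tnth lq i) \mPo lp = 'X_i) -> (P \mPo lq) \mPo lp = P.
Proof.
move=> h; rewrite (comp_mpolyEX P lq) (raddf_sum (comp_mpoly lp)) [RHS]mpolyE; apply: eq_bigr => m _ /=.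
rewrite comp_mpolyZ comp_mpolyX (rmorph_prod (comp_mpoly lp)) [in RHS]mpolyXE_id; congr (_ *: _); apply: eq_bigr => i _.
by rewrite /= rmorphXn /= h.
Qed.

Lemma to_generalK : cancel to_general of_general.
Proof.
move=> P; apply: comp_mpolyA => i; case: (ord3P i) => ->; rewrite (tnth_nth 0) /=.
- by rewrite comp_mpolyXU.
- by rewrite comp_mpolyD comp_mpolyZ !comp_mpolyXU /= subrK.
- by rewrite comp_mpolyD comp_mpolyZ !comp_mpolyXU /= subrK.
Qed.

Lemma of_generalK : cancel of_general to_general.
Proof.
move=> P; apply: comp_mpolyA => i; case: (ord3P i) => ->; rewrite (tnth_nth 0) /=.
- by rewrite comp_mpolyB comp_mpolyZ !comp_mpolyXU /= addrK.
- by rewrite comp_mpolyXU.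
- by rewrite comp_mpolyB comp_mpolyZ !comp_mpolyXU /= addrK.
Qed.

Lemma to_general_homog d P : P \is d.-homog -> to_general P \is d.-homog.
Proof.
move=> hP; rewrite -[d]mul1n; apply: homog_comp hP _ => i.
by case: (ord3P i) => ->; rewrite (tnth_nth 0) /= ?dhomogD ?dhomogZ // homogX.
Qed.

Lemma order_ge_comp n P (lq : 3.-tuple {mpoly k[3]}) :
  order_ge 1 (tnth lq i0) -> order_ge 1 (tnth lq i1) -> order_ge n P -> order_ge n (P \mPo lq).
Proof.
move=> h0 h1 hP; rewrite comp_mpolyEX big_seq; apply: order_ge_sum => m /hP nm.
rewrite -mul_mpolyC -[n]add0n; apply: order_geM => //; rewrite comp_mpolyX big3 /=.
have h : order_ge (1 * m i0 + (1 * m i1 + 0))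
    (tnth lq i0 ^+ m i0 * (tnth lq i1 ^+ m i1 * tnth lq i2 ^+ m i2)).
  by do 2?[apply: order_geM]; try exact: order_ge_exp; apply: order_ge0.
by move=> m' /h; move: nm; clear; lia.
Qed.

Lemma order_ge_lin (a : k) (i j : 'I_3) : i != i2 -> j != i2 -> order_ge 1 ('X_i + a *: 'X_j).
Proof.
have X (l : 'I_3) : l != i2 -> order_ge 1 ('X_l : {mpoly k[3]}).
  move=> ne; apply: order_geX; rewrite !mnm1E.
  by case: (ord3P l) ne => ->.
move=> hi hj; apply: order_geD; first exact: X.
by rewrite -mul_mpolyC; apply: (@order_geM _ 0 1) => //; apply: X.
Qed.

Lemma to_general_order n P : order_ge n (to_general P) <-> order_ge n P.
Proof.
have lin0 (i : 'I_3) : 'X_i = 'X_i + 0 *: 'X_i0 :> {mpoly k[3]} by rewrite scale0r addr0.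
split=> h; last first.
  apply: order_ge_comp h; rewrite (tnth_nth 0) /=; last exact: order_ge_lin.
  by rewrite lin0; apply: order_ge_lin.
rewrite -[P]to_generalK; apply: order_ge_comp h; rewrite (tnth_nth 0) /=.
  by rewrite -scaleNr; apply: order_ge_lin.
by rewrite lin0; apply: order_ge_lin.
Qed.

Lemma to_general_top P :
  (to_general P).@[fun i => (i == i1)%:R] = P.@[fun i => if i == i0 then 1 else if i == i1 then b else c].
Proof.
rewrite /to_general comp_mpoly_meval; apply: meval_eq => i.
by case: (ord3P i) => ->; rewrite (tnth_nth 0) /= ?mevalD ?mevalZ !mevalXU //= mulr1 add0r.
Qed.

Lemma to_general_irreducible F : irreducible_elt F -> irreducible_elt (to_general F).
Proof. exact: (automorphism_irreducible to_generalK of_generalK). Qed.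

(** The coordinates on which the forms [to_general P] take the values of the
    forms [P]. *)
Definition general_coord (L : fieldExtType k) (x : 'I_3 -> L) : 'I_3 -> L := fun i =>
  if i == i0 then x i1 - b%:A * x i0 else if i == i1 then x i0 else x i2 - c%:A * x i0.

Lemma eval_at_general (L : fieldExtType k) P (x : 'I_3 -> L) :
  eval_at (to_general P) (general_coord x) = eval_at P x.
Proof.
rewrite /to_general /eval_at map_meval_comp; congr (meval _ _); apply/funext => i.
rewrite -/(eval_at (tnth _ i) _).
case: (ord3P i) => ->; rewrite (tnth_nth 0) /= ?eval_atD ?eval_atZ !eval_atXU //=.
- by rewrite subrK.
- by rewrite subrK.
Qed.

End ChangeOfCoordinates.
Section RelativeHeights.
Variables (R : realType) (k : fieldExtType rat).

Lemma comb_bounded (es : seq k) : exists2 C : nat -> R, adelic C &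
  forall (L : fieldExtType k) p (w : L -> R) (s : seq L) e u v,
    is_base p -> lies_over p w -> e \in es -> u \in s -> v \in s ->
    w (u - e%:A * v) <= C p * smax w s.
Proof.
elim: es => [|e es [C aC hC]]; first by exists (fun=> 1); first exact: adelic1.
have [D aD hD] := scalar_bounded R e; have ak := adelic_kap R.
exists (fun p => C p * (kap R p * D p)); first by do 2?[apply: adelicM].
move=> L p w s e' u v bp ow ie us vs; have aw := over_av ow.
have C1 := adelic_ge1 p aC; have D1 := adelic_ge1 p aD; have k1 := adelic_ge1 p ak.
have C0 := adelic_gt0 p aC; have D0 := adelic_gt0 p aD; have k0 := adelic_gt0 p ak.
have s0 : 0 <= smax w s by apply: smax_ge0.
move: ie; rewrite inE => /predU1P[->|ie]; last first.
  apply: le_trans (hC L p w s e' u v bp ow ie us vs) _; rewrite ler_wpM2r // ler_peMr ?(ltW C0) //.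
  by rewrite mulr_ege1.
apply: le_trans (_ : kap R p * D p * smax w s <= _); last first.
  by rewrite ler_wpM2r // ler_peMl // mulr_ge0 // ltW.
apply: le_trans (kapP _ _ bp ow) _; rewrite -mulrA ler_wpM2l ?(ltW k0) // ge_max (avN aw) (avM aw).
apply/andP; split; first by apply: le_trans (_ : smax w s <= _); rewrite ?le_smax // ler_peMl.
by apply: ler_pM; rewrite ?av_ge0 //; [apply: hD | apply: le_smax].
Qed.

Lemma general_coord_nonzero b c (L : fieldExtType k) (x : 'I_3 -> L) :
  nonzero_vec x -> nonzero_vec (general_coord b c x).
Proof.
move=> [i xi]; apply: contrapT => no.
have z j : general_coord b c x j = 0 by apply/eqP/negPn/negP => h; apply: no; exists j.
move: (z i0) (z i1) (z i2); rewrite /general_coord /= => e0 x0 e2.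
move: e0 e2; rewrite x0 !mulr0 !subr0 => x1 x2.
by case: (ord3P i) xi => ->; rewrite ?x0 ?x1 ?x2 eqxx.
Qed.

Lemma general_height b c : exists2 C : R, 0 <= C &
  forall (L : fieldExtType k) (x : 'I_3 -> L), nonzero_vec x ->
  let y := general_coord b c x in
  [/\ vheight R [:: x i0; x i1; x i2] <= vheight R [:: y i0; y i1; y i2] + C,
      vheight R [:: y i0; y i1; y i2] <= vheight R [:: x i0; x i1; x i2] + C &
      (exists2 a, a \in [:: x i0; x i1] & a != 0) ->
      [/\ exists2 a, a \in [:: y i0; y i1] & a != 0,
          vheight R [:: x i0; x i1] <= vheight R [:: y i0; y i1] + C &
          vheight R [:: y i0; y i1] <= vheight R [:: x i0; x i1] + C]].
Proof.
have [C aC hC] := comb_bounded [:: 0; b; c; - b; - c].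
have [C' C'0 hC'] := vheight_le k aC; exists C' => // L x nx y.
have [y0 y1 y2] : [/\ y i0 = x i1 - b%:A * x i0, y i1 = x i0 - 0%:A * x i0 &
    y i2 = x i2 - c%:A * x i0] by rewrite scale0r mul0r subr0.
have [x0 x1 x2] : [/\ x i0 = y i1 - 0%:A * y i1, x i1 = y i0 - (- b)%:A * y i1 &
    x i2 = y i2 - (- c)%:A * y i1].
  rewrite !scaleNr !mulNr !opprK scale0r mul0r subr0 /y /general_coord /=.
  by rewrite !subrK.
have ny : nonzero_vec y := general_coord_nonzero b c nx.
have [a ia a0] := nonzero3 nx; have [a' ia' a'0] := nonzero3 ny.
have bound p (w : L -> R) s t : is_base p -> lies_over p w ->
    (forall u, u \in s -> exists e v v', [/\ e \in [:: 0; b; c; - b; - c], v \in t, v' \in t &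
      u = v - e%:A * v']) -> smax w s <= C p * smax w t.
  move=> bp ow h; have aw := over_av ow; apply: smax_le => [|u /h[e [v [v' [ie iv iv' ->]]]]].
    by rewrite mulr_ge0 ?smax_ge0 // ltW // adelic_gt0.
  exact: hC.
have mem2 (u v : L) : (u \in [:: u; v]) * (v \in [:: u; v]) by rewrite !inE !eqxx orbT.
have mem3 (u v z : L) : (u \in [:: u; v; z]) * (v \in [:: u; v; z]) * (z \in [:: u; v; z]).
  by rewrite !inE !eqxx !orbT.
have memb : [/\ 0 \in [:: 0; b; c; - b; - c], b \in [:: 0; b; c; - b; - c],
    c \in [:: 0; b; c; - b; - c], - b \in [:: 0; b; c; - b; - c] & - c \in [:: 0; b; c; - b; - c]].
  by rewrite !inE !eqxx !orbT.
have [m0 mb mc mnb mnc] := memb.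
split.
- apply: hC' ia a0 ia' a'0 _ => p w bp ow; apply: bound => // u; rewrite !inE => /or3P[]/eqP->.
  + by exists 0, (y i1), (y i1); rewrite !mem3.
  + by exists (- b), (y i0), (y i1); rewrite !mem3.
  + by exists (- c), (y i2), (y i1); rewrite !mem3.
- apply: hC' ia' a'0 ia a0 _ => p w bp ow; apply: bound => // u; rewrite !inE => /or3P[]/eqP->.
  + by exists b, (x i1), (x i0); rewrite !mem3.
  + by exists 0, (x i0), (x i0); rewrite !mem3.
  + by exists c, (x i2), (x i0); rewrite !mem3.
move=> [d id d0]; have ex : exists2 a, a \in [:: y i0; y i1] & a != 0.
  have [e1|] := eqVneq (y i1) 0; last by exists (y i1); rewrite ?mem2.
  have [e0|] := eqVneq (y i0) 0; last by exists (y i0); rewrite ?mem2.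
  by move: id d0; rewrite !inE x0 x1 e0 e1 !mulr0 !subr0 orbb => ->.
have [d' id' d'0] := ex; split=> //.
- apply: hC' id d0 id' d'0 _ => p w bp ow; apply: bound => // u; rewrite !inE => /orP[]/eqP->.
  + by exists 0, (y i1), (y i1); rewrite !mem2.
  + by exists (- b), (y i0), (y i1); rewrite !mem2.
- apply: hC' id' d'0 id d0 _ => p w bp ow; apply: bound => // u; rewrite !inE => /orP[]/eqP->.
  + by exists b, (x i1), (x i0); rewrite !mem2.
  + by exists 0, (x i0), (x i0); rewrite !mem2.
Qed.

Lemma exists_nonroot (r : {poly k}) : r != 0 -> exists a, r.[a] != 0.
Proof.
move=> r0; apply: contrapT => no; pose rs : seq k := [seq n%:R | n <- iota 0 (size r)].
have : (size rs < size r)%N.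
  apply: max_poly_roots => //.
    by apply/allP => a _; apply/negPn/negP => h; apply: no; exists a.
  rewrite map_inj_uniq ?iota_uniq // => i j.
  by rewrite -!(rmorph_nat (in_alg k)) => /fmorph_inj/eqP; rewrite eqr_nat => /eqP.
by rewrite size_map size_iota ltnn.
Qed.

Lemma horner_dehom (P : {mpoly k[3]}) b c :
  ((dehom P).[b%:P]).[c] = P.@[fun i => if i == i0 then 1 else if i == i1 then b else c].
Proof.
rewrite dehomE horner_sum horner_sum {3}[P]mpolyE raddf_sum; apply: eq_bigr => m _.
rewrite /= mevalZ mevalX big3 /= expr1n mul1r !hornerE.
exact: mulrAC.
Qed.

Lemma exists_general_point d (F : {mpoly k[3]}) : F \is d.-homog -> F != 0 ->
  exists b c : k, F.@[fun i => if i == i0 then 1 else if i == i1 then b else c] != 0.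
Proof.
move=> hF F0; have D0 : dehom F != 0.
  by apply: contraNneq F0 => D0; apply/eqP/(dehom_inj hF (dhomog0 _ _ _)); rewrite D0 rmorph0.
have D0' : swapXY (dehom F) != 0 by rewrite swapXY_eq0.
have [j hj] : exists j, (swapXY (dehom F))`_j != 0.
  by exists (size (swapXY (dehom F))).-1; rewrite -[_`_ _]/(lead_coef _) lead_coef_eq0.
have [b hb] := exists_nonroot hj.
have [|c hc] := @exists_nonroot ((dehom F).[b%:P]).
  apply: contraNneq hb => e; apply/eqP; have := congr1 (fun r : {poly k} => r`_j) e.
  rewrite coef0 horner_coef coef_sum => <-; rewrite (horner_coef_wide (n := size (dehom F))).
    by apply: eq_bigr => i _; rewrite -polyC_exp coefMC coef_swapXY.
  by apply/leq_sizeP => i ?; rewrite coef_swapXY (_ : (dehom F)`_i = 0) ?coef0 //; apply: nth_default.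
by exists b, c; rewrite -horner_dehom.
Qed.

Variables (d m : nat) (F : {mpoly k[3]}).
Hypotheses (hX : integral_plane_curve F d) (hm : multiplicity_at_O F m).

Lemma curve_degree : (0 < d)%N /\ (m <= d)%N.
Proof.
have [hF F0 nu irrF] := hX; have [om nm] := multiplicity_monomials hF hm.
have /dhomogP hF' := hF; split.
  rewrite lt0n; apply: contraNneq nu => d0.
  have mz m' : m' \in msupp F -> m' = 0%MM.
    by move=> /hF' /eqP /=; rewrite d0 mdeg_eq0 => /eqP.
  have FE : F = (F@_0)%:MP.
    apply/mpolyP => m'; rewrite mcoeffC; have [->|ne] := eqVneq 0%MM m'; first by rewrite mulr1.
    rewrite mulr0 memN_msupp_eq0 //; apply: contra ne => /mz ->.
    by rewrite eqxx.
  have c0 : F@_0 != 0 by apply: contraNneq F0 => c0; rewrite FE c0 mpolyC0.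
  by rewrite FE; apply/unitrP; exists (F@_0)^-1%:MP; rewrite -!mpolyCM mulVf // mulfV.
have := mlead_supp F0 => iF; have := om _ iF; have := hF' _ iF; rewrite /= mdeg3.
by clear; lia.
Qed.

(** The two projections have degrees [d - m] and [d].  The second part, with the
    curve in general position, serves to discard the finitely many points where
    another form vanishes. *)
Lemma relative_height :
  (forall eps : R, 0 < eps -> exists c : R, forall (L : fieldExtType k) (x : 'I_3 -> L),
     nonzero_vec x -> eval_at F x = 0 -> (exists2 a, a \in [:: x i0; x i1] & a != 0) ->
     vheight R [:: x i0; x i1] <=
       ((d - m)%:R / d%:R + eps) * vheight R [:: x i0; x i1; x i2] + c /\
     ((d - m)%:R / d%:R - eps) * vheight R [:: x i0; x i1; x i2] <=
       vheight R [:: x i0; x i1] + c) /\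
  (forall f H, H \is f.-homog -> ~ (exists Q, H = Q * F) -> exists c : R,
     forall (L : fieldExtType k) (x : 'I_3 -> L), nonzero_vec x ->
       eval_at F x = 0 -> eval_at H x = 0 -> vheight R [:: x i0; x i1; x i2] <= c).
Proof.
have [hF F0 nu irrF] := hX; have [d0 md] := curve_degree.
have [om nm] := multiplicity_monomials hF hm.
have [b [c bc]] := exists_general_point hF F0.
set F' := to_general b c F.
have hF' : F' \is d.-homog by apply: to_general_homog.
have irrF' : irreducible_elt F' by apply: to_general_irreducible.
have Fy : F'.@[fun i => (i == i1)%:R] != 0 by rewrite to_general_top.
have deg m' : m' \in msupp F' -> (m' i0 + (m' i1 + m' i2))%N = d.
  by rewrite -mdeg3; have /dhomogP h := hF'; apply: h.
have om' : order_ge m F' by apply/to_general_order.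
have hs m' : m' \in msupp F' -> (m' i2 <= d - m)%N.
  by move=> i'; have := om' _ i'; have := deg _ i'; clear; lia.
have hs' : exists2 m', m' \in msupp F' & m' i2 = (d - m)%N.
  apply: contrapT => no; apply: nm; apply/(to_general_order b c) => m' i'.
  have := om' _ i'; rewrite leq_eqVlt => /predU1P[e|//]; case: no; exists m' => //.
  by have := deg _ i'; move: e; clear; lia.
have [K K0 hK] := general_height b c.
split=> [eps e0|f H hH nd].
  have [c1 hc1] := curve_height_upper d0 hF' irrF' Fy hs e0.
  have [c2 hc2] := curve_height_lower d0 hF' irrF' Fy hs hs' e0.
  set rho := (d - m)%:R / d%:R in hc1 hc2 *.
  exists (`|c1| + `|c2| + K + (`|rho + eps| * K + `|rho - eps| * K)) => L x nx Fx nO.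
  have [h2 h2' /(_ nO)[nO' h1 h1']] := hK L x nx.
  have ny := general_coord_nonzero b c nx.
  have Fx' : eval_at F' (general_coord b c x) = 0 by rewrite eval_at_general.
  have := hc1 L _ ny Fx' nO'; have := hc2 L _ ny Fx' nO'.
  move: h2 h2' h1 h1'; set H2 := vheight R [:: x i0; _; _]; set H1 := vheight R [:: x i0; _].
  set H2' := vheight _ _; set H1' := vheight _ _ => h2 h2' h1 h1' hl hu.
  have mulc (r : R) : `|r * (H2' - H2)| <= `|r| * K.
    rewrite normrM ler_wpM2l // ler_norml; apply/andP; split; lra.
  have := mulc (rho + eps); have := mulc (rho - eps); rewrite !ler_norml.
  move=> /andP[a1 a2] /andP[a3 a4].
  have := ler_norm c1; have := ler_norm c2; have := normr_ge0 c1; have := normr_ge0 c2.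
  have p1 : 0 <= `|rho + eps| * K by rewrite mulr_ge0.
  have p2 : 0 <= `|rho - eps| * K by rewrite mulr_ge0.
  move: hl hu a1 a2 a3 a4 p1 p2; rewrite !mulrBr.
  move: ((rho + eps) * H2) ((rho + eps) * H2') ((rho - eps) * H2) ((rho - eps) * H2').
  move: (`|rho + eps| * K) (`|rho - eps| * K) `|c1| `|c2| => A1 A2 A3 A4 A5 A6 A7 A8.
  by move=> *; split; lra.
have nd' : ~ exists Q, to_general b c H = Q * F'.
  move=> [Q QE]; apply: nd; exists (of_general b c Q).
  by rewrite -[LHS](to_generalK b c) QE rmorphM /= to_generalK.
have [c1 hc1] := exceptional_height R d0 hF' irrF' Fy hs (to_general_homog b c hH) nd'.
exists (c1 + K) => L x nx Fx Hx; have [h2 _ _] := hK L x nx.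
apply: le_trans h2 _; rewrite lerD2r; apply: hc1; rewrite ?eval_at_general //.
exact: general_coord_nonzero.
Qed.

End RelativeHeights.
(** * Rational curves *)

Section BezoutFamily.
Variable k : fieldType.

Lemma bezout_family (s : seq {poly k}) : (exists2 a, a \in s & a != 0) ->
  exists D (t : seq {poly k}) (u : 'I_(size t) -> {poly k}),
    [/\ D != 0, s = [seq D * b | b <- t] & \sum_i u i * t`_i = 1].
Proof.
move=> [a0 a0s a00]; pose D := \big[@gcdp k/0]_(a <- s) a.
have dvD a : a \in s -> D %| a.
  rewrite /D; elim: s {a0s D} => // b s IH; rewrite inE big_cons => /predU1P[->|/IH h].
    exact: dvdp_gcdl.
  exact: dvdp_trans (dvdp_gcdr _ _) h.
have D0 : D != 0 by apply: contraNneq a00 => D0; have := dvD _ a0s; rewrite D0 dvd0p.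
have [t sE] : exists t, s = [seq D * b | b <- t].
  exists [seq a %/ D | a <- s]; rewrite -map_comp -[LHS]map_id; apply/eq_in_map => a /dvD h /=.
  by rewrite mulrC divpK.
pose comb x := exists u : 'I_(size t) -> {poly k}, x = \sum_i u i * s`_i.
have cD x y : comb x -> comb y -> comb (x + y).
  move=> [u ->] [v ->]; exists (fun i => u i + v i); rewrite -big_split /=.
  by apply: eq_bigr => i _; rewrite mulrDl.
have cM x y : comb y -> comb (x * y).
  move=> [u ->]; exists (fun i => x * u i); rewrite mulr_sumr.
  by apply: eq_bigr => i _; rewrite mulrA.
have [u uE] : comb D.
  rewrite /D big_seq; apply: big_ind => [|x y hx hy|a].
  - by exists (fun=> 0); rewrite big1 // => i _; rewrite mul0r.
  - have := egcdpE x y => /= /eqpfP ->; rewrite -mul_polyC; apply/cM/cD; exact: cM.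
  move=> /(nthP 0)[j js <-]; have jt : (j < size t)%N by rewrite -(size_map (fun b => D * b)) -sE.
  exists (fun i => (i == Ordinal jt)%:R); rewrite (bigD1 (Ordinal jt)) //= eqxx mul1r.
  by rewrite big1 ?addr0 // => i /negPf->; rewrite mul0r.
exists D, t, u; split=> //; apply: (mulfI D0); rewrite mulr1 {2}uE mulr_sumr.
apply: eq_bigr => i _; rewrite mulrCA; congr (_ * _).
by rewrite [in RHS]sE (nth_map 0).
Qed.

End BezoutFamily.

Section RationalHeights.
Variables (R : realType) (k : fieldExtType rat).
Implicit Types (L : fieldExtType k).

(** Divide the polynomials by their greatest common divisor, and let [e] be the
    largest degree of the quotients.  Where [t] is bounded, a Bezout relation
    bounds the maximum of their values from below; elsewhere, the leading term
    of a quotient of degree [e] does. *)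
Lemma morphism_height (s : seq {poly k}) : (exists2 a, a \in s & a != 0) ->
  exists e (c : R), forall L (t : L), (exists2 a, a \in s & ev1 t a != 0) ->
  vheight R (map (ev1 t) s) <= e%:R * vheight R [:: 1; t] + c /\
  e%:R * vheight R [:: 1; t] <= vheight R (map (ev1 t) s) + c.
Proof.
move=> ex; have [D [q [u [D0 sE uE]]]] := bezout_family ex.
have [j jq jmax] : exists2 j, (j < size q)%N &
    forall i, (i < size q)%N -> (size (q`_i)%R <= size (q`_j)%R)%N.
  have q0 : (0 < size q)%N by case: ex => a; rewrite sE; case: (q).
  have [j _ jm] := @arg_maxnP _ (Ordinal q0) xpredT (fun i => size (q`_i)%R) isT.
  by exists j => // i iq; apply: (jm (Ordinal iq)).
set e := (size (q`_j)%R).-1.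
have qj0 : q`_j != 0.
  apply/eqP => z; move/eqP: uE; rewrite big1 ?(eq_sym 0) ?oner_eq0 // => i _.
  by have := jmax i (ltn_ord i); rewrite z size_poly0 leqn0 size_poly_eq0 => /eqP ->; rewrite mulr0.
have sj : size (q`_j)%R = e.+1 by rewrite /e prednK // lt0n size_poly_eq0.
have /choice[C hC] (i : 'I_(size q)) : exists C : nat -> R, adelic C /\
    forall L p (w : L -> R) (t : L), is_base p -> lies_over p w ->
      w (ev1 t q`_i) <= C p * msize1 w t ^+ e.
  have [|C aC h] := @ev1_bounded R k q`_i e; first by rewrite -sj jmax.
  by exists C.
have aC i : adelic (C i) by case: (hC i).
have aP : adelic (fun p => \prod_i C i p) := adelic_prod (index_enum _) aC.
have [B aB hB] := leading_term_dominates R qj0; rewrite -/e in hB.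
have /choice[E hE] (i : 'I_(size q)) : exists E : nat -> R, adelic E /\
    forall L p (w : L -> R) (t : L), is_base p -> lies_over p w -> w t <= B p ->
      w (ev1 t (u i)) <= E p.
  have [E aE h] := ev1_bounded R (leqnSn (size (u i))).
  exists (fun p => E p * B p ^+ size (u i)); split; first by apply/adelicM/adelicX.
  move=> L p w t bp ow tB; apply: le_trans (h L p w t bp ow) _.
  rewrite ler_wpM2l ?(ltW (adelic_gt0 p aE)) // lerXn2r ?nnegrE //.
  - by rewrite (le_trans ler01) // (msize1_ge1 t ow).
  - by rewrite ltW // adelic_gt0.
  - by apply: (msize1_le ow) => //; apply: adelic_ge1.
have aE i : adelic (E i) by case: (hE i).
have aPE : adelic (fun p => \prod_i E i p) := adelic_prod (index_enum _) aE.
have aK := adelicX (size q) (adelic_kap R).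
have aG := adelicM (adelicX e aB) (adelicM aK aPE).
have aH := adelicM aB aG.
have [c1 c10 hc1] := place_height_le k aP.
have [c2 c20 hc2] := place_height_le k aH.
exists e, (c1 + c2) => L t nz.
have Dt : ev1 t D != 0.
  by case: nz => a; rewrite sE => /mapP[b _ ->]; rewrite rmorphM mulf_eq0 negb_or => /andP[].
have [b bq bt] : exists2 b, b \in q & ev1 t b != 0.
  case: nz => a; rewrite sE => /mapP[b bq ->]; rewrite rmorphM mulf_eq0 negb_or => /andP[_ h].
  by exists b.
have -> : vheight R (map (ev1 t) s) = vheight R (map (ev1 t) q).
  rewrite -(vheightZ R Dt (map_f _ bq) bt) sE -!map_comp; congr vheight.
  by apply: eq_map => a /=; rewrite rmorphM.
have sz1 := size_funX e (size_fun_msize1 R t).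
have sz2 := size_fun_smax R (map_f (ev1 t) bq) bt.
rewrite -(place_heightX e (size_fun_msize1 R t)) /vheight; split.
  apply: le_trans (hc1 L _ _ sz2 sz1 _) _; last by rewrite lerD2l lerDl.
  move=> p w bp ow; have aw := over_av ow.
  have M0 : 0 <= msize1 w t ^+ e by rewrite exprn_ge0 // (le_trans ler01) // (msize1_ge1 t ow).
  apply: smax_le => [|x /mapP[a /(nthP 0)[i iq <-] ->]].
    by rewrite mulr_ge0 // ltW // (adelic_gt0 p aP).
  apply: le_trans ((hC (Ordinal iq)).2 L p w t bp ow) _.
  by rewrite ler_wpM2r // (le_adelic_prod (Ordinal iq) p aC).
apply: le_trans (hc2 L _ _ sz1 sz2 _) _; last by rewrite lerD2l lerDr.
move=> p w bp ow; have aw := over_av ow; set S := smax w _.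
have S0 : 0 <= S by apply: smax_ge0.
have B1 := adelic_ge1 p aB; have B0 := adelic_gt0 p aB.
have G1 := adelic_ge1 p aG; have G0 := adelic_gt0 p aG; rewrite /= in G1 G0.
case: (hB L p w t bp ow) => [tB|le]; last first.
  apply: le_trans le _; rewrite -mulrA; apply: ler_wpM2l (ltW B0) _ _ _.
  apply: le_trans (_ : S <= _); last by rewrite ler_peMl.
  by apply: le_smax; apply/map_f/mem_nth.
have MB : msize1 w t ^+ e <= B p ^+ e.
  by rewrite lerXn2r ?nnegrE ?(ltW B0) ?(msize1_le ow) // (le_trans ler01) // (msize1_ge1 t ow).
have P0 : 0 <= \prod_i E i p by rewrite ltW // (adelic_gt0 p aPE).
have : 1 <= kap R p ^+ size q * (\prod_i E i p * S).
  have e1 : w (ev1 t 1) = 1 by rewrite rmorph1 (av1 aw).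
  rewrite -[leLHS]e1 -uE rmorph_sum; apply: kap_sum_ord => // [|i].
    exact: mulr_ge0.
  rewrite rmorphM (avM aw); apply: ler_pM; rewrite ?av_ge0 //.
    by apply: le_trans ((hE i).2 L p w t bp ow tB) _; apply: le_adelic_prod.
  by apply: le_smax; apply/map_f/mem_nth.
move=> h; apply: le_trans MB _.
apply: le_trans (_ : B p ^+ e * (kap R p ^+ size q * \prod_i E i p) * S <= _).
  by rewrite -2!mulrA ler_peMr // exprn_ge0 // ltW.
by rewrite -[leRHS]mulrA ler_peMl // mulr_ge0 // ltW.
Qed.

Lemma height2_gt0 L : 0 < vheight R [:: 1; 2%:R : L].
Proof.
have [n [W [nE W1 _ WE _]]] := place_heightE R L.
have n0 : (0 < n)%N by rewrite nE muln_gt0 !adim_gt0.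
have [_ [B hB]] := size_fun_msize1 R (2%:R : L).
rewrite /vheight (WE _ B.+1) => [|p w bp ow Bp]; last by apply: (hB p) => //; apply: ltnW.
rewrite divr_gt0 //; last by rewrite ltr0n /rel_degree adim_gt0.
have ge0 p i : is_base p -> 0 <= ln (smax (W p i) [:: 1; 2%:R]).
  by move=> bp; apply: ln_ge0; apply: (msize1_ge1 _ (W1 p i bp)).
rewrite (bigD1 (Ordinal (ltn0Sn B))) //= ltr_pwDl //; last first.
  by apply: sumr_ge0 => p /andP[bp _]; apply: sumr_ge0 => i _; apply: ge0.
rewrite (bigD1 (Ordinal n0)) //= ltr_pwDl //; last by apply: sumr_ge0 => i _; apply: ge0.
apply: ln_gt0; have [aw hw] := W1 0%N (Ordinal n0) isT.
apply: lt_le_trans (msize1_ge _ _).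
by rewrite -(ratr_nat L 2) hw /base_abs /= ratr_nat normr_nat ltr1n.
Qed.

Lemma heightX L (t : L) n : vheight R [:: 1; t ^+ n] = n%:R * vheight R [:: 1; t].
Proof.
rewrite /vheight -(place_heightX n (size_fun_msize1 R t)); apply: place_height_eq => p w bp ow.
have aw := over_av ow; have [t1|t1] := leP (w t) 1.
  have -> : smax w [:: 1; t ^+ n] = 1.
    apply/eqP; rewrite eq_le (msize1_ge1 _ ow) andbT; apply: (msize1_le ow) => //.
    by rewrite (avX aw) exprn_ile1 ?av_ge0.
  have -> : msize1 w t = 1 by apply/eqP; rewrite eq_le (msize1_ge1 _ ow) (msize1_le ow).
  by rewrite expr1n.
rewrite (msize1_eq ow (ltW t1)) -(avX aw); apply: (msize1_eq ow).
by rewrite (avX aw) exprn_ege1 // ltW.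
Qed.

End RationalHeights.
Section BinaryForms.
Variable k : fieldExtType rat.
Implicit Types (P : {mpoly k[2]}).

Let j0 : 'I_2 := ord0.
Let j1 : 'I_2 := lift ord0 ord0.

Lemma big2 (T : Type) (idx : T) (op : Monoid.law idx) (f : 'I_2 -> T) :
  \big[op/idx]_(i < 2) f i = op (f j0) (f j1).
Proof. by rewrite !big_ord_recl big_ord0 Monoid.mulm1. Qed.

Lemma ord2P (i : 'I_2) : i = j0 \/ i = j1.
Proof. by case: i => -[|[|//]] h; [left|right]; apply: val_inj. Qed.

(** The polynomial [P(T, 1)]. *)
Definition affine_part P : {poly k} := \sum_(m <- msupp P) P@_m *: 'X^(m j0).

Variable L : fieldExtType k.
Implicit Type q : 'I_2 -> L.

Definition eval2 P q : L := (map_mpoly (in_alg L) P).@[q].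

Lemma eval2E P q : eval2 P q = \sum_(m <- msupp P) (P@_m)%:A * (q j0 ^+ m j0 * q j1 ^+ m j1).
Proof. by rewrite /eval2 map_mevalE; apply: eq_bigr => m _; rewrite big2. Qed.

Lemma ev1_affine_part P (t : L) : ev1 t (affine_part P) = eval2 P (fun i => if i == j0 then t else 1).
Proof.
rewrite eval2E rmorph_sum; apply: eq_bigr => m _ /=.
by rewrite expr1n mulr1 -mul_polyC rmorphM rmorphXn /= ev1C ev1X.
Qed.

Lemma eval2_homog e P (c : L) q : P \is e.-homog ->
  eval2 P (fun i => c * q i) = c ^+ e * eval2 P q.
Proof.
move=> /dhomogP hP; rewrite !eval2E mulr_sumr !big_seq; apply: eq_bigr => m /hP <-.
by rewrite /= mdegE big2 [RHS]mulrCA exprD !exprMn; congr (_ * _); rewrite mulrACA.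
Qed.

Lemma eval2_affine e P q : P \is e.-homog -> q j1 != 0 ->
  eval2 P q = q j1 ^+ e * ev1 (q j0 / q j1) (affine_part P).
Proof.
move=> hP q1; rewrite ev1_affine_part -(eval2_homog _ _ hP) /eval2; apply: meval_eq => i.
by case: (ord2P i) => -> /=; rewrite ?mulr1 // mulrC divfK.
Qed.

Lemma eval2_infinity e P q : P \is e.-homog -> q j1 = 0 ->
  eval2 P q = q j0 ^+ e * (P.@[fun i => (i == j0)%:R])%:A.
Proof.
move=> hP q1; have -> : (P.@[fun i => (i == j0)%:R])%:A = eval2 P (fun i => (i == j0)%:R).
  rewrite eval2E [in LHS](mpolyE P) raddf_sum scaler_suml; apply: eq_bigr => m _.
  rewrite /= mevalZ mevalX big2 /= -scalerA -[RHS]scalerAl mul1r; congr (_ *: _).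
  by rewrite -[LHS]/(in_alg L _) rmorphM !(rmorphXn (in_alg L)) /= scale1r scale0r.
rewrite -(eval2_homog _ _ hP) /eval2; apply: meval_eq => i.
by case: (ord2P i) => -> /=; rewrite ?mulr1 ?mulr0.
Qed.

End BinaryForms.

Lemma eval_at_minor (k : fieldExtType rat) (L : fieldExtType k) (P P' Q F : {mpoly k[3]})
    (x : 'I_3 -> L) i j :
  P * 'X_j - P' * 'X_i = Q * F -> eval_at F x = 0 -> eval_at P x * x j = eval_at P' x * x i.
Proof.
move=> e Fx; rewrite -[x j](eval_atXU j x) -[x i](eval_atXU i x).
transitivity (eval_at (P * 'X_j) x); first by rewrite eval_atM.
have -> : P * 'X_j = Q * F + P' * 'X_i by rewrite -e subrK.
by rewrite eval_atD eval_atM Fx mulr0 add0r eval_atM.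
Qed.

Section RationalCurve.
Variables (R : realType) (k : fieldExtType rat).

Lemma constant_height (s : seq k) : exists c : R, forall (L : fieldExtType k) a,
  a \in s -> a != 0 -> vheight R [seq b%:A : L | b <- s] <= c.
Proof.
have [C aC hC] : exists2 C : nat -> R, adelic C & forall (L : fieldExtType k) p (w : L -> R) a,
    is_base p -> lies_over p w -> a \in s -> w a%:A <= C p.
  elim: s => [|b s [C aC hC]]; first by exists (fun=> 1); first exact: adelic1.
  have [D aD hD] := scalar_bounded R b; exists (fun p => C p * D p); first exact: adelicM.
  move=> L p w a bp ow; have C1 := adelic_ge1 p aC; have D1 := adelic_ge1 p aD.
  have C0 := adelic_gt0 p aC; have D0 := adelic_gt0 p aD.
  rewrite inE => /predU1P[->|ia].
    by apply: le_trans (hD L p w bp ow) _; rewrite ler_peMl // ltW.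
  by apply: le_trans (hC L p w a bp ow ia) _; rewrite ler_peMr // ltW.
have [c c0 hc] := vheight_le k aC; exists c => L a ia a0.
have a1 : a%:A != 0 :> L by rewrite scaler_eq0 oner_eq0 orbF.
rewrite -[c]add0r -(vheight1 R (oner_neq0 L)).
apply: (hc L _ _ a%:A 1) => //; rewrite ?inE ?eqxx ?oner_neq0 //.
  exact: (map_f (fun b => b%:A)).
move=> p w bp ow; have aw := over_av ow.
have -> : smax w [:: 1] = 1 by rewrite /smax big_cons big_nil (av1 aw) max_l.
rewrite mulr1; apply: smax_le => [|x /mapP[b ib ->]]; last exact: hC.
by rewrite ltW // adelic_gt0.
Qed.

(** At large multiples of [T] the constant is negligible. *)
Lemma slope_le (a b c T : R) N : 0 < T ->
  (forall n, (N <= n)%N -> a * (n%:R * T) <= b * (n%:R * T) + c) -> a <= b.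
Proof.
move=> T0 h; rewrite leNgt; apply/negP => ba.
pose n := (maxn N (Num.truncn (`|c| / ((a - b) * T))).+1).
have abT : 0 < (a - b) * T by rewrite mulr_gt0 // subr_gt0.
have : `|c| / ((a - b) * T) < n%:R.
  by apply: lt_le_trans (truncnS_gt _) _; rewrite ler_nat leq_maxr.
rewrite ltr_pdivrMr // => lt.
have := h n (leq_maxl _ _); rewrite -lerBlDl -mulrBl => le.
have := le_lt_trans (le_trans le (ler_norm c)) lt.
by rewrite mulrCA ltxx.
Qed.

Variables (d m : nat) (F : {mpoly k[3]}).
Hypotheses (hX : integral_plane_curve F d) (hm : multiplicity_at_O F m).

(** On the image of the parametrization both heights are multiples of the height
    of the parameter.  The ratio of the multipliers is read off from
    [relative_height] at the parameters [2 ^ n], whose heights are unbounded. *)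
Lemma rational_relative_height : rational_curve F -> exists c : R,
  forall (L : fieldExtType k) (x : 'I_3 -> L),
    nonzero_vec x -> eval_at F x = 0 -> (exists2 a, a \in [:: x i0; x i1] & a != 0) ->
    `|vheight R [:: x i0; x i1] - (d - m)%:R / d%:R * vheight R [:: x i0; x i1; x i2]| <= c.
Proof.
have [eps exc] := relative_height R hX hm; set rho := (d - m)%:R / d%:R in eps *.
have rho0 : 0 <= rho by rewrite divr_ge0.
move=> [e [f [A [B []]]]] [hA exA FA] [hB _] _ [[i nABi] ABij].
have [c0 hc0] := eps 1 ltr01.
have bounded c : exists c', forall (L : fieldExtType k) (x : 'I_3 -> L),
    nonzero_vec x -> eval_at F x = 0 -> (exists2 a, a \in [:: x i0; x i1] & a != 0) ->
    vheight R [:: x i0; x i1; x i2] <= c ->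
    `|vheight R [:: x i0; x i1] - rho * vheight R [:: x i0; x i1; x i2]| <= c'.
  exists ((rho + 1) * c + `|c0| + rho * c) => L x nx Fx nO le.
  have [a ia a0] := nonzero3 nx; have [b ib b0] := nO.
  have H2 := vheight_ge0 R ia a0; have H1 := vheight_ge0 R ib b0.
  have [h _] := hc0 L x nx Fx nO; have r1 : 0 <= rho + 1 by rewrite addr_ge0.
  have l1 := ler_wpM2l r1 le; have l2 := ler_wpM2l rho0 le.
  have l3 := mulr_ge0 rho0 H2; have l4 := mulr_ge0 r1 H2.
  have l5 := ler_norm c0; have l6 := normr_ge0 c0.
  rewrite ler_norml; move: h l1 l2 l3 l4 l5 l6 H1.
  move: (rho * _) (rho * c) ((rho + 1) * _) ((rho + 1) * c) (`|c0|) (vheight _ _).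
  by move=> *; apply/andP; split; lra.
have hAB : tnth A i \mPo B \is (f * e).-homog by apply: homog_comp.
have [c1 hc1] := exc _ _ hAB nABi; have [c1' hc1'] := bounded c1.
pose al j := affine_part (tnth A j).
pose a j : k := (tnth A j).@[fun l => (l == ord0)%:R].
have [c2 hc2] := constant_height [:: a i0; a i1; a i2]; have [c2' hc2'] := bounded c2.
pose s3 := [:: al i0; al i1; al i2]; pose s2 := [:: al i0; al i1].
(* Outside the exceptional points, [x] is the image of its parameter [B(x)]. *)
have param (L : fieldExtType k) (x : 'I_3 -> L) : nonzero_vec x -> eval_at F x = 0 ->
    (exists2 a, a \in [:: x i0; x i1] & a != 0) ->
    [\/ `|vheight R [:: x i0; x i1] - rho * vheight R [:: x i0; x i1; x i2]| <= c1',
        `|vheight R [:: x i0; x i1] - rho * vheight R [:: x i0; x i1; x i2]| <= c2' |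
        exists t : L, [/\ exists2 a, a \in s2 & ev1 t a != 0,
          vheight R [:: x i0; x i1] = vheight R (map (ev1 t) s2) &
          vheight R [:: x i0; x i1; x i2] = vheight R (map (ev1 t) s3)]].
  move=> nx Fx nO; pose q l := eval_at (tnth B l) x.
  have qE j : eval_at (tnth A j \mPo B) x = eval2 (tnth A j) q by apply: map_meval_comp.
  have [z|nz] := eqVneq (eval_at (tnth A i \mPo B) x) 0.
    by constructor 1; apply: hc1' => //; apply: hc1.
  rewrite qE in nz; have prop j : eval2 (tnth A i) q * x j = eval2 (tnth A j) q * x i.
    by rewrite -!qE; have [Q QE] := ABij i j; apply: eval_at_minor QE Fx.
  pose la := x i / eval2 (tnth A i) q.
  have xE j : x j = la * eval2 (tnth A j) q.
    by rewrite /la mulrAC [x i * _]mulrC -prop mulrAC divff // mul1r.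
  have xi : x i != 0.
    apply/eqP => xi; have [j] := nx; rewrite xE /la xi !mul0r eqxx //.
  have la0 : la != 0 by rewrite mulf_neq0 ?invr_neq0.
  have [q1|q1] := eqVneq (q (lift ord0 ord0)) 0.
    constructor 2; apply: hc2' => //.
    pose nu := la * q ord0 ^+ e.
    have xE' j : x j = nu * (a j)%:A by rewrite xE (eval2_infinity (hA j) q1) mulrA.
    have nu0 : nu != 0 by apply: contraNneq xi => nu0; rewrite xE' nu0 mul0r.
    have ai : a i != 0 by apply: contraNneq xi => ai; rewrite xE' ai scale0r mulr0.
    have ia : a i \in [:: a i0; a i1; a i2] by rewrite !inE; case: (ord3P i) => ->; rewrite eqxx ?orbT.
    have := hc2 L _ ia ai; rewrite /= !xE'.
    rewrite -(@vheightZ R _ _ _ nu (a i)%:A) //=; first exact: (map_f (fun b => b%:A) ia).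
    by rewrite scaler_eq0 oner_eq0 orbF.
  constructor 3; exists (q ord0 / q (lift ord0 ord0)).
  set t := q ord0 / _; pose mu := la * q (lift ord0 ord0) ^+ e.
  have xE' j : x j = mu * ev1 t (al j) by rewrite xE (eval2_affine (hA j) q1) mulrA.
  have mu0 : mu != 0 by rewrite mulf_neq0 // expf_neq0.
  have ex2 : exists2 a, a \in s2 & ev1 t a != 0.
    have [b] := nO; rewrite !inE => /orP[]/eqP->; rewrite xE' mulf_eq0 negb_or => /andP[_ h].
      by exists (al i0); rewrite // !inE eqxx.
    by exists (al i1); rewrite // !inE eqxx orbT.
  have [b ib b0] := ex2; split=> //; rewrite !xE'.
    by rewrite -(vheightZ R mu0 (map_f (ev1 t) ib) b0).
  rewrite -(@vheightZ R _ _ (map (ev1 t) s3) mu (ev1 t b)) //; apply: map_f.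
  by move: ib; rewrite !inE => /orP[]->; rewrite ?orbT.
have [ex2|no2] := pselect (exists2 a, a \in s2 & a != 0); last first.
  exists (Num.max c1' c2') => L x nx Fx nO; rewrite le_max.
  have [->//|->|[t [[b ib b0] _ _]]] := param L x nx Fx nO; first by rewrite orbT.
  case: no2; exists b => //; by apply: contraNneq b0 => ->; rewrite rmorph0.
have ex3 : exists2 a, a \in s3 & a != 0.
  by have [b ib b0] := ex2; exists b => //; move: ib; rewrite !inE => /orP[]->; rewrite ?orbT.
have [e1 [c3 hc3]] := morphism_height R ex2.
have [e2 [c4 hc4]] := morphism_height R ex3.
have eE : e1%:R = rho * e2%:R.
  pose L : fieldExtType k := k^o; pose T := vheight R [:: 1; 2%:R : L].
  have T0 : 0 < T := height2_gt0 R L.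
  have [b ib b0] := ex2; have [c5 hc5] := root_height R b0.
  pose N := (Num.truncn (`|c5| / T)).+1.
  pose y n : 'I_3 -> L := fun j => ev1 (2%:R ^+ n) (al j).
  have yN n : (N <= n)%N -> ev1 (2%:R ^+ n : L) b != 0.
    move=> Nn; apply/eqP => /hc5; rewrite heightX leNgt => /negP; apply.
    apply: le_lt_trans (ler_norm c5) _; rewrite -ltr_pdivrMr //.
    by apply: lt_le_trans (truncnS_gt _) _; rewrite ler_nat.
  have Fy n : eval_at F (y n) = 0.
    transitivity (eval2 (F \mPo A) (fun l => if l == ord0 then 2%:R ^+ n else 1 : L)).
      rewrite /eval2 map_meval_comp; apply: meval_eq => j; exact: ev1_affine_part.
    by rewrite FA /eval2 raddf0 meval0.
  have yO n : (N <= n)%N -> exists2 a, a \in [:: y n i0; y n i1] & a != 0.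
    by move=> /yN nz; exists (ev1 (2%:R ^+ n) b) => //; apply: (map_f (ev1 _) ib).
  have ny n : (N <= n)%N -> nonzero_vec (y n).
    by move=> /yO[u]; rewrite !inE => /orP[]/eqP-> h; [exists i0 | exists i1].
  have bounds n : (N <= n)%N -> 
      [/\ vheight R [:: y n i0; y n i1] <= e1%:R * (n%:R * T) + c3,
          e1%:R * (n%:R * T) <= vheight R [:: y n i0; y n i1] + c3,
          vheight R [:: y n i0; y n i1; y n i2] <= e2%:R * (n%:R * T) + c4 &
          e2%:R * (n%:R * T) <= vheight R [:: y n i0; y n i1; y n i2] + c4].
    move=> Nn; have nz := yN n Nn; rewrite -heightX.
    have [|u1 u2] := hc3 L (2%:R ^+ n); first by exists b.
    have [|u3 u4] := hc4 L (2%:R ^+ n) => //.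
    by exists b => //; move: ib; rewrite !inE => /orP[]->; rewrite ?orbT.
  apply/eqP; rewrite eq_le; apply/andP; split; apply/ler_addgt0Pr => ep ep0.
    have p0 : 0 < ep / (e2%:R + 1) by rewrite divr_gt0 // ltr_wpDl.
    have pe : ep / (e2%:R + 1) * e2%:R <= ep.
      by rewrite mulrAC ler_pdivrMr ?ltr_wpDl // ler_pM2l // lerDl.
    move: (ep / _) p0 pe => ep' p0 pe; have [c hc] := eps ep' p0.
    apply: le_trans (_ : (rho + ep') * e2%:R <= _); last by rewrite mulrDl lerD2l.
    apply: (@slope_le _ _ ((rho + ep') * c4 + c + c3) T N T0) => n Nn.
    have [_ b2 b3 _] := bounds n Nn; have [h _] := hc L (y n) (ny n Nn) (Fy n) (yO n Nn).
    have r0 : 0 <= rho + ep' by rewrite addr_ge0 // ltW.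
    apply: le_trans b2 _; rewrite !addrA lerD2r; apply: le_trans h _.
    by rewrite lerD2r -mulrA -mulrDr ler_wpM2l.
  have p0 : 0 < ep / (e2%:R + 1) by rewrite divr_gt0 // ltr_wpDl.
  have pe : ep / (e2%:R + 1) * e2%:R <= ep.
    by rewrite mulrAC ler_pdivrMr ?ltr_wpDl // ler_pM2l // lerDl.
  move: (ep / _) p0 pe => ep' p0 pe; have [c hc] := eps ep' p0.
  rewrite -lerBlDr; apply: le_trans (_ : (rho - ep') * e2%:R <= _).
    by rewrite mulrBl lerD2l lerN2.
  apply: (@slope_le _ _ (c3 + c + `|rho - ep'| * c4) T N T0) => n Nn.
  have [b1 _ b3 b4] := bounds n Nn; have [_ h] := hc L (y n) (ny n Nn) (Fy n) (yO n Nn).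
  rewrite -mulrA; set H2 := vheight R [:: y n i0; y n i1; y n i2] in b3 b4 h.
  have -> : (rho - ep') * (e2%:R * (n%:R * T)) =
      (rho - ep') * H2 + (rho - ep') * (e2%:R * (n%:R * T) - H2) by rewrite -mulrDr subrKC.
  rewrite !addrA; apply: lerD.
    by apply: le_trans h _; rewrite lerD2r.
  apply: le_trans (ler_norm _) _; rewrite normrM ler_wpM2l // ler_norml.
  by move: (e2%:R * _) b3 b4 => u b3 b4; apply/andP; split; lra.
exists (Num.max (Num.max c1' c2') (c3 + rho * c4)) => L x nx Fx nO; rewrite !le_max.
have [->//|->|[t [[b ib b0] -> ->]]] := param L x nx Fx nO; first by rewrite orbT.
apply/orP; right.
have [|u1 u2] := hc3 L t; first by exists b.
have [|u3 u4] := hc4 L t.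
  by exists b => //; move: ib; rewrite !inE => /orP[]->; rewrite ?orbT.
have l3 := ler_wpM2l rho0 u3; have l4 := ler_wpM2l rho0 u4.
move: u1 u2 l3 l4; rewrite !mulrDr !mulrA -eE ler_norml.
move: (vheight R (map _ s2)) (rho * _) (rho * c4) (e1%:R * _) => *.
by apply/andP; split; lra.
Qed.

End RationalCurve.
(** * The height of O on the curve *)

Lemma not_O_coord (k : fieldExtType rat) (L : fieldExtType k) (x : 'I_3 -> L) :
  nonzero_vec x -> ~ same_point x (point_O L) -> exists2 a, a \in [:: x i0; x i1] & a != 0.
Proof.
move=> [j xj] nO; have [x0|x0] := eqVneq (x i0) 0; last by exists (x i0); rewrite ?inE ?eqxx.
have [x1|x1] := eqVneq (x i1) 0; last by exists (x i1); rewrite ?inE ?eqxx ?orbT.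
case: nO; exists (x i2).
  by case: (ord3P j) xj => ->; rewrite ?x0 ?x1 ?eqxx.
by move=> i; case: (ord3P i) => ->; rewrite /point_O /= ?mulr0 ?mulr1.
Qed.

Theorem theoremA4 (R : realType) (k : fieldExtType rat) (d m : nat)
    (F : {mpoly k[3]}) (hO : global_fun R k)
    (hX : integral_plane_curve F d)
    (hm : multiplicity_at_O F m)
    (hhO : height_function (subscheme_O k) hO) :
  (forall eps : R, 0 < eps -> exists C1 C2 : R,
     [/\ 0 < C1, 0 < C2 &
       forall (L : fieldExtType k) (x : 'I_3 -> L), on_curve_minus_O F x ->
         (m%:R / d%:R - eps) * std_height R x - C1 <= hO L x /\
         hO L x <= (m%:R / d%:R + eps) * std_height R x + C2]) /\
  (rational_curve F -> exists C : R,
     forall (L : fieldExtType k) (x : 'I_3 -> L), on_curve_minus_O F x ->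
       `|hO L x - m%:R / d%:R * std_height R x| <= C).
Proof.
have [c0 c00 hc0] := height_of_O hhO; have [d0 md] := curve_degree hX hm.
have mdE : m%:R / d%:R = 1 - (d - m)%:R / d%:R :> R.
  have dn : d%:R != 0 :> R by rewrite pnatr_eq0 -lt0n.
  by rewrite natrB // mulrBl divff // subKr.
rewrite mdE; set rho := (d - m)%:R / d%:R; split=> [eps e0|rat].
  have [c hc] := (relative_height R hX hm).1 eps e0; rewrite -/rho in hc.
  have C0 : 0 < `|c| + c0 + 1 by rewrite ltr_wpDl // addr_ge0.
  exists (`|c| + c0 + 1), (`|c| + c0 + 1); split=> // L x [nx Fx nO].
  have nO' := not_O_coord nx nO; have := hc0 L x nx nO'; have [h1 h2] := hc L x nx Fx nO'.
  rewrite (std_heightE R nx) ler_norml => /andP[h3 h4].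
  have := ler_norm c; have := normr_ge0 c.
  move: h1 h2 h3 h4; rewrite !(mulrDl, mulrBl, mul1r, mulNr).
  move: (hO L x) (vheight _ _) (vheight _ _) (`|c|) (rho * _) (eps * _).
  by move=> *; split; lra.
have [c hc] := rational_relative_height R hX hm rat; rewrite -/rho in hc.
exists (c0 + c) => L x [nx Fx nO]; have nO' := not_O_coord nx nO.
have := hc0 L x nx nO'; have := hc L x nx Fx nO'.
rewrite (std_heightE R nx) mulrBl mul1r !ler_norml => /andP[h1 h2] /andP[h3 h4].
move: h1 h2 h3 h4; move: (hO L x) (vheight _ _) (vheight _ _) (rho * _).
by move=> *; apply/andP; split; lra.
Qed.
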